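(* Let $(\xi_i)_{i\ge 1}$ be i.i.d. copies of a strictly positive random variable whose distribution function $G$ has a bounded continuous density $g$ on $(0,\infty)$ with $g(\tfrac12)>0$. For $A\subseteq\{1,\dots,n\}$ let $f_n(A)=|A|-\sum_{i=1}^{n-1}\xi_i\mathbf 1(i\in A,\ i+1\in A)$, and let $A_n^{\mathrm{opt}}$ be a subset of $\{1,\dots,n\}$ maximizing $f_n$. For $0<\delta<1$ let $$\varepsilon_n(\delta)=\min\big\{n^{-1}\big(f_n(A_n^{\mathrm{opt}})-f_n(B)\big):\ B\subseteq\{1,\dots,n\},\ |B\bigtriangleup A_n^{\mathrm{opt}}|\ge\delta n\big\}.$$ Then the limit $\bar\varepsilon(\delta):=\lim_{n\to\infty}\mathrm{E}\,\varepsilon_n(\delta)$ exists for all $0<\delta<1$, and $$\limsup_{\delta\downarrow0}\delta^{-2}\bar\varepsilon(\delta)<\infty,\qquad \liminf_{\delta\downarrow0}\delta^{-2}\bar\varepsilon(\delta)>0 .$$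
   Context: $\bigtriangleup$ denotes symmetric difference. The maximizer $A_n^{\mathrm{opt}}$ is unique with probability tending to $1$ as $n\to\infty$; when it is not unique, any fixed measurable choice of maximizer may be used. *)

(* Defs.v *)
(* MathComp / MathComp-Analysis. *)
From HB Require Import structures.
From mathcomp Require Import all_boot all_order all_algebra.
From mathcomp Require Import all_classical all_reals all_analysis.

Set Implicit Arguments.
Unset Strict Implicit.
Unset Printing Implicit Defensive.

Import Order.TTheory GRing.Theory Num.Theory.
Import numFieldNormedType.Exports.

Local Open Scope classical_set_scope.
Local Open Scope ring_scope.

(* Indices are shifted by one: {1, ..., n} is 'I_n, and xi_{i+1} is [x i]. *)

Definition fn (R : realType) (x : nat -> R) (n : nat) (A : {set 'I_n}) : R :=
  #|A|%:R - \sum_(i in A) \sum_(j in A | j == i.+1 :> nat) x i.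

Definition symdiff (T : finType) (A B : {set T}) : {set T} :=
  (A :\: B) :|: (B :\: A).

Definition maximizes (R : realType) (x : nat -> R) (n : nat)
  (A : {set 'I_n}) : Prop := forall B : {set 'I_n}, fn x B <= fn x A.

Definition gap (R : realType) (x : nat -> R) (n : nat) (A B : {set 'I_n}) : R :=
  n%:R^-1 * (fn x A - fn x B).

(* [\big[Num.min/_]] needs a default value. The complement of A is at distance
   n from A, hence an admissible B when delta <= 1, so this default does not
   change the minimum. *)
Definition eps (R : realType) (x : nat -> R) (n : nat) (A : {set 'I_n})
    (delta : R) : R :=
  \big[Num.min/gap x A (~: A)]_(B : {set 'I_n} |
    delta * n%:R <= #|symdiff B A|%:R) gap x A B.

Lemma eps_is_min (R : realType) (x : nat -> R) (n : nat) (A : {set 'I_n})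
    (delta : R) : delta <= 1 ->
  (exists2 B : {set 'I_n}, delta * n%:R <= #|symdiff B A|%:R &
     eps x A delta = gap x A B) /\
  (forall B : {set 'I_n}, delta * n%:R <= #|symdiff B A|%:R ->
     eps x A delta <= gap x A B).
Proof.
move=> d1; split; last by move=> B hB; exact: bigmin_le_cond.
have hC : delta * n%:R <= #|symdiff (~: A) A|%:R.
  rewrite (_ : symdiff _ _ = [set: 'I_n]%SET).
    by rewrite cardsT card_ord ler_piMl.
  by apply/setP => i; rewrite !inE; case: (i \in A).
rewrite /eps; elim/big_ind: _ => [|y z [B hB ->] [C hC' ->]|B hB].
- by exists (~: A)%SET.
- by rewrite /Num.min; case: ifP => _; [exists B | exists C].
- by exists B.
Qed.

Definition mutually_independent d (T : measurableType d) (R : realType)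
    (P : probability T R) (xi : nat -> {RV P >-> R}) : Prop :=
  forall (I : seq nat) (B : nat -> set R),
    uniq I -> (forall i, measurable (B i)) ->
    P (\bigcap_(i in [set` I]) xi i @^-1` B i) =
    (\prod_(i <- I) P (xi i @^-1` B i))%E.

Definition identically_distributed d (T : measurableType d) (R : realType)
    (P : probability T R) (xi : nat -> {RV P >-> R}) : Prop :=
  forall (i : nat) (B : set R), measurable B ->
    distribution P (xi i) B = distribution P (xi 0%N) B.

(* The values of g outside ]0, +oo[ are irrelevant. *)
Definition bounded_continuous_density (R : realType) (G : R -> \bar R)
    (g : R -> R) : Prop :=
  [/\ forall x, 0 < x -> 0 <= g x,
      exists M : R, forall x, 0 < x -> g x <= M,
      forall x, 0 < x -> {for x, continuous g} &
      forall x, G x = (\int[lebesgue_measure]_(t in `]0%R, x]) (g t)%:E)%E].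

(* Main.v *)
Require Import Defs.
From HB Require Import structures.
From mathcomp Require Import all_boot all_order all_algebra.
From mathcomp Require Import all_classical all_reals all_analysis.
From mathcomp Require Import ring lra zify measurable_realfun.

Set Implicit Arguments.
Unset Strict Implicit.
Unset Printing Implicit Defensive.

Import Order.TTheory GRing.Theory Num.Theory.
Import numFieldNormedType.Exports.

Local Open Scope classical_set_scope.
Local Open Scope ring_scope.

(* Write the value of a set as a constant minus a sum of edge costs: 1/2 for an edge
   with two empty ends, z - 1/2 for one with two occupied ends, 0 otherwise. Changing
   the optimal set on a run of sites between consecutive walls (edges with equal
   ends) costs only two end terms of the form 1/2 or +-(z - 1/2). A site whose two
   weights are less than c < 1/2 belongs to every optimal set; such forced sites cut
   the chain into independent pieces with exponential tails.

   Lower bound: call a site bad when it lies in a run without forced sites whose flip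
   costs less than X times its length. The density being bounded, a site is bad with
   probability O(X). A set at distance delta n therefore costs at least
   (X delta - O(X^2)) n, and X is chosen of order delta.

   Upper bound: as g(1/2) > 0, a positive multiple of h n sites can be flipped
   independently of each other, each at cost at most h. Flipping all of them moves the
   optimal set by delta n when h is of order delta, at cost O(delta^2 n).

   Limit: the optimal set of a chain agrees with those of its two halves away from the
   forced sites next to the junction, so n E eps_n is subadditive up to a constant and
   Fekete's lemma applies. *)

(** * Costs of configurations on a chain *)

(** The optimal set depends on all weights at once, so events about it have no directly computable
    probability. Each estimate is therefore reduced to events on a few nearby weights: badness of a
    site refers to all runs through it, not only to those of the optimal set, and the sites flipped
    for the upper bound carry conditions that put their neighbours into every optimal set. A forced
    site has a second role: once there is one, no optimal set leaves an edge empty. An optimal set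
    is then determined by its full edges, so it is unique unless the weights satisfy an affine
    relation with coefficients -1, 0, 1; and its complement has no full edge, hence is a cheap
    filling around a junction. The event that no site is forced is paid for separately, its
    probability being O(1/n). As uniqueness may fail there, means are computed for the largest value
    of [eps] over all maximizers, a function of the weights alone. *)

Section Chain.
Variables (R : realFieldType) (z : nat -> R).
Implicit Types b : nat -> bool.
Implicit Types (n p q i j s : nat).

(* Sites are 1, ..., n and edge j joins the sites j and j+1, for 0 <= j <= n;
   the sites 0 and n+1 are empty. The negative of f_n is, up to the constant
   (n+1)/2, the sum over all edges of an edge cost which vanishes unless both
   ends agree. *)
Definition edge_cost (c : R) (a b : bool) : R :=
  2^-1 - (a%:R + b%:R) / 2 + c * (a && b)%:R.

Definition cost n b : R := \sum_(0 <= j < n.+1) edge_cost (z j) (b j) (b j.+1).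

Definition valid n b := ~~ b 0%N /\ ~~ b n.+1.

Definition optimal n b :=
  valid n b /\ forall b', valid n b' -> cost n b <= cost n b'.

Definition flip p q b : nat -> bool := fun i => b i (+) (p < i <= q)%N.

Definition wall b j := b j == b j.+1.

Definition forced c s := (z s.-1 < c) && (z s < c).

Lemma sum_diff_edges n b b' p q : (p < q <= n)%N ->
  (forall j, (j <= n)%N -> j != p -> j != q ->
     edge_cost (z j) (b' j) (b' j.+1) = edge_cost (z j) (b j) (b j.+1)) ->
  cost n b' - cost n b =
    (edge_cost (z p) (b' p) (b' p.+1) - edge_cost (z p) (b p) (b p.+1)) +
    (edge_cost (z q) (b' q) (b' q.+1) - edge_cost (z q) (b q) (b q.+1)).
Proof.
move=> /andP[pq qn] H; rewrite /cost -sumrB !big_mkord.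
have pn : (p < n.+1)%N by lia.
have qn' : (q < n.+1)%N by lia.
rewrite (bigD1 (Ordinal pn)) //= (bigD1 (Ordinal qn')) /=; last first.
  by rewrite -val_eqE /=; lia.
rewrite big1 ?addr0 // => i /andP[i1 i2].
by rewrite H ?subrr // -ltnS.
Qed.

Lemma flip_valid n p q b : (q <= n)%N -> valid n b -> valid n (flip p q b).
Proof.
move=> qn [b0 bn]; split; rewrite /flip.
  by rewrite ltn0 /= addbF.
by rewrite [(n.+1 <= q)%N]ltnNge qn andbF addbF.
Qed.

Lemma flip_in p q b i : (p < i <= q)%N -> flip p q b i = ~~ b i.
Proof. by rewrite /flip => ->; rewrite addbT. Qed.

Lemma flip_out p q b i : ~~ (p < i <= q)%N -> flip p q b i = b i.
Proof. by rewrite /flip => /negbTE ->; rewrite addbF. Qed.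

Lemma edge_costN (c : R) (a b : bool) : a != b ->
  edge_cost c (~~ a) (~~ b) = edge_cost c a b.
Proof. by case: a; case: b => //= _; rewrite /edge_cost /=; ring. Qed.

(** Between walls the configuration alternates, and an edge with different ends costs 0 before and
    after the flip; only the edges p and q change. *)
Lemma flip_cost n p q b : (p < q <= n)%N ->
  (forall j, (p < j < q)%N -> ~~ wall b j) ->
  cost n (flip p q b) - cost n b =
    (edge_cost (z p) (b p) (~~ b p.+1) - edge_cost (z p) (b p) (b p.+1)) +
    (edge_cost (z q) (~~ b q) (b q.+1) - edge_cost (z q) (b q) (b q.+1)).
Proof.
move=> pqn H.
have e1 : flip p q b p = b p by rewrite flip_out //; lia.
have e2 : flip p q b p.+1 = ~~ b p.+1 by rewrite flip_in //; lia.
have e3 : flip p q b q = ~~ b q by rewrite flip_in //; lia.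
have e4 : flip p q b q.+1 = b q.+1 by rewrite flip_out //; lia.
rewrite (@sum_diff_edges _ _ _ p q) //; last first.
  move=> j jn jp jq.
  have [pjq|npjq] := boolP (p < j < q)%N.
    by rewrite !flip_in; [apply: edge_costN; exact: H | lia | lia].
  by rewrite !flip_out //; lia.
by rewrite e1 e2 e3 e4.
Qed.

(* If the run (p, q] of sites where b' differs from b goes on beyond a wall at q,
   then the costs of that wall for b and for b' add up to z q > 0. *)
Lemma undo_run n p q b b' : (p < q <= n)%N -> 0 < z q ->
  (forall j, (p < j < q)%N -> ~~ wall b j) ->
  b' p = b p -> (forall i, (p < i <= q)%N -> b' i = ~~ b i) ->
  (b' q.+1 = b q.+1 \/ wall b q) ->
  cost n (flip p q b) - cost n b <= cost n b' - cost n (flip p q b').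
Proof.
move=> pqn zq H bp bi bq.
have H' j : (p < j < q)%N -> ~~ wall b' j.
  move=> pjq; rewrite /wall !bi; try lia.
  by have := H j pjq; rewrite /wall; case: (b j); case: (b j.+1).
rewrite flip_cost // -[leRHS]opprB flip_cost // bp (bi p.+1); last lia.
rewrite (bi q); last lia.
rewrite !negbK [leRHS]opprD !opprB lerD2l.
case: bq => [->|]; first exact: lexx.
rewrite /wall => /eqP ->; case: (b q.+1); case: (b' q.+1);
  rewrite /edge_cost /=. all: lra.
Qed.

Definition setsite s (v : bool) b : nat -> bool := fun i => if i == s then v else b i.

Lemma add_site_cost n s b : (0 < s <= n)%N -> ~~ b s ->
  cost n (setsite s true b) - cost n b =
    z s.-1 * (b s.-1)%:R + z s * (b s.+1)%:R - 1.
Proof.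
move=> sn bs.
have e1 : setsite s true b s.-1 = b s.-1.
  by rewrite /setsite ifN //; lia.
have e2 : setsite s true b s = true by rewrite /setsite eqxx.
have e3 : setsite s true b s.+1 = b s.+1.
  by rewrite /setsite ifN //; lia.
rewrite (@sum_diff_edges _ _ _ s.-1 s); [|lia|]; last first.
  by move=> j jn j1 j2; rewrite /setsite !ifN //; lia.
have -> : s.-1.+1 = s by lia.
rewrite e1 e2 e3 (negbTE bs).
by case: (b s.-1); case: (b s.+1); rewrite /edge_cost /=; lra.
Qed.

Lemma add_forced n c s b : (0 < s <= n)%N -> 0 < c ->
  forced c s -> ~~ b s ->
  1 - 2 * c <= cost n b - cost n (setsite s true b).
Proof.
move=> sn c0 /andP[z1 z2] bs.
rewrite -[leRHS]opprB add_site_cost //.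
by case: (b s.-1); case: (b s.+1) => /=; lra.
Qed.

Lemma setsite_valid n s v b : (0 < s <= n)%N -> valid n b ->
  valid n (setsite s v b).
Proof. by move=> sn [b0 bn]; rewrite /valid /setsite !ifN //; lia. Qed.

Lemma forced_in n c s b : (0 < s <= n)%N -> 0 < c < 2^-1 ->
  forced c s -> optimal n b -> b s.
Proof.
move=> sn /andP[c0 c1] fs [vb ob]; apply/negPn/negP => bs.
have := ob _ (setsite_valid true sn vb).
have := add_forced sn c0 fs bs; lra.
Qed.

Lemma flip_opt_ge0 n p q b : (q <= n)%N -> optimal n b ->
  0 <= cost n (flip p q b) - cost n b.
Proof. by move=> qn [vb ob]; rewrite subr_ge0 ob //; exact: flip_valid. Qed.

Hypothesis z_gt0 : forall j, 0 < z j.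

(** Otherwise removing j would pay. This bounds every edge cost of an optimal configuration by 1/2,
    which the gluing needs. *)
Lemma optimal_edge_le1 n b j : (j <= n)%N -> optimal n b -> b j -> b j.+1 -> z j <= 1.
Proof.
move=> jn [vb ob] bj bj1.
have j0 : (0 < j)%N by case: j bj {bj1 jn} => // b0; move: vb => [/negP].
have jn' : (0 < j <= n)%N by rewrite j0.
have bs : ~~ setsite j false b j by rewrite /setsite eqxx.
have := ob _ (setsite_valid false jn' vb).
have := add_site_cost jn' bs.
have -> : cost n (setsite j true (setsite j false b)) = cost n b.
  have E k : setsite j true (setsite j false b) k = b k.
    by rewrite /setsite; case: eqP => // ->; rewrite bj.
  by apply: eq_bigr => i _; rewrite !E.
have -> : setsite j false b j.-1 = b j.-1 by rewrite /setsite ifN //; lia.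
have -> : setsite j false b j.+1 = b j.+1 by rewrite /setsite ifN //; lia.
rewrite bj1; have := z_gt0 j.-1; case: (b j.-1) => /=; lra.
Qed.

(* Flipping the run between two neighbouring walls, one of which is empty,
   would lower the cost. *)
Lemma empty_edge_only_wall n b e e' : optimal n b -> (e <= n)%N -> (e' <= n)%N ->
  ~~ b e -> ~~ b e.+1 -> e != e' -> ~~ wall b e'.
Proof.
move=> ob en e'n be be1 ee'; apply/negP => we'.
have [lt|lt] : (e < e')%N \/ (e' < e)%N by lia.
- have ex : exists j, (e < j <= n)%N && wall b j.
    by exists e'; rewrite lt e'n.
  case: (ex_minnP ex) => q /andP[eqn wq] qmin.
  have H j : (e < j < q)%N -> ~~ wall b j.
    move=> ejq; apply/negP => wj; have := qmin j.
    by rewrite wj andbT => /(_ ltac:(lia)); lia.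
  have qn : (q <= n)%N by lia.
  have := flip_opt_ge0 e qn ob; rewrite flip_cost //.
  move: wq; rewrite /wall => /eqP <-; rewrite (negbTE be) (negbTE be1) /edge_cost.
  by have := z_gt0 q; case: (b q) => /=; lra.
- have ex : exists j, (j < e)%N && wall b j by exists e'; rewrite lt.
  have ub j : (j < e)%N && wall b j -> (j <= e)%N by lia.
  case: (ex_maxnP ex ub) => q /andP[qe wq] qmax.
  have H j : (q < j < e)%N -> ~~ wall b j.
    move=> ejq; apply/negP => wj; have := qmax j.
    by rewrite wj andbT => /(_ ltac:(lia)); lia.
  have qn : (q < e <= n)%N by lia.
  have := flip_opt_ge0 q en ob; rewrite flip_cost //.
  move: wq; rewrite /wall => /eqP <-; rewrite (negbTE be) (negbTE be1) /edge_cost.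
  by have := z_gt0 q; case: (b q) => /=; lra.
Qed.

(** An empty edge e would be the only wall, so b alternates from e to the occupied site s. Flipping
    the run in between changes the cost of edge e from 1/2 to 0 and that of the edge next to s from
    0 to less than c - 1/2, a strict gain. *)
Lemma forced_no_empty_edge n c b s e : (0 < s <= n)%N -> 0 < c < 2^-1 ->
  forced c s -> optimal n b -> (e <= n)%N -> b e || b e.+1.
Proof.
move=> sn c12 fs ob en; apply/negPn/negP; rewrite negb_or => /andP[be be1].
have bs := forced_in sn c12 fs ob.
have nw j : (j <= n)%N -> j != e -> ~~ wall b j.
  by move=> jn je; apply: (empty_edge_only_wall ob en) => //; rewrite eq_sym.
have se : s != e by apply/eqP => E; move: be; rewrite -E bs.
have se1 : s != e.+1 by apply/eqP => E; move: be1; rewrite -E bs.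
move: fs => /andP[f1 f2]; move: c12 => /andP[c0 c1].
have [lt|lt] : (e < s.-1)%N \/ (s < e)%N by lia.
- have sn1 : (e < s.-1 <= n)%N by lia.
  have := flip_opt_ge0 e (proj2 (andP sn1)) ob.
  rewrite flip_cost //; last by move=> j jj; apply: nw; lia.
  have -> : s.-1.+1 = s by lia.
  have := nw s.-1; rewrite /wall; have -> : s.-1.+1 = s by lia.
  move=> /(_ ltac:(lia) ltac:(lia)); rewrite bs (negbTE be) (negbTE be1).
  by case: (b s.-1) => //= _; rewrite /edge_cost /=; lra.
- have sn1 : (s < e <= n)%N by lia.
  have := flip_opt_ge0 s en ob.
  rewrite flip_cost //; last by move=> j jj; apply: nw; lia.
  have := nw s; rewrite /wall.
  move=> /(_ ltac:(lia) ltac:(lia)); rewrite bs (negbTE be) (negbTE be1).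
  by case: (b s.+1) => //= _; rewrite /edge_cost /=; lra.
Qed.

Definition cnt n (P : pred nat) : nat := \sum_(1 <= i < n.+1) P i.

Lemma cnt_run n p q : cnt n (fun i => p < i <= q)%N = (minn q n - minn p n)%N.
Proof.
rewrite /cnt; elim: n => [|n IH]; first by rewrite big_geq.
by rewrite big_nat_recr //= IH; lia.
Qed.

Lemma le_cnt n (P Q : pred nat) :
  (forall i, (0 < i <= n)%N -> P i -> Q i) -> (cnt n P <= cnt n Q)%N.
Proof.
move=> H; rewrite /cnt !big_nat; apply: leq_sum => i.
by move=> /H; case: (P i); case: (Q i) => // ->.
Qed.

Lemma cntD n (P Q S : pred nat) :
  (forall i, (0 < i <= n)%N -> (P i : nat) = Q i + S i)%N ->
  cnt n P = (cnt n Q + cnt n S)%N.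
Proof.
move=> H; rewrite /cnt -big_split /= !big_nat; apply: eq_bigr => i.
by move=> /H.
Qed.

(* Flipping a run (p, q] without walls costs the sum of two end terms, each of
   them 1/2 or +-(z - 1/2); these are the ways in which it can be below y. *)
Definition small_ends p q (y : R) := [|| 1 <= y, `|z q| < y, `|z q - 1| < y |
  (0 < p)%N && [|| `|z p| < y, `|z p - 1| < y, `|z q - z p| < y |
                  `|z q + z p - 1| < y]].

(** A boolean fold over a list, so that measurability follows by induction on the list. *)
Definition unforced c p q := \big[andb/true]_(p.+1 <= s < q.+1) ~~ forced c s.

Lemma unforcedP c p q :
  reflect (forall s, (p < s <= q)%N -> ~~ forced c s) (unforced c p q).
Proof.
rewrite /unforced big_all; apply: (iffP allP) => H s.
  by move=> ps; apply: H; rewrite mem_index_iota; lia.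
by rewrite mem_index_iota => ps; apply: H; lia.
Qed.

Definition bad c x p q := unforced c p q && small_ends p q (x * (q - p)%:R).

Definition bad_site c x n i :=
  [exists p : 'I_n.+1, exists q : 'I_n.+1, (p < i <= q)%N && bad c x p q].

Lemma small_endsI p q y u v : 0 < z p -> 0 < z q -> 0 <= u + v < y ->
  u = 2^-1 \/ (0 < p)%N /\ (u = z p - 2^-1 \/ u = 2^-1 - z p) ->
  v = 2^-1 \/ v = z q - 2^-1 \/ v = 2^-1 - z q ->
  small_ends p q y.
Proof.
move=> zp zq /andP[h1 h2] hu hv; rewrite /small_ends !ltr_norml.
by case: hu => [|[p0 []]] Eu; case: hv => [|[]] Ev; rewrite ?p0; apply/or4P;
  first [ solve [constructor 1; lra]
  | solve [constructor 2; apply/andP; split; lra]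
  | solve [constructor 3; apply/andP; split; lra]
  | constructor 4; apply/or4P; first [
       solve [constructor 1; apply/andP; split; lra]
     | solve [constructor 2; apply/andP; split; lra]
     | solve [constructor 3; apply/andP; split; lra]
     | solve [constructor 4; apply/andP; split; lra]]].
Qed.

Lemma small_ends_run n c s b p q y : (0 < s <= n)%N -> 0 < c < 2^-1 ->
  forced c s -> optimal n b -> (p < q <= n)%N ->
  (forall j, (p < j < q)%N -> ~~ wall b j) ->
  cost n (flip p q b) - cost n b < y -> small_ends p q y.
Proof.
move=> sn c12 fs ob pqn H.
have qn : (q <= n)%N by lia.
have pn : (p <= n)%N by lia.
have := flip_opt_ge0 p qn ob; rewrite flip_cost //.
have := forced_no_empty_edge sn c12 fs ob qn.
have := forced_no_empty_edge sn c12 fs ob pn.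
(* Site 0 is empty, so a run starting at p = 0 has left end term 1/2. *)
have p0 : b p -> (0 < p)%N by case: p {pqn H pn} => // b0; move: ob => [[/negP]].
move=> ep eq h1 h2; have := conj h1 h2; move/andP => h12.
apply: (small_endsI (z_gt0 p) (z_gt0 q) h12).
- case: (b p) p0 ep => [|_] /=.
    move=> /(_ isT) p0 _; right; split => //.
    by case: (b p.+1); [right|left]; rewrite /edge_cost /=; lra.
  by move=> ->; left; rewrite /edge_cost /=; lra.
- case: (b q) eq => /=; last first.
    by move=> ->; right; left; rewrite /edge_cost /=; lra.
  case: (b q.+1) => _; last by left; rewrite /edge_cost /=; lra.
  by right; right; rewrite /edge_cost /=; lra.
Qed.

(** Induction on the number of sites where b' and b differ: b' is moved back to b in steps, each
    gaining at least x per repaired site that is not bad. A step either adds a missing forced site,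
    which gains 1 - 2c >= x, or undoes one run. *)
Lemma lower_count n c s b x : (0 < s <= n)%N -> 0 < c < 2^-1 ->
  forced c s -> optimal n b -> 0 <= x <= 1 - 2 * c ->
  forall b', valid n b' ->
  x * (cnt n (fun i => (b i != b' i) && ~~ bad_site c x n i))%:R
    <= cost n b' - cost n b.
Proof.
move=> sn c12 fs ob /andP[x0 xc] b'.
have [m] := ubnP (cnt n (fun i => b i != b' i)).
elim: m b' => // m IH b' hm vb'.
have [vb mb] := ob.
(* It is enough to repair a nonempty set D of differing sites; the rest is the induction hypothesis
   for b''. *)
have step b'' (D : pred nat) : valid n b'' ->
    (forall i, (0 < i <= n)%N -> D i -> b i != b' i) ->
    (forall i, (0 < i <= n)%N -> b'' i = if D i then b i else b' i) ->
    (0 < cnt n D)%N ->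
    x * (cnt n (fun i => D i && ~~ bad_site c x n i))%:R <= cost n b' - cost n b'' ->
    x * (cnt n (fun i => (b i != b' i) && ~~ bad_site c x n i))%:R <= cost n b' - cost n b.
  move=> vb'' HD Hb D0 HC.
  have E1 : cnt n (fun i => b i != b' i) = (cnt n D + cnt n (fun i => b i != b'' i))%N.
    apply: cntD => i hi; rewrite Hb //; have := HD i hi.
    by case: (D i) => [/(_ isT) ->|_]; rewrite ?eqxx ?addn0 ?add0n.
  have E2 : cnt n (fun i => (b i != b' i) && ~~ bad_site c x n i) =
      (cnt n (fun i => D i && ~~ bad_site c x n i) +
       cnt n (fun i => (b i != b'' i) && ~~ bad_site c x n i))%N.
    apply: cntD => i hi; rewrite Hb //; have := HD i hi.
    by case: (D i) => [/(_ isT) ->|_]; rewrite ?eqxx ?addn0 ?add0n.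
  rewrite E2 natrD mulrDr.
  have := IH b'' ltac:(clear -E1 D0 hm; lia) vb''; lra.
have [/existsP[i /andP[/andP[bi fi] i0]]|nf] :=
    boolP [exists i : 'I_n.+1, (b i != b' i) && forced c i && (0 < i)%N].
  have hi : (0 < i <= n)%N by rewrite i0 -ltnS ltn_ord.
  have bt := forced_in hi c12 fi ob.
  have b'f : ~~ b' i by move: bi; rewrite bt; case: (b' i).
  have ci : cnt n (pred1 (i : nat)) = 1%N.
    transitivity (cnt n (fun j => i.-1 < j <= i)%N); last by rewrite cnt_run; clear -hi; lia.
    by rewrite /cnt; apply: eq_bigr => j _ /=; congr nat_of_bool; clear -i0; lia.
  apply: (step (setsite i true b') (pred1 (i : nat))).
  - exact: setsite_valid.
  - by move=> j _ /eqP ->.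
  - by move=> j _ /=; rewrite /setsite; case: eqP => [->|].
  - by rewrite ci.
  have le1 : (cnt n (fun j => (j == i :> nat) && ~~ bad_site c x n j) <= 1)%N.
    by rewrite -[leqRHS]ci; apply: le_cnt => j _ /andP[].
  have := @add_forced n c i b' hi ltac:(clear -c12; lra) fi b'f.
  have : x * (cnt n (fun j => (j == i :> nat) && ~~ bad_site c x n j))%:R <= x.
    by rewrite ler_piMr // -[1]/(1%:R) ler_nat.
  lra.
have [D0|D1] := posnP (cnt n (fun i => b i != b' i)).
  rewrite (_ : cnt _ _ = 0%N) ?mulr0 ?subr_ge0 ?mb //.
  apply/eqP; rewrite -leqn0 -[leqRHS]D0; apply: le_cnt => i _ /andP[] //.
have exD : exists i, (0 < i <= n)%N && (b i != b' i).
  apply: contrapT => H; move: D1; suff -> : cnt n (fun i => b i != b' i) = 0%N by [].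
  rewrite /cnt big_nat big1 // => i hi; apply/eqP; rewrite eqb0.
  by apply/negP => bi; apply: H; exists i; rewrite bi andbT; clear -hi; lia.
case: (ex_minnP exD) => p1 /andP[p1n bp1] pmin.
(* The repaired run starts at the first differing site p1 and stops where the difference ends or at
   the first wall of b, whichever comes first. *)
have exq : exists j, (p1 <= j <= n)%N && ((b j.+1 == b' j.+1) || wall b j).
  exists n; rewrite leqnn; move: p1n => /andP[_ ->] /=.
  by move: vb vb' => [_ /negbTE ->] [_ /negbTE ->].
case: (ex_minnP exq) => q /andP[p1q hq] qmin.
set p := p1.-1.
have Ep : p.+1 = p1 by clear -p1n; rewrite /p; lia.
have pqn : (p < q <= n)%N by clear -p1n p1q Ep; lia.
have run j : (p < j < q)%N -> (b j.+1 != b' j.+1) && ~~ wall b j.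
  move=> pj; rewrite -negb_or; apply/negP => hj.
  by have := qmin j; rewrite hj andbT => /(_ ltac:(clear -pj pqn Ep; lia)); clear -pj; lia.
have H j : (p < j < q)%N -> ~~ wall b j by move=> /run /andP[].
have Hb j : (p < j <= q)%N -> b' j = ~~ b j.
  move=> pj; have : b j != b' j.
    have [->//|ne] := eqVneq j p1.
    have : (p < j.-1 < q)%N by clear -pj ne Ep; lia.
    by move=> /run /andP[]; rewrite prednK; last by clear -pj; lia.
  by case: (b j); case: (b' j).
have Hp : b' p = b p.
  have [p0|p0] := posnP p.
    by rewrite p0; move: vb vb' => [/negbTE -> _] [/negbTE -> _].
  apply/eqP; rewrite eq_sym; apply/negPn/negP => bp.
  by have := pmin p; rewrite bp andbT => /(_ ltac:(clear -Ep p0 p1n; lia)); clear -Ep; lia.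
have Hq : b' q.+1 = b q.+1 \/ wall b q.
  by case/orP: hq => [/eqP ->|]; [left | right].
have := undo_run pqn (z_gt0 q) H Hp Hb Hq.
set DD := cost n (flip p q b) - cost n b => hD.
have DD0 : 0 <= DD by apply: flip_opt_ge0 => //; clear -pqn; lia.
have crun : cnt n (fun i => p < i <= q)%N = (q - p)%N.
  by rewrite cnt_run; clear -pqn; lia.
apply: (step (flip p q b') (fun i => p < i <= q)%N).
- by apply: flip_valid => //; clear -pqn; lia.
- by move=> i _ pi; rewrite Hb //; case: (b i).
- move=> i _; case: ifP => pi; first by rewrite flip_in // Hb // negbK.
  by rewrite flip_out // pi.
- by rewrite crun; clear -pqn; lia.
(* Either undoing the run gains x times its length, or the run is cheap. As b and b' now agree at
   forced sites, it contains none, so all its sites are bad and nothing has to be gained. *)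
apply: le_trans hD; have [lt|ge] := ltP DD (x * (q - p)%:R); last first.
  apply: le_trans ge; rewrite ler_wpM2l // ler_nat -crun.
  by apply: le_cnt => i _ /andP[].
rewrite (_ : cnt _ _ = 0%N) ?mulr0 //.
rewrite /cnt; apply: big1 => i _; apply/eqP; rewrite eqb0 negb_and negbK.
have [pi|//] := boolP (p < i <= q)%N; rewrite /=.
have pn1 : (p < n.+1)%N by clear -pqn; lia.
have qn1 : (q < n.+1)%N by clear -pqn; lia.
apply/existsP; exists (Ordinal pn1); apply/existsP; exists (Ordinal qn1).
rewrite pi /bad /= (small_ends_run sn c12 fs ob pqn H lt) andbT.
apply/unforcedP => t pt; apply/negP => ft.
have tn : (t < n.+1)%N by clear -pt pqn; lia.
move/existsP: nf; apply; exists (Ordinal tn); rewrite /= ft Hb //.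
by case: (b t) => /=; clear -pt; lia.
Qed.

End Chain.

(** * Gluing two chains *)

Definition splice s (u v : nat -> bool) : nat -> bool :=
  fun i => if (i <= s)%N then u i else v i.

Section Gluing.
Variables (R : realFieldType).
Implicit Types (z : nat -> R) (n p q i j s : nat) (b : nat -> bool).

Lemma splice_cost_left z n s u v : (s <= n)%N -> u s = v s ->
  cost z n (splice s u v) - cost z n v =
  \sum_(0 <= j < s) (edge_cost (z j) (u j) (u j.+1) - edge_cost (z j) (v j) (v j.+1)).
Proof.
move=> sn E; rewrite /cost -sumrB (big_cat_nat (n := s)) //=; last by lia.
rewrite [X in _ + X = _]big_nat [X in _ + X = _]big1 ?addr0.
  by rewrite !big_nat; apply: eq_bigr => j js; rewrite /splice !ifT //; lia.
move=> j js; rewrite /splice (_ : (j.+1 <= s)%N = false); last lia.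
by case: (leqP j s) => js'; rewrite ?subrr // (_ : j = s) ?E ?subrr //; lia.
Qed.

Lemma splice_cost_right z n s u v : (s <= n)%N -> u s = v s ->
  cost z n (splice s u v) - cost z n u =
  \sum_(s <= j < n.+1) (edge_cost (z j) (v j) (v j.+1) - edge_cost (z j) (u j) (u j.+1)).
Proof.
move=> sn E; rewrite /cost -sumrB (big_cat_nat (n := s)) //=; last by lia.
rewrite [X in X + _ = _]big_nat [X in X + _ = _]big1 ?add0r.
  rewrite !big_nat; apply: eq_bigr => j js.
  rewrite /splice (_ : (j.+1 <= s)%N = false); last lia.
  by case: (leqP j s) => js' //; rewrite (_ : j = s) ?E //; lia.
by move=> j js; rewrite /splice !ifT ?subrr //; lia.
Qed.

Lemma splice_valid n s u v : (s <= n)%N -> ~~ u 0%N -> ~~ v n.+1 ->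
  valid n (splice s u v).
Proof.
by move=> sn u0 vn; rewrite /valid /splice leq0n [(n.+1 <= s)%N]leqNgt ltnS sn.
Qed.

(** Configurations are functions on all of nat, hence the comparison on the sites 1, ..., n only. *)
Definition unique_optimal z n b := optimal z n b /\
  forall b', optimal z n b' -> forall i, (0 < i <= n)%N -> b' i = b i.

(** Exchange argument: both are occupied at s, so their parts left of s can be swapped. The two
    changes of cost are opposite and neither is negative; the splice is therefore optimal for the
    long chain too, and uniqueness identifies it with b. *)
Lemma agree_left z n n1 s b b1 : unique_optimal z n b -> optimal z n1 b1 ->
  (0 < s <= n1)%N -> (n1 <= n)%N -> b s -> b1 s ->
  forall i, (i <= s)%N -> b1 i = b i.
Proof.
move=> [[[b0 bn] ob] ub] [[b10 b1n] ob1] sn n1n bs b1s i si.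
have h1 := @splice_cost_left z n s b1 b ltac:(lia) ltac:(by rewrite bs b1s).
have h2 := @splice_cost_left z n1 s b b1 ltac:(lia) ltac:(by rewrite bs b1s).
have E : cost z n (splice s b1 b) - cost z n b =
    cost z n1 b1 - cost z n1 (splice s b b1).
  by rewrite h1 -opprB h2 -sumrN; apply: eq_bigr => j _; rewrite opprB.
have v1 : valid n (splice s b1 b) by apply: splice_valid => //; lia.
have v2 : valid n1 (splice s b b1) by apply: splice_valid => //; lia.
have opt : optimal z n (splice s b1 b).
  split=> // b' vb'; apply: le_trans (ob _ vb').
  by rewrite -subr_le0 E subr_le0 ob1.
have [->|i0] := posnP i; first by rewrite (negbTE b0) (negbTE b10).
have := ub _ opt i ltac:(clear -i0 si sn n1n; lia).
by rewrite /splice si.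
Qed.

Lemma agree_right z n1 n2 s b b2 : unique_optimal z (n1 + n2) b ->
  optimal (fun j => z (n1 + j)%N) n2 b2 ->
  (0 < s <= n2)%N -> b (n1 + s)%N -> b2 s ->
  forall i, (s <= i <= n2.+1)%N -> b2 i = b (n1 + i)%N.
Proof.
move=> [[[b0 bn] ob] ub] [[b20 b2n] ob2] sn bs b2s i si.
pose v i := b2 (i - n1)%N.
have vs : v (n1 + s)%N = b2 s by rewrite /v addKn.
have e1 : b (n1 + s)%N = v (n1 + s)%N by rewrite vs bs b2s.
have e2 : b2 s = b (n1 + s)%N by rewrite bs b2s.
have h1 := @splice_cost_right z (n1 + n2) (n1 + s) b v ltac:(clear -sn; lia) e1.
have h2 := @splice_cost_right (fun j => z (n1 + j)%N) n2 s b2 (fun i => b (n1 + i)%N)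
  ltac:(clear -sn; lia) e2.
have E : cost z (n1 + n2) (splice (n1 + s) b v) - cost z (n1 + n2) b =
    cost (fun j => z (n1 + j)%N) n2 b2 -
    cost (fun j => z (n1 + j)%N) n2 (splice s b2 (fun i => b (n1 + i)%N)).
  rewrite h1 -opprB h2 -sumrN -addnS [(n1 + n2.+1)%N]addnC [(n1 + s)%N]addnC.
  rewrite big_addn addnK; apply: eq_bigr => j _.
  by rewrite /v -addSn !addnK [(j + n1)%N]addnC [(j.+1 + n1)%N]addnC opprB.
have v1 : valid (n1 + n2) (splice (n1 + s) b v).
  by apply: splice_valid => //; [clear -sn; lia | rewrite /v -addnS addKn].
have v2 : valid n2 (splice s b2 (fun i => b (n1 + i)%N)).
  by apply: splice_valid => //; [clear -sn; lia | rewrite addnS].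
have opt : optimal z (n1 + n2) (splice (n1 + s) b v).
  split=> // b' vb'; apply: le_trans (ob _ vb').
  by rewrite -subr_le0 E subr_le0 ob2.
have [->|ni] := eqVneq i n2.+1; first by rewrite (negbTE b2n) addnS (negbTE bn).
have := ub _ opt (n1 + i)%N ltac:(clear -si ni sn; lia).
rewrite /splice leq_add2l /v addKn; case: (leqP i s) => // h _.
have -> : i = s by clear -h si; lia.
by rewrite bs b2s.
Qed.

Lemma edge_cost_ge (c : R) (a e : bool) : 0 < c -> - 2^-1 <= edge_cost c a e.
Proof. by case: a; case: e => c0; rewrite /edge_cost /=; lra. Qed.

Lemma edge_cost_le (c : R) (a e : bool) : (a -> e -> c <= 1) -> edge_cost c a e <= 2^-1.
Proof.
case: a; case: e => h; rewrite /edge_cost /=; try lra.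
Qed.

Lemma sum_geq m a : (\sum_(0 <= j < m) (a <= j) = m - a)%N.
Proof.
elim: m => [|m IH]; first by rewrite big_geq.
by rewrite big_nat_recr //= IH; lia.
Qed.

Lemma sum_leq m a : (\sum_(0 <= j < m) (j <= a) = minn m a.+1)%N.
Proof.
elim: m => [|m IH]; first by rewrite big_geq // min0n.
by rewrite big_nat_recr //= IH; lia.
Qed.

(* Outside the zone from s1 to s2 the optimal configuration of the whole chain
   agrees with those of the two halves, so B1 and B2 can be copied there; inside
   the zone the complement of b is used, which is as far from b as possible. *)
Lemma glue z n1 n2 c b b1 b2 B1 B2 s s1 s2 (n := (n1 + n2)%N)
    (z2 := fun j => z (n1 + j)%N) :
  (forall j, 0 < z j) -> 0 < c < 2^-1 ->
  unique_optimal z n b -> optimal z n1 b1 -> optimal z2 n2 b2 ->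
  valid n1 B1 -> valid n2 B2 ->
  (0 < s <= n)%N -> forced z c s ->
  (s1 <= n1)%N -> (0 < s1)%N ==> forced z c s1 ->
  (n1 < s2 <= n.+1)%N -> (s2 <= n)%N ==> forced z c s2 ->
  exists B, [/\ valid n B,
    (cnt n1 (fun i => b1 i != B1 i) + cnt n2 (fun i => b2 i != B2 i) <=
       cnt n (fun i => b i != B i))%N &
    cost z n B - cost z n b <= (cost z n1 B1 - cost z n1 b1) +
      (cost z2 n2 B2 - cost z2 n2 b2) + (2 * (s2 - s1) + 5)%:R].
Proof.
move=> z0 c12 ub ob1 ob2 vB1 vB2 sn fs s1n f1 s2n f2.
have ob := ub.1.
have vb := ob.1.
have bs1 : (0 < s1)%N -> b s1 /\ b1 s1.
  move=> s0; move: f1; rewrite s0 => f1; split.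
    by apply: (forced_in _ c12 f1 ob); clear -s0 s1n n; lia.
  by apply: (forced_in _ c12 f1 ob1); clear -s0 s1n; lia.
have bs2 : (s2 <= n)%N -> b s2 /\ b2 (s2 - n1)%N.
  move=> s0; move: f2; rewrite s0 => f2; split.
    by apply: (forced_in _ c12 f2 ob); clear -s0 s2n; lia.
  apply: (forced_in (z := z2) (c := c) _ c12 _ ob2).
    by clear -s0 s2n; lia.
  rewrite /forced /z2 subnKC; last by clear -s2n; lia.
  rewrite (_ : n1 + (s2 - n1).-1 = s2.-1)%N //; clear -s2n; lia.
have agl i : (i <= s1)%N -> b1 i = b i.
  move=> is1; have [s10|s10] := posnP s1.
    rewrite (_ : i = 0%N); last by clear -is1 s10; lia.
    by rewrite (negbTE vb.1) (negbTE ob1.1.1).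
  have [h1 h2] := bs1 s10.
  by apply: (agree_left ub ob1 _ _ h1 h2) => //; clear -s10 s1n n; lia.
have agr i : (s2 <= n1 + i <= n.+1)%N -> b2 i = b (n1 + i)%N.
  move=> is2; have [s2n1|s2n1] := leqP s2 n; last first.
    rewrite (_ : i = n2.+1)%N; last by clear -is2 s2n1; lia.
    by rewrite addnS (negbTE vb.2) (negbTE ob2.1.2).
  have [h1 h2] := bs2 s2n1.
  apply: (@agree_right z n1 n2 (s2 - n1)) => //.
  - by clear -s2n s2n1; lia.
  - by rewrite subnKC //; clear -s2n; lia.
  - by clear -is2; lia.
pose B i := if (i < s1)%N then B1 i else if (i <= s2)%N then
  (0 < i <= n)%N && ~~ b i else B2 (i - n1)%N.
have F1g j : (j <= n1)%N -> -1 <= edge_cost (z j) (B1 j) (B1 j.+1) - edge_cost (z j) (b1 j) (b1 j.+1).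
  move=> jn; have := edge_cost_ge (B1 j) (B1 j.+1) (z0 j).
  have := @edge_cost_le (z j) (b1 j) (b1 j.+1) (optimal_edge_le1 z0 jn ob1); lra.
have z20 j : 0 < z2 j by exact: z0.
have F2g j : (j <= n2)%N -> -1 <= edge_cost (z2 j) (B2 j) (B2 j.+1) - edge_cost (z2 j) (b2 j) (b2 j.+1).
  move=> jn; have := edge_cost_ge (B2 j) (B2 j.+1) (z20 j).
  have := @edge_cost_le (z2 j) (b2 j) (b2 j.+1) (optimal_edge_le1 z20 jn ob2); lra.
(* When s1 and s2 are sites, b occupies them and the complement does not, so the edges where the
   three parts of B meet are not full. *)
have Bs1 : (0 < s1)%N -> B s1 = false.
  move=> s10; rewrite /B ltnn ifT; last by clear -s1n s2n; lia.
  by rewrite (bs1 s10).1 andbF.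
have Bs2 : B s2 = false.
  rewrite /B ifN; last by clear -s1n s2n; lia.
  rewrite leqnn; case: (leqP s2 n) => h; last by rewrite andbF.
  by rewrite (bs2 h).1 andbF.
(* b has no empty edge, so its complement has no full one: an edge of the zone costs at most 1/2,
   against at least -1/2 for b. *)
have Fz j : (s1 <= j.+1)%N -> (j <= s2)%N -> (j <= n)%N ->
    edge_cost (z j) (B j) (B j.+1) - edge_cost (z j) (b j) (b j.+1) <= 1.
  move=> h1 h2 h3; have := edge_cost_ge (b j) (b j.+1) (z0 j).
  suff : edge_cost (z j) (B j) (B j.+1) <= 2^-1 by lra.
  apply: edge_cost_le => Bj Bj1.
  have ne1 : j != s2 by apply/eqP => E; move: Bj; rewrite E Bs2.
  have ne2 : j.+1 != s1.
    by apply/eqP => E; move: Bj1; rewrite E Bs1 //; clear -E; lia.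
  have l1 : (j < s1)%N = false by clear -h1 ne2; lia.
  have l2 : (j.+1 < s1)%N = false by clear -h1 ne2; lia.
  have l3 : (j.+1 <= s2)%N by clear -h2 ne1; lia.
  move: Bj Bj1; rewrite /B l1 l2 h2 l3.
  move=> /andP[_ bj] /andP[_ bj1].
  by have := forced_no_empty_edge z0 sn c12 fs ob h3; rewrite (negbTE bj) (negbTE bj1).
exists B; split.
- split.
    rewrite /B; case: ifP => _; first exact: vB1.1.
    by rewrite leq0n.
  rewrite /B ifN; last by clear -s1n n; lia.
  rewrite ltnn andbF; case: ifP => // _.
  by rewrite /n -addnS addKn; exact: vB2.2.
- rewrite /cnt [leqRHS](big_cat_nat (n := n1.+1)) //=; last by clear -n; lia.
  apply: leq_add; rewrite !big_nat.
    apply: leq_sum => i hi; have [lt|ge] := ltnP i s1.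
      by rewrite /B lt agl // ltnW.
    rewrite /B ifN -?leqNgt // ifT; last by clear -hi s2n; lia.
    rewrite (_ : (0 < i <= n)%N); last by clear -hi n; lia.
    by case: (b i) => /=; exact: leq_b1.
  rewrite -!big_nat (_ : n.+1 = n2.+1 + n1)%N; last by rewrite /n addSn addnC.
  rewrite -[n1.+1]add1n big_addn addnK !big_nat; apply: leq_sum => i hi.
  rewrite [(i + n1)%N]addnC; have [lt|ge] := ltnP s2 (n1 + i).
    have l0 : (n1 + i < s1)%N = false by clear -s1n; lia.
    have l1 : (n1 + i <= s2)%N = false by clear -lt; lia.
    by rewrite /B l0 l1 addKn agr //; clear -lt hi n; lia.
  have l0 : (n1 + i < s1)%N = false by clear -s1n; lia.
  rewrite /B l0 ge (_ : (0 < n1 + i <= n)%N); last by clear -hi n; lia.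
  by case: (b (n1 + i)%N) => /=; exact: leq_b1.
rewrite /cost -!sumrB.
set F := fun j => edge_cost (z j) (B j) (B j.+1) - edge_cost (z j) (b j) (b j.+1).
set F1 := fun j => edge_cost (z j) (B1 j) (B1 j.+1) - edge_cost (z j) (b1 j) (b1 j.+1).
set F2 := fun j => edge_cost (z2 j) (B2 j) (B2 j.+1) - edge_cost (z2 j) (b2 j) (b2 j.+1).
rewrite -/(\sum_(0 <= j < n.+1) F j) -/(\sum_(0 <= j < n1.+1) F1 j) -/(\sum_(0 <= j < n2.+1) F2 j).
have L1 : \sum_(0 <= j < n1) F j <= \sum_(0 <= j < n1) (F1 j + (2 * (s1.-1 <= j))%:R).
  rewrite !big_nat; apply: ler_sum => j /andP[_ jn1].
  have [lt|ge] := ltnP j s1.-1.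
    rewrite muln0 addr0 /F /F1.
    have e0 : (j < s1)%N by clear -lt; lia.
    have e1 : (j.+1 < s1)%N by clear -lt; lia.
    by rewrite /B e0 e1 !agl // ltnW.
  have h1 := Fz j ltac:(clear -ge; lia) ltac:(clear -jn1 s2n; lia) ltac:(clear -jn1 n; lia).
  have h2 := F1g j (ltnW jn1).
  by rewrite muln1; move: h1 h2; rewrite /F /F1; lra.
have L2 : \sum_(0 <= j < n2.+1) F (j + n1)%N <= \sum_(0 <= j < n2.+1) (F2 j + (2 * (j <= s2 - n1)%N)%:R).
  rewrite !big_nat; apply: ler_sum => j /andP[_ jn2]; rewrite [(j + n1)%N]addnC.
  have [ge|lt] := leqP j (s2 - n1).
    have h1 := Fz (n1 + j)%N ltac:(clear -s1n; lia) ltac:(clear -ge s2n; lia) ltac:(clear -jn2 n; lia).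
    have h2 := F2g j ltac:(clear -jn2; lia).
    by rewrite muln1; move: h1 h2; rewrite /F /F2; lra.
  rewrite muln0 addr0 /F /F2 /z2.
  have e0 : (n1 + j < s1)%N = false by clear -s1n; lia.
  have e1 : ((n1 + j).+1 < s1)%N = false by clear -s1n; lia.
  have e2 : (n1 + j <= s2)%N = false by clear -lt s2n; lia.
  have e3 : ((n1 + j).+1 <= s2)%N = false by clear -lt s2n; lia.
  rewrite /B e0 e1 e2 e3 -addnS !addKn !agr //; first by clear -lt s2n jn2 n; lia.
  by clear -lt s2n jn2 n; lia.
(* The halves together have one edge more than the whole chain. This surplus edge n1 of the first
   half accounts for 1, and the at most s2 - s1 + 2 edges of the zone for 2 each: together 2(s2 -
   s1) + 5. *)
have L3 : -1 <= F1 n1 by exact: F1g.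
rewrite (big_cat_nat (n := n1)) //=; last by clear -n; lia.
rewrite -{2}[n1]add0n big_addn (_ : n.+1 - n1 = n2.+1)%N; last by clear -n; lia.
rewrite (big_nat_recr n1 0 F1) //=.
have addc m (f : nat -> R) (k : nat -> nat) :
    \sum_(0 <= j < m) (f j + (2 * k j)%:R) =
    \sum_(0 <= j < m) f j + 2 * (\sum_(0 <= j < m) k j)%:R.
  rewrite big_split /=; congr (_ + _).
  by rewrite natr_sum big_distrr /=; apply: eq_bigr => j _; rewrite natrM.
move: L1 L2; rewrite !addc sum_geq sum_leq.
set S1 := \sum_(0 <= j < n1) F1 j; set S2 := \sum_(0 <= j < n2.+1) F2 j.
set k1 := (n1 - s1.-1)%N; set k2 := minn _ _ => L1 L2.
have : (k1 + k2 <= s2 - s1 + 2)%N.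
  by rewrite /k1 /k2; clear -s1n s2n; lia.
rewrite -(ler_nat R) natrD [X in _ <= X -> _]natrD => k12.
by rewrite [X in _ <= _ + _ + X]natrD natrM; lra.
Qed.

End Gluing.

(** * Explicit competitors, and recovery of an optimal configuration from its full edges *)

Section Witnesses.
Variables (R : realFieldType) (z : nat -> R).
Implicit Types (n p q i j s : nat) (b : nat -> bool).
Hypothesis z_gt0 : forall j, 0 < z j.

(** Site 0 is empty, so edge 0 is never full; this absorbs the different weight that a shifted
    sequence has there. *)
Lemma cost_ext (z' : nat -> R) n b b' :
  (forall j, (0 < j)%N -> z' j = z j) -> ~~ b 0%N ->
  (forall i, (i <= n.+1)%N -> b' i = b i) -> cost z' n b' = cost z n b.
Proof.
move=> zz b0 bb; rewrite /cost !big_nat; apply: eq_bigr => j /andP[_ jn].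
rewrite !bb //; last by rewrite ltnW.
have [->|j0] := posnP j; first by rewrite /edge_cost (negbTE b0) !mulr0.
by rewrite zz.
Qed.

Lemma optimal_ext (z' : nat -> R) n b b' :
  (forall j, (0 < j)%N -> z' j = z j) ->
  (forall i, (i <= n.+1)%N -> b' i = b i) -> optimal z n b -> optimal z' n b'.
Proof.
move=> zz bb [[b0 bn] ob]; split.
  by split; rewrite bb.
move=> b2 [b20 b2n]; rewrite (@cost_ext z' n b b') // (@cost_ext z' n b2 b2) //.
exact: ob.
Qed.

(* The complement of an optimal b, with one end of its only empty edge removed. *)
Lemma far_competitor n b : (0 < n)%N -> optimal z n b ->
  exists B, [/\ valid n B, (n.-1 <= cnt n (fun i => b i != B i))%N &
    cost z n B - cost z n b <= n%:R].
Proof.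
move=> n0 ob; have vb := ob.1.
(* e is the empty inner edge if there is one, and 0 otherwise. *)
have [e He] : exists e, forall j, (0 < j < n)%N -> j != e -> b j || b j.+1.
  have [/existsP[e /andP[en be]]|ne] :=
      boolP [exists e : 'I_n, (0 < e)%N && ~~ (b e || b e.+1)].
    exists (nat_of_ord e) => j jn je; apply/negPn/negP; rewrite negb_or => /andP[b1 b2].
    move: be; rewrite negb_or => /andP[b3 b4].
    have e_n : (e <= n)%N by rewrite ltnW.
    have j_n : (j <= n)%N by clear -jn; lia.
    have := empty_edge_only_wall z_gt0 ob j_n e_n b1 b2 je.
    by rewrite /wall (negbTE b3) (negbTE b4).
  exists 0%N => j jn _; apply/negPn/negP => bj; move/existsP: ne; apply.
  have jn' : (j < n)%N by clear -jn; lia.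
  by exists (Ordinal jn'); rewrite /= bj andbT; clear -jn; lia.
pose B i := [&& (0 < i <= n)%N, i != e & ~~ b i].
exists B; split.
- by split; rewrite /B ?ltnn ?andbF.
- have -> : n.-1 = (cnt n (fun i => 0 < i <= n)%N - 1)%N.
    by rewrite cnt_run; clear -n0; lia.
  rewrite leq_subLR (_ : 1 + _ = cnt n (fun i => b i != B i) + 1)%N; last by rewrite addnC.
  have ce : (cnt n (fun i => (e.-1 < i <= e)%N) <= 1)%N.
    by rewrite cnt_run; clear; lia.
  apply: leq_trans (leq_add (leqnn _) ce); rewrite /cnt -big_split /= !big_nat.
  apply: leq_sum => i hi; rewrite /B.
  have -> : (0 < i <= n)%N by clear -hi; lia.
  have [ie|ie] /= := eqVneq i e; last by case: (b i).
  have -> : (e.-1 < i <= e)%N by rewrite -ie; clear -hi; lia.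
  by rewrite leq_addl.
(* The two end edges contribute at most 1/2 each and the n - 1 inner ones at most 1 each: n in
   all. *)
rewrite /cost -sumrB big_nat_recr //= big_ltn //.
have E0 : edge_cost (z 0) (B 0) (B 1) - edge_cost (z 0) (b 0) (b 1) <= 2^-1.
  rewrite (negbTE vb.1) /B /= /edge_cost /=.
  by case: (b 1%N); case: (_ && _) => /=; lra.
have En : edge_cost (z n) (B n) (B n.+1) - edge_cost (z n) (b n) (b n.+1) <= 2^-1.
  rewrite (negbTE vb.2) /B ltnn andbF /= /edge_cost /=.
  by case: (b n); case: (_ && _) => /=; lra.
have Ej : \sum_(1 <= j < n) (edge_cost (z j) (B j) (B j.+1) - edge_cost (z j) (b j) (b j.+1)) <= (n - 1)%:R.
  rewrite -[leRHS]mulr1 mulr_natl -sumr_const_nat !big_nat.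
  apply: ler_sum => j jn; have := edge_cost_ge (b j) (b j.+1) (z_gt0 j).
  suff : edge_cost (z j) (B j) (B j.+1) <= 2^-1 by lra.
  apply: edge_cost_le => /and3P[_ je bj] /and3P[_ _ bj1].
  by have := He j jn je; rewrite (negbTE bj) (negbTE bj1).
move: Ej; rewrite natrB //; lra.
Qed.

(** With both neighbours occupied, flipping site i changes the cost by z_{i-1} + z_i - 1 up to sign,
    whatever its state. No two spots are adjacent, so each edge is affected by at most one flip and
    the changes add up. *)
Lemma flip_spots n b (sp : pred nat) h : valid n b ->
  (forall i, sp i -> [/\ (0 < i <= n)%N, b i.-1, b i.+1, ~~ sp i.+1 &
      `|1 - z i.-1 - z i| <= h]) ->
  exists B, [/\ valid n B, cnt n (fun i => b i != B i) = cnt n sp &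
    cost z n B - cost z n b <= h * (cnt n sp)%:R].
Proof.
move=> [b0 bn] H; pose B i := b i (+) sp i.
have s0 : sp 0%N = false by apply/negbTE/negP => /H[].
have sn : sp n.+1 = false by apply/negbTE/negP => /H[]; rewrite ltnn andbF.
exists B; split.
- by split; rewrite /B ?s0 ?sn addbF.
- by rewrite /cnt; apply: eq_bigr => i _; rewrite /B; case: (b i); case: (sp i).
pose al j : R := if sp j.+1 then edge_cost (z j) (b j) (~~ b j.+1) - edge_cost (z j) (b j) (b j.+1) else 0.
pose be j : R := if sp j then edge_cost (z j) (~~ b j) (b j.+1) - edge_cost (z j) (b j) (b j.+1) else 0.
rewrite /cost -sumrB (eq_bigr (fun j => al j + be j)); last first.
  move=> j _; rewrite /al /be /B.
  have [s1|s1] := boolP (sp j).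
    have [_ _ _ /negbTE -> _] := H j s1.
    by rewrite addbT addbF add0r.
  by rewrite addbF; case: (sp j.+1); rewrite ?addbT ?addbF ?addr0 ?subrr.
rewrite big_split /= big_nat_recr //= {2}/al sn addr0.
rewrite [X in _ + X]big_nat_recl // {1}/be s0 add0r.
rewrite -big_split /= /cnt natr_sum mulr_sumr.
rewrite -[1%N in leRHS]add0n -[n.+1 in leRHS]addn1 big_addn addn1 subn1 /= !big_nat.
apply: ler_sum => i _; rewrite addn1 /al /be.
have [s1|s1] := boolP (sp i.+1); last by rewrite addr0 mulr0.
have [_ /= b1 b2 _] := H _ s1; rewrite b1 b2 mulr1 ler_norml => /andP[h1 h2].
by case: (b i.+1); rewrite /edge_cost /=; lra.
Qed.

(** Read from left to right: as no edge is empty, the site after an empty one is occupied, and the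
    site after an occupied one is given by whether the edge is full. *)
Lemma optimal_determined n b b' c s : (0 < s <= n)%N -> 0 < c < 2^-1 ->
  forced z c s -> optimal z n b -> optimal z n b' ->
  (forall j, (0 < j < n)%N -> (b j && b j.+1) = (b' j && b' j.+1)) ->
  forall i, (i <= n.+1)%N -> b i = b' i.
Proof.
move=> sn c12 fs ob ob' E.
elim=> [|i IH] hi; first by rewrite (negbTE ob.1.1) (negbTE ob'.1.1).
have := IH (ltnW hi); have i_n : (i <= n)%N by [].
have := forced_no_empty_edge z_gt0 sn c12 fs ob i_n.
have := forced_no_empty_edge z_gt0 sn c12 fs ob' i_n.
case b1 : (b i); case b2 : (b' i) => //=; last by move=> -> ->.
move=> _ _ _; have [e|ne] := eqVneq i n.
  by rewrite e (negbTE ob.1.2) (negbTE ob'.1.2).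
have i0 : (0 < i)%N by case: i b1 {IH hi i_n b2 ne} => // b1; move: ob => [[]]; rewrite b1.
by have := E i ltac:(clear -i0 i_n ne; lia); rewrite b1 b2.
Qed.

End Witnesses.

(** * From sets to configurations *)

Section Configurations.
Variables (R : realType).
Implicit Types (x : nat -> R) (n i j s : nat) (b : nat -> bool).

Definition cfg n (A : {set 'I_n}) : nat -> bool :=
  fun i => [exists k in A, k.+1 == i :> nat].

Definition set_of n b : {set 'I_n} := [set k : 'I_n | b k.+1]%SET.

(* Edge j joins the sites j and j+1, so its weight xi_j is [x j.-1]; the weight
   of edge 0 is irrelevant. *)
Definition wt x j : R := x j.-1.

Lemma cfgE n (A : {set 'I_n}) (k : 'I_n) : cfg A k.+1 = (k \in A).
Proof.
apply/existsP/idP => [[k' /andP[kA /eqP [E]]]|kA].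
  by rewrite -(val_inj E).
by exists k; rewrite kA eqxx.
Qed.

Lemma cfg_valid n (A : {set 'I_n}) : valid n (cfg A).
Proof.
split; apply/negP => /existsP[k /andP[_ /eqP]] // [E].
by have := ltn_ord k; rewrite E ltnn.
Qed.

Lemma cfg_set_of n b : valid n b -> forall i, (i <= n.+1)%N -> cfg (set_of n b) i = b i.
Proof.
move=> vb [|i]; first by rewrite (negbTE vb.1) (negbTE (cfg_valid _).1).
rewrite ltnS leq_eqVlt => /orP[/eqP ->|lt].
  by rewrite (negbTE vb.2) (negbTE (cfg_valid _).2).
by have := cfgE (set_of n b) (Ordinal lt); rewrite inE.
Qed.

Lemma cfg_inj n (A B : {set 'I_n}) :
  (forall i, (i <= n.+1)%N -> cfg A i = cfg B i) -> A = B.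
Proof. by move=> H; apply/setP => k; rewrite -!cfgE H // ltnW // ltnS. Qed.

Lemma cnt_card n (P : pred nat) : cnt n P = #|[set k : 'I_n | P k.+1]%SET|.
Proof.
rewrite -sum1_card /cnt -[1%N in LHS]add0n -[n.+1]addn1 big_addn addn1 subn1 big_mkord.
rewrite [RHS]big_mkcond /=; apply: eq_bigr => k _; rewrite inE addn1.
by case: (P _).
Qed.

Lemma fnE x n (A : {set 'I_n}) : fn x A = n.+1%:R / 2 - cost (wt x) n (cfg A).
Proof.
have [v0 vn] := cfg_valid A.
have cardE : (#|A|%:R = \sum_(0 <= j < n.+1) ((cfg A j)%:R : R)).
  rewrite big_ltn //. rewrite (negbTE v0) add0r -natr_sum.
  congr _%:R; rewrite -/(cnt n (cfg A)) cnt_card.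
  by apply: eq_card => k; rewrite inE cfgE.
have cardE' : (#|A|%:R = \sum_(0 <= j < n.+1) ((cfg A j.+1)%:R : R)).
  rewrite big_nat_recr //= (negbTE vn) addr0 cardE [X in X = _]big_ltn // (negbTE v0)
    add0r.
  by rewrite -[1%N]add0n -[n.+1]addn1 big_addn addn1 subn1; apply: eq_bigr => j _; rewrite addn1.
have -> : cost (wt x) n (cfg A) = n.+1%:R / 2 - #|A|%:R +
    \sum_(0 <= j < n.+1) wt x j * (cfg A j && cfg A j.+1)%:R.
  rewrite /cost /edge_cost !big_split /=; congr (_ + _ + _).
    by rewrite sumr_const_nat subn0 mulr_natl.
  by rewrite sumrN -mulr_suml big_split /= -cardE -cardE'; lra.
rewrite /fn; suff -> : \sum_(i in A) \sum_(j in A | j == i.+1 :> nat) x i =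
  \sum_(0 <= j < n.+1) wt x j * (cfg A j && cfg A j.+1)%:R by ring.
rewrite big_ltn // (negbTE v0) mulr0 add0r -[1%N]add0n -[n.+1]addn1 big_addn.
rewrite addn1 subn1 big_mkord big_mkcond /=; apply: eq_bigr => k _.
rewrite addn1 cfgE /wt /=; case: (k \in A) => /=; last by rewrite mulr0.
have [h|h] := boolP (cfg A k.+2).
  move/existsP: (h) => [l /andP[lA /eqP[El]]].
  rewrite mulr1 (big_pred1 l) // => j /=; apply/andP/eqP => [[jA /eqP E]|->].
    by apply: val_inj; rewrite /= E El.
  by rewrite lA El eqxx.
rewrite mulr0 big1 // => j /andP[jA /eqP E]; case/negP: h; apply/existsP.
by exists j; rewrite jA E eqxx.
Qed.

Lemma symdiff_cnt n (A B : {set 'I_n}) :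
  #|symdiff B A| = cnt n (fun i => cfg A i != cfg B i).
Proof.
rewrite cnt_card; apply: eq_card => k; rewrite !inE !cfgE.
by case: (k \in A); case: (k \in B).
Qed.

Lemma maximizesP x n (A : {set 'I_n}) :
  maximizes x A <-> optimal (wt x) n (cfg A).
Proof.
split=> [H|[_ H] B]; last first.
  by have := H _ (cfg_valid B); rewrite !fnE; lra.
split; first exact: cfg_valid.
move=> b vb; have := H (set_of n b); rewrite !fnE.
rewrite (@cost_ext _ (wt x) _ n b (cfg (set_of n b))) //; first lra.
  exact: vb.1.
exact: cfg_set_of.
Qed.

Lemma gapE x n (A B : {set 'I_n}) : (0 < n)%N ->
  n%:R * gap x A B = cost (wt x) n (cfg B) - cost (wt x) n (cfg A).
Proof.
move=> n0; rewrite /gap mulrA divff ?mul1r ?pnatr_eq0 -?lt0n // !fnE; lra.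
Qed.

Lemma eps_le_cost x n (A : {set 'I_n}) delta b : (0 < n)%N -> delta <= 1 ->
  valid n b -> delta * n%:R <= (cnt n (fun i => cfg A i != b i))%:R ->
  n%:R * eps x A delta <= cost (wt x) n b - cost (wt x) n (cfg A).
Proof.
move=> n0 d1 vb hd; have E := cfg_set_of vb.
have -> : cost (wt x) n b = cost (wt x) n (cfg (set_of n b)).
  by rewrite (@cost_ext _ (wt x) _ n b (cfg (set_of n b))) //; exact: vb.1.
rewrite -gapE // ler_wpM2l //; apply: (eps_is_min x A d1).2.
rewrite symdiff_cnt (_ : cnt _ _ = cnt n (fun i => cfg A i != b i)) //.
by rewrite /cnt !big_nat; apply: eq_bigr => i hi; rewrite E // ltnW; clear -hi; lia.
Qed.

Lemma eps_cost x n (A : {set 'I_n}) delta : (0 < n)%N -> delta <= 1 ->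
  exists b, [/\ valid n b, delta * n%:R <= (cnt n (fun i => cfg A i != b i))%:R &
  n%:R * eps x A delta = cost (wt x) n b - cost (wt x) n (cfg A)].
Proof.
move=> n0 d1; have [[B hB ->] _] := eps_is_min x A d1.
by exists (cfg B); split; [exact: cfg_valid | rewrite -symdiff_cnt | exact: gapE].
Qed.

Lemma eps_ge0 x n (A : {set 'I_n}) delta : maximizes x A -> 0 <= eps x A delta.
Proof.
move=> H; rewrite /eps; elim/big_ind: _ => [|a b a0 b0|B _].
- by rewrite mulr_ge0 // subr_ge0 H.
- by rewrite le_min a0.
- by rewrite mulr_ge0 // subr_ge0 H.
Qed.

Lemma eps_le1 x n (A : {set 'I_n}) delta : (forall i, 0 < x i) -> (0 < n)%N ->
  delta <= 1 -> delta * n%:R <= (n.-1)%:R -> maximizes x A -> eps x A delta <= 1.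
Proof.
move=> x0 n0 d1 dn /maximizesP oA.
have [B [vB hB cB]] := far_competitor (fun j => x0 j.-1) n0 oA.
have n0' : 0 < n%:R :> R by rewrite ltr0n.
rewrite -(ler_pM2l n0') mulr1; apply: le_trans cB; apply: eps_le_cost => //.
by apply: le_trans dn _; rewrite ler_nat.
Qed.

(** The counting bound needs a forced site. If there is none, the last term alone is at least the
    left side, as delta <= 1. *)
Lemma eps_lower x n (A : {set 'I_n}) delta c X : (forall i, 0 < x i) -> (0 < n)%N ->
  delta <= 1 -> 0 < c < 2^-1 -> 0 <= X <= 1 - 2 * c -> maximizes x A ->
  X * (delta * n%:R) <= n%:R * eps x A delta +
    X * (cnt n (bad_site (wt x) c X n))%:R + X * n%:R * (unforced (wt x) c 0 n)%:R.
Proof.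
move=> x0 n0 d1 c12 hX mA; have X0 : 0 <= X by case/andP: hX.
have e0 := eps_ge0 delta mA.
have [uf|/unforcedP nuf] := boolP (unforced (wt x) c 0 n).
  have : X * (delta * n%:R) <= X * n%:R by rewrite ler_wpM2l // ler_piMl.
  have : 0 <= n%:R * eps x A delta by rewrite mulr_ge0.
  have : 0 <= X * (cnt n (bad_site (wt x) c X n))%:R by rewrite mulr_ge0.
  by rewrite mulr1; lra.
have [s [sn fs]] : exists s, (0 < s <= n)%N /\ forced (wt x) c s.
  by apply: contrapT => H; apply: nuf => s sn; apply/negP => fs; apply: H; exists s.
rewrite mulr0 addr0; have [b [vb hb ->]] := eps_cost x A n0 d1.
have := lower_count (fun j => x0 j.-1) sn c12 fs ((maximizesP x A).1 mA) hX vb.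
suff : X * (delta * n%:R) <= X * (cnt n (fun i => (cfg A i != b i) && ~~ bad_site (wt x) c X n i))%:R
  + X * (cnt n (bad_site (wt x) c X n))%:R by lra.
rewrite -mulrDr ler_wpM2l //; apply: le_trans hb _; rewrite -natrD ler_nat.
rewrite /cnt -big_split /=; apply: leq_sum => i _.
by case: (_ != _) => //=; case: (bad_site _ _ _ _ _).
Qed.

Definition shiftx (k : nat) x i := x (k + i)%N.

(** s1 is the last forced site up to n1, or 0. Its distance to the junction is written as a sum of
    indicators, whose expectation can be taken term by term. *)
Lemma cnt_unforced_left z c n1 : exists2 s1, (s1 <= n1)%N && ((0 < s1)%N ==> forced z c s1) &
  (n1 - s1 = \sum_(0 <= i < n1) unforced (R := R) z c i n1)%N.
Proof.
have ex : exists s, (s <= n1)%N && ((0 < s)%N ==> forced z c s) by exists 0%N.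
have ub s : (s <= n1)%N && ((0 < s)%N ==> forced z c s) -> (s <= n1)%N by case/andP.
case: (ex_maxnP ex ub) => s1 h1 hmax; exists s1 => //.
rewrite -sum_geq !big_nat; apply: eq_bigr => i hi; congr nat_of_bool.
apply/idP/unforcedP => [s1i t ti|H].
  apply/negP => ft; have := hmax t; rewrite ft implybT andbT => /(_ ltac:(clear -ti; lia)).
  by clear -s1i ti; lia.
rewrite leqNgt; apply/negP => is1; move: h1 => /andP[s1n /implyP/(_ ltac:(clear -is1; lia))].
by apply/negP; apply: H; clear -is1 s1n; lia.
Qed.

Lemma cnt_unforced_right z c n1 n2 : exists2 s2, (n1 < s2 <= (n1 + n2).+1)%N &&
    ((s2 <= n1 + n2)%N ==> forced z c s2) &
  (s2 - n1.+1 = \sum_(0 <= i < n2) unforced (R := R) z c n1 (n1 + i.+1))%N.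
Proof.
have ex : exists s, (n1 < s <= (n1 + n2).+1)%N && ((s <= n1 + n2)%N ==> forced z c s).
  by exists (n1 + n2).+1; rewrite ltnn leqnn ltnS leq_addr.
case: (ex_minnP ex) => s2 h2 hmin; exists s2 => //.
transitivity (\sum_(0 <= i < n2) (i < s2 - n1.+1))%N.
  have [->|d0] := posnP (s2 - n1.+1)%N; first by rewrite big1.
  have -> : (s2 - n1.+1 = (s2 - n1.+1).-1.+1)%N by rewrite prednK.
  rewrite -[LHS](_ : minn n2 (s2 - n1.+1).-1.+1 = _)%N ?sum_leq //.
  by case/andP: h2 => h2 _; clear -h2 d0; lia.
rewrite !big_nat; apply: eq_bigr => i hi; congr nat_of_bool.
apply/idP/unforcedP => [is2 t ti|H].
  apply/negP => ft; have := hmin t; rewrite ft implybT andbT.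
  by move=> /(_ ltac:(clear -ti hi; lia)); clear -is2 ti; lia.
rewrite ltnNge; apply/negP => is2; move: h2 => /andP[s2n /implyP].
move=> /(_ ltac:(clear -is2 hi s2n; lia)).
by apply/negP; apply: H; clear -is2 s2n; lia.
Qed.

Definition unique_max x n (A : {set 'I_n}) :=
  maximizes x A /\ forall A' : {set 'I_n}, maximizes x A' -> A' = A.

Lemma unique_maxP x n (A : {set 'I_n}) :
  unique_max x A -> unique_optimal (wt x) n (cfg A).
Proof.
move=> [/maximizesP oA uA]; split=> // b ob i hi.
have Eb := cfg_set_of ob.1.
have : maximizes x (set_of n b).
  by apply/maximizesP; apply: optimal_ext ob => // j hj; exact: Eb.
by move=> /uA <-; rewrite Eb // ltnW // ltnS; case/andP: hi.
Qed.

(** If some site is forced, the optimal set is unique and [glue] applies to the minimizers of the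
    two halves. If none is, the zone is the whole chain, and the trivial bound n on the left side is
    already below the two sums. *)
Lemma eps_glue x n1 n2 c delta (n := (n1 + n2)%N) (A : {set 'I_n})
    (A1 : {set 'I_n1}) (A2 : {set 'I_n2}) :
  (forall i, 0 < x i) -> (0 < n1)%N -> (0 < n2)%N -> 0 <= delta <= 1 -> delta * n%:R <= (n.-1)%:R ->
  0 < c < 2^-1 ->
  (~~ unforced (wt x) c 0 n -> unique_max x A) -> maximizes x A ->
  maximizes x A1 -> maximizes (shiftx n1 x) A2 ->
  n%:R * eps x A delta <= n1%:R * eps x A1 delta + n2%:R * eps (shiftx n1 x) A2 delta +
    2 * (\sum_(0 <= i < n1) unforced (wt x) c i n1)%:R +
    2 * (\sum_(0 <= i < n2) unforced (wt x) c n1 (n1 + i.+1))%:R + 7.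
Proof.
move=> x0 n10 n20 /andP[d0 d1] dn c12 uA mA mA1 mA2.
have n0 : (0 < n)%N by rewrite /n; clear -n10; lia.
have e1 := eps_ge0 delta mA1.
have e2 := eps_ge0 delta mA2.
have [s1 /andP[s1n f1] <-] := cnt_unforced_left (wt x) c n1.
have [s2 /andP[s2n f2] <-] := cnt_unforced_right (wt x) c n1 n2.
have [uf|nuf] := boolP (unforced (wt x) c 0 n).
  have hs1 : s1 = 0%N.
    apply/eqP; rewrite -leqn0 leqNgt; apply/negP => s10; move: f1; rewrite s10 /=.
    by apply/negP; move/unforcedP: uf => /(_ s1); apply; clear -s10 s1n n; lia.
  have hs2 : s2 = n.+1.
    apply/eqP; rewrite eqn_leq (andP s2n).2 /= ltnNge; apply/negP => s20; move: f2; rewrite s20 /=.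
    by apply/negP; move/unforcedP: uf => /(_ s2); apply; clear -s20 s2n n; lia.
  have := eps_le1 x0 n0 d1 dn mA.
  have nn : n%:R <= (n1 - s1)%:R + (s2 - n1.+1)%:R :> R.
    by rewrite -natrD ler_nat hs1 hs2; clear -n n10; lia.
  have h1 : 0 <= n1%:R * eps x A1 delta by rewrite mulr_ge0.
  have h2 : 0 <= n2%:R * eps (shiftx n1 x) A2 delta by rewrite mulr_ge0.
  move=> ele; have : n%:R * eps x A delta <= n%:R by rewrite ler_piMr.
  have : 0 <= (n1 - s1)%:R :> R by [].
  have : 0 <= (s2 - n1.+1)%:R :> R by [].
  lra.
have {}uA := unique_maxP (uA nuf).
have [s [sn fs]] : exists s, (0 < s <= n)%N /\ forced (wt x) c s.
  apply: contrapT => H; move/unforcedP: nuf; apply => s sn; apply/negP => fs.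
  by apply: H; exists s.
have [b1 [vb1 hb1 ->]] := eps_cost x A1 n10 d1.
have [b2 [vb2 hb2 ->]] := eps_cost (shiftx n1 x) A2 n20 d1.
have zz j : (0 < j)%N -> wt (shiftx n1 x) j = wt x (n1 + j).
  by case: j => // j _; rewrite /wt /shiftx addnS.
have ob2 : optimal (fun j => wt x (n1 + j)) n2 (cfg A2).
  by apply: (optimal_ext _ _ ((maximizesP _ _).1 mA2)) => // j j0; rewrite zz.
rewrite -(@cost_ext _ (wt (shiftx n1 x)) (fun j => wt x (n1 + j)) n2 b2 b2) //; last exact: vb2.1.
  2: by move=> j j0; rewrite zz.
rewrite -(@cost_ext _ (wt (shiftx n1 x)) (fun j => wt x (n1 + j)) n2 (cfg A2) (cfg A2)) //; last exact: (cfg_valid _).1.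
  2: by move=> j j0; rewrite zz.
have [B [vB dB cB]] := glue (z := wt x) (fun j => x0 j.-1) c12 uA ((maximizesP _ _).1 mA1) ob2
  vb1 vb2 sn fs s1n f1 s2n f2.
have dB' : delta * n%:R <= (cnt n (fun i => cfg A i != B i))%:R.
  apply: (@le_trans _ _ ((cnt n1 (fun i => cfg A1 i != b1 i))%:R + (cnt n2 (fun i => cfg A2 i != b2 i))%:R)).
    by rewrite /n natrD mulrDr lerD.
  by rewrite -natrD ler_nat.
have := @eps_le_cost x n A delta B n0 d1 vB dB'.
have : ((2 * (s2 - s1) + 5)%:R : R) <= 2 * (n1 - s1)%:R + 2 * (s2 - n1.+1)%:R + 7.
  rewrite -!natrM -!natrD ler_nat; clear -s1n s2n; lia.
move: cB; rewrite -/n; lra.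
Qed.

(* The squared deviation (N - mu)^2 is expanded, and 8 N / mu moved to the left,
   so that both sides are nonnegative combinations of indicators. *)
Lemma eps_upper x n (A : {set 'I_n}) delta h mu (sp : pred nat) (z := wt x) :
  (forall i, 0 < x i) -> (0 < n)%N -> delta <= 1 -> delta * n%:R <= (n.-1)%:R ->
  0 <= h -> 0 < mu -> delta * n%:R <= mu / 2 -> maximizes x A ->
  (forall i, sp i -> [/\ (1 < i < n)%N, ~~ sp i.+1, z i.-2 + z i.-1 < 1,
     z i + z i.+1 < 1 & `|1 - z i.-1 - z i| <= h]) ->
  eps x A delta + 8 / mu * (cnt n sp)%:R <=
    h / n%:R * (cnt n sp)%:R + 4 / mu ^+ 2 * (cnt n sp)%:R ^+ 2 + 4.
Proof.
move=> x0 n0 d1 dn h0 mu0 dmu mA Hsp.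
set N := (cnt n sp)%:R; have n0' : 0 < n%:R :> R by rewrite ltr0n.
have N0 : 0 <= N by [].
suff key : eps x A delta <= h / n%:R * N + 4 / mu ^+ 2 * (N - mu) ^+ 2.
  apply: (@le_trans _ _ (h / n%:R * N + 4 / mu ^+ 2 * (N - mu) ^+ 2 + 8 / mu * N)).
    by rewrite lerD2r.
  rewrite le_eqVlt; apply/orP; left; apply/eqP; field; lra.
have hN0 : 0 <= h / n%:R * N by rewrite mulr_ge0 // divr_ge0.
have mu2 : 0 < mu ^+ 2 by rewrite exprn_gt0.
(* Chebyshev: for N < mu / 2 the quadratic term is at least 1, hence at least [eps]; otherwise
   flipping all the spots moves the optimal set by at least delta n sites. *)
have [lt|ge] := ltP N (mu / 2).
  have := eps_le1 x0 n0 d1 dn mA.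
  have : 1 <= 4 / mu ^+ 2 * (N - mu) ^+ 2.
    rewrite mulrAC ler_pdivlMr // mul1r; nra.
  lra.
have oA := (maximizesP _ _).1 mA.
have z0 j : 0 < z j by exact: x0.
(* A site whose two weights add up to less than 1 is in every optimal set; this occupies both
   neighbours of a spot. *)
have inA s : (0 < s <= n)%N -> z s.-1 + z s < 1 -> cfg A s.
  move=> sn zs; have [//|ns] := boolP (cfg A s); exfalso.
  have := oA.2 _ (setsite_valid true sn oA.1); have := add_site_cost (wt x) sn ns.
  have := z0 s.-1; have := z0 s; rewrite -/z.
  by case: (cfg A s.-1); case: (cfg A s.+1) => /=; lra.
have [||B [vB dB cB]] := @flip_spots _ z n (cfg A) sp h; first exact: oA.1.
  move=> i /Hsp[hi si z1 z2 z3]; split=> //; first by clear -hi; lia.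
    by apply: inA; first (clear -hi; lia).
  by apply: inA; first (clear -hi; lia).
have := @eps_le_cost x n A delta B n0 d1 vB.
rewrite dB => /(_ (le_trans dmu ge)) => h1.
have : eps x A delta <= h / n%:R * N.
  rewrite mulrAC ler_pdivlMr // mulrC; exact: le_trans h1 cB.
have : 0 <= 4 / mu ^+ 2 * (N - mu) ^+ 2 by rewrite mulr_ge0 ?sqr_ge0 // divr_ge0 // ltW.
lra.
Qed.

(* Two distinct optimal sets with no empty edges differ in their full edges, so
   their equal values give an affine relation between the weights. *)
Definition full_edges n (A : {set 'I_n}) : {set 'I_n} :=
  [set k : 'I_n | cfg A k.+1 && cfg A k.+2]%SET.

Lemma fn_full x n (A : {set 'I_n}) : fn x A = #|A|%:R - \sum_(i in full_edges A) x i.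
Proof.
rewrite /fn; congr (_ - _); rewrite big_mkcond /= [RHS]big_mkcond /=.
apply: eq_bigr => k _; rewrite inE cfgE; case: (k \in A) => //=.
have [h|h] := boolP (cfg A k.+2).
  move/existsP: (h) => [l /andP[lA /eqP[El]]].
  rewrite (big_pred1 l) // => j /=; apply/andP/eqP => [[jA /eqP E]|->].
    by apply: val_inj; rewrite /= E El.
  by rewrite lA El eqxx.
rewrite big1 // => j /andP[jA /eqP E]; case/negP: h; apply/existsP.
by exists j; rewrite jA E eqxx.
Qed.

Definition tie x n (E1 E2 : {set 'I_n}) (m1 m2 : nat) :=
  \sum_(i in E1) x i + m1%:R = \sum_(i in E2) x i + m2%:R.

(** Ties range over finitely many sets and integers, independently of A, so that all of them can be
    excluded almost surely at once. *)
Lemma unique_max_or_tie x n c (A : {set 'I_n}) : (forall i, 0 < x i) ->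
  0 < c < 2^-1 -> maximizes x A ->
  (forall (E1 E2 : {set 'I_n}) (m1 m2 : 'I_n.+1), E1 != E2 -> ~ tie x E1 E2 m1 m2) ->
  ~~ unforced (wt x) c 0 n -> unique_max x A.
Proof.
move=> x0 c12 mA nt nuf; split=> // A' mA'.
have [s [sn fs]] : exists s, (0 < s <= n)%N /\ forced (wt x) c s.
  apply: contrapT => H; move/unforcedP: nuf; apply => s sn; apply/negP => fs.
  by apply: H; exists s.
have feq : fn x A = fn x A' by apply/eqP; rewrite eq_le mA mA'.
have cardlt (D : {set 'I_n}) : (#|D| < n.+1)%N.
  by rewrite ltnS -[X in (_ <= X)%N]card_ord max_card.
have [E|ne] := eqVneq (full_edges A) (full_edges A'); last first.
  exfalso; apply: (nt _ _ (Ordinal (cardlt A')) (Ordinal (cardlt A)) ne).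
  by move: feq; rewrite /tie /= !fn_full; lra.
apply: cfg_inj => i hi; have := optimal_determined (fun j => x0 j.-1) sn c12 fs
  ((maximizesP _ _).1 mA') ((maximizesP _ _).1 mA); apply => // j jn.
have jn' : (j.-1 < n)%N by clear -jn; lia.
have Ej : j.-1.+1 = j by clear -jn; lia.
move/setP/(_ (Ordinal jn')): E; rewrite !inE /= Ej => ->; by [].
Qed.

End Configurations.

(** * Measurability and expectations *)

Section Measurability.
Context d (T : measurableType d) (R : realType).
Implicit Types (f g : T -> R) (b c : T -> bool).

Lemma measurable_fun_if_bool b f g : measurable_fun setT b ->
  measurable_fun setT f -> measurable_fun setT g ->
  measurable_fun setT (fun t => if b t then f t else g t).
Proof.
move=> mb mf mg; apply: measurable_fun_if => //; exact: measurable_funTS.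
Qed.

Lemma measurable_big_if I (s : seq I) (op : R -> R -> R) (idx : T -> R)
    (b : I -> T -> bool) (F : I -> T -> R) :
  (forall f g, measurable_fun setT f -> measurable_fun setT g ->
     measurable_fun setT (fun t => op (f t) (g t))) ->
  measurable_fun setT idx ->
  (forall i, measurable_fun setT (b i)) -> (forall i, measurable_fun setT (F i)) ->
  measurable_fun setT (fun t => \big[op/idx t]_(i <- s | b i t) F i t).
Proof.
move=> mop mi mb mF; elim: s => [|i s IH].
  by under eq_fun do rewrite big_nil.
under eq_fun do rewrite big_cons.
by apply: measurable_fun_if_bool => //; exact: mop.
Qed.

Lemma measurable_forallb (I : finType) (b : I -> T -> bool) :
  (forall i, measurable_fun setT (b i)) ->
  measurable_fun setT (fun t => [forall i, b i t]).
Proof.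
move=> mb; have -> : (fun t => [forall i, b i t]) = (fun t => all (b ^~ t) (enum I)).
  apply/funext => t; apply/forallP/allP => [H i _|H i]; first exact: H.
  by apply: H; rewrite mem_enum.
elim: (enum I) => [|i s IH] /=; first exact: measurable_cst.
exact: measurable_and.
Qed.

Lemma measurable_existsb (I : finType) (b : I -> T -> bool) :
  (forall i, measurable_fun setT (b i)) ->
  measurable_fun setT (fun t => [exists i, b i t]).
Proof.
move=> mb.
rewrite (_ : (fun t => _) = fun t => ~~ [forall i, ~~ b i t]); last first.
  apply/funext => t; rewrite negb_forall; apply: eq_existsb => i.
  by rewrite negbK.
by apply: measurable_neg; apply: measurable_forallb => i; exact: measurable_neg.
Qed.

Lemma measurable_set_bool b : measurable_fun setT b -> measurable [set t | b t].
Proof. by move=> mb; rewrite -[X in measurable X]setTI; exact: mb. Qed.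

Lemma measurable_bool_set b : measurable [set t | b t] -> measurable_fun setT b.
Proof.
by move=> mb; apply: (measurable_fun_bool true); rewrite setTI.
Qed.

Lemma measurable_indic b : measurable_fun setT b ->
  measurable_fun setT (fun t => (b t)%:R : R).
Proof.
move=> mb.
rewrite (_ : (fun t => _) = fun t => if b t then 1 else 0 : R); last first.
  by apply/funext => t; case: (b t).
by apply: measurable_fun_if_bool => //; exact: measurable_cst.
Qed.

Variables (X : T -> nat -> R) (mX : forall i, measurable_fun setT (fun t => X t i)).

Definition maxb n (x : nat -> R) (A : {set 'I_n}) := [forall B : {set 'I_n}, fn x B <= fn x A].

Lemma maxbP n (x : nat -> R) (A : {set 'I_n}) : reflect (maximizes x A) (maxb x A).
Proof. exact: forallP. Qed.

(* Free of the choice of a maximizer, and equal to eps at the maximizer when it is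
   unique. *)
Definition epsM n (delta : R) (x : nat -> R) : R :=
  \big[Num.max/0]_(A : {set 'I_n} | maxb x A) eps x A delta.

Lemma measurable_fn n (A : {set 'I_n}) : measurable_fun setT (fun t => fn (X t) A).
Proof.
apply: measurable_funB; first exact: measurable_cst.
have mD (f g : T -> R) : measurable_fun setT f -> measurable_fun setT g ->
    measurable_fun setT (fun t => f t + g t) by exact: measurable_funD.
apply: measurable_big_if => // i; exact: measurable_big_if.
Qed.

Lemma measurable_gap n (A B : {set 'I_n}) : measurable_fun setT (fun t => gap (X t) A B).
Proof.
apply: measurable_funM; first exact: measurable_cst.
by apply: measurable_funB; exact: measurable_fn.
Qed.

Lemma measurable_eps n (A : {set 'I_n}) delta :
  measurable_fun setT (fun t => eps (X t) A delta).
Proof.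
apply: measurable_big_if => //; last by move=> B; exact: measurable_gap.
- by move=> f g mf mg; exact: measurable_minr.
- exact: measurable_gap.
Qed.

Lemma measurable_maxb n (A : {set 'I_n}) : measurable_fun setT (fun t => maxb (X t) A).
Proof.
apply: measurable_forallb => B; apply: measurable_fun_ler; exact: measurable_fn.
Qed.

Lemma measurable_epsM n delta : measurable_fun setT (fun t => epsM n delta (X t)).
Proof.
apply: measurable_big_if => [f g mf mg|||A].
- exact: measurable_maxr.
- exact: measurable_cst.
- by move=> A; exact: measurable_maxb.
- exact: measurable_eps.
Qed.

Lemma measurable_wt j : measurable_fun setT (fun t => wt (X t) j).
Proof. exact: mX. Qed.

Lemma measurable_forced (c : R) s : measurable_fun setT (fun t => forced (wt (X t)) c s).
Proof.
by apply: measurable_and; (apply: measurable_fun_ltr;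
  [exact: measurable_wt | exact: measurable_cst]).
Qed.

Lemma measurable_unforced (c : R) p q :
  measurable_fun setT (fun t => unforced (wt (X t)) c p q).
Proof.
rewrite /unforced; elim: index_iota => [|s r IH].
  under eq_fun do rewrite big_nil.
  exact: measurable_cst.
under eq_fun do rewrite big_cons.
by apply: measurable_and => //; apply: measurable_neg; exact: measurable_forced.
Qed.

Lemma measurable_small_ends p q (y : R) : measurable_fun setT (fun t => small_ends (wt (X t)) p q y).
Proof.
have mn (f : T -> R) : measurable_fun setT f -> measurable_fun setT (fun t => `|f t| < y).
  move=> mf; apply: measurable_fun_ltr; last exact: measurable_cst.
  exact: (measurableT_comp (@normr_measurable R setT) mf).
have mw j : measurable_fun setT (fun t => wt (X t) j) by exact: measurable_wt.
have mb (b : bool) : measurable_fun [set: T] (fun=> b) by exact: measurable_cst.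
rewrite /small_ends; apply: measurable_or; first exact: mb.
apply: measurable_or; first exact: mn.
apply: measurable_or; first by apply: mn; exact: measurable_funB.
apply: measurable_and; first exact: mb.
apply: measurable_or; first exact: mn.
apply: measurable_or; first by apply: mn; exact: measurable_funB.
apply: measurable_or; apply: mn; first exact: measurable_funB.
by apply: measurable_funB => //; exact: measurable_funD.
Qed.

Lemma measurable_bad (c x : R) p q : measurable_fun setT (fun t => bad (wt (X t)) c x p q).
Proof. by apply: measurable_and; [exact: measurable_unforced | exact: measurable_small_ends]. Qed.

End Measurability.
Arguments epsM {R}.

(** * Expectations of almost surely bounded variables *)

Section Expectation.
Context d (T : measurableType d) (R : realType) (P : probability T R).
Implicit Types (X Y : T -> R) (b : T -> bool).

(** The bounds are almost sure only, because the weights are positive only almost surely;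
    [integral_max0] restores pointwise nonnegativity. *)
Definition bounded_rv X := measurable_fun setT X /\
  exists K : R, {ae P, forall t, 0 <= X t <= K}.

Definition ex X : R := fine (\int[P]_t (X t)%:E)%E.

Definition pr b : R := fine (P [set t | b t]).

Lemma integral_max0 X : bounded_rv X ->
  (\int[P]_t (X t)%:E)%E = (\int[P]_t (Num.max (X t) 0)%:E)%E.
Proof.
move=> [mX [K hK]]; apply: ae_eq_integral => //; first exact/measurable_EFinP.
  by apply/measurable_EFinP; exact: measurable_maxr.
by apply: filterS hK => t /andP[h _] _; rewrite max_l.
Qed.

Lemma exE X : bounded_rv X -> (\int[P]_t (X t)%:E)%E = (ex X)%:E.
Proof.
move=> bX; have [mX [K hK]] := bX.
have mX' : measurable_fun setT (fun t => (Num.max (X t) 0)%:E).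
  by apply/measurable_EFinP; exact: measurable_maxr.
rewrite /ex (integral_max0 bX) fineK // ge0_fin_numE; last first.
  by apply: integral_ge0 => t _; rewrite lee_fin le_max lexx orbT.
apply: (@le_lt_trans _ _ (\int[P]_t (Num.max K 0)%:E)%E).
  apply: ae_ge0_le_integral => //.
  - by move=> t _; rewrite lee_fin le_max lexx orbT.
  - by move=> t _; rewrite lee_fin le_max lexx orbT.
  - apply: filterS hK => t /andP[h0 h] _; rewrite lee_fin max_l //.
    by rewrite le_max h.
by rewrite integral_cst //= probability_setT mule1 ltry.
Qed.

Lemma ex_le X Y : bounded_rv X -> bounded_rv Y ->
  {ae P, forall t, X t <= Y t} -> ex X <= ex Y.
Proof.
move=> bX bY XY; rewrite -lee_fin -!exE //.
have mm Z : bounded_rv Z -> measurable_fun setT (fun t => (Num.max (Z t) 0)%:E).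
  by move=> [mZ _]; apply/measurable_EFinP; exact: measurable_maxr.
rewrite (integral_max0 bX) (integral_max0 bY); apply: ae_ge0_le_integral => //.
- by move=> t _; rewrite lee_fin le_max lexx orbT.
- exact: mm.
- by move=> t _; rewrite lee_fin le_max lexx orbT.
- exact: mm.
- by apply: filterS XY => t h _; rewrite lee_fin ge_max !le_max h lexx orbT.
Qed.

Lemma bounded_rvD X Y : bounded_rv X -> bounded_rv Y -> bounded_rv (fun t => X t + Y t).
Proof.
move=> [mX [K hK]] [mY [L hL]]; split; first exact: measurable_funD.
exists (K + L); apply: filterS2 hK hL => t /andP[h1 h2] /andP[h3 h4].
by rewrite addr_ge0 // lerD.
Qed.

Lemma bounded_rvZ (a : R) X : 0 <= a -> bounded_rv X -> bounded_rv (fun t => a * X t).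
Proof.
move=> a0 [mX [K hK]]; split; first exact: measurable_funM.
exists (a * K); apply: filterS hK => t /andP[h1 h2].
by rewrite mulr_ge0 // ler_wpM2l.
Qed.

Lemma bounded_rv_ind b : measurable_fun setT b -> bounded_rv (fun t => (b t)%:R).
Proof.
move=> mb; split; first exact: measurable_indic.
by exists 1; apply: aeW => t; case: (b t); rewrite ?lexx ?ler01.
Qed.

Lemma bounded_rv_cst (a : R) : 0 <= a -> bounded_rv (fun=> a).
Proof.
move=> a0; split; first exact: measurable_cst.
by exists a; apply: aeW => t; rewrite a0 lexx.
Qed.

Lemma bounded_rv_sum (I : Type) (s : seq I) (F : I -> T -> R) :
  (forall i, bounded_rv (F i)) -> bounded_rv (fun t => \sum_(i <- s) F i t).
Proof.
move=> bF; elim: s => [|i s IH].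
  under eq_fun do rewrite big_nil.
  exact: bounded_rv_cst.
under eq_fun do rewrite big_cons.
exact: bounded_rvD.
Qed.

Lemma exD X Y : bounded_rv X -> bounded_rv Y -> ex (fun t => X t + Y t) = ex X + ex Y.
Proof.
move=> bX bY; apply: EFin_inj; rewrite -exE; last exact: bounded_rvD.
rewrite EFinD -!exE //.
have iX Z : bounded_rv Z -> P.-integrable setT (EFin \o Z).
  move=> bZ; have [mZ [K hK]] := bZ; apply/integrableP; split; first exact/measurable_EFinP.
  rewrite (_ : (\int[P]_x `|(EFin \o Z) x|)%E = (\int[P]_x (Z x)%:E)%E).
    by rewrite exE // ltry.
  apply: ae_eq_integral => //.
  - by apply: measurableT_comp => //; exact/measurable_EFinP.
  - exact/measurable_EFinP.
  by apply: filterS hK => t /andP[h _] _ /=; rewrite ger0_norm.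
rewrite -integralD //; [exact: iX | exact: iX].
Qed.

Lemma exZ (a : R) X : 0 <= a -> bounded_rv X -> ex (fun t => a * X t) = a * ex X.
Proof.
move=> a0 bX; have [mX [K hK]] := bX.
apply: EFin_inj; rewrite -exE; last exact: bounded_rvZ.
rewrite EFinM -!exE //.
rewrite (integral_max0 bX) -ge0_integralZl //.
- rewrite (integral_max0 (bounded_rvZ a0 bX)).
  by apply: eq_integral => t _; rewrite -EFinM maxr_pMr // mulr0.
- by apply/measurable_EFinP; exact: measurable_maxr.
- by move=> t _; rewrite lee_fin le_max lexx orbT.
Qed.

Lemma ex_cst (a : R) : ex (fun=> a) = a.
Proof. by rewrite /ex integral_cst //= probability_setT mule1. Qed.

Lemma ex_ind b : measurable_fun setT b -> ex (fun t => (b t)%:R) = pr b.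
Proof.
move=> mb; rewrite /ex /pr -[X in P X]setIT -integral_indic //; last first.
  exact: measurable_set_bool.
congr fine; apply: eq_integral => t _; rewrite indicE.
by have -> : (t \in [set t | b t]) = b t by apply/idP/idP; rewrite inE.
Qed.

Lemma ex_sum (I : Type) (s : seq I) (F : I -> T -> R) :
  (forall i, bounded_rv (F i)) ->
  ex (fun t => \sum_(i <- s) F i t) = \sum_(i <- s) ex (F i).
Proof.
move=> bF; elim: s => [|i s IH].
  by rewrite big_nil; under [X in ex X]eq_fun do rewrite big_nil; rewrite ex_cst.
rewrite big_cons -IH -exD //; last exact: bounded_rv_sum.
by congr ex; apply/funext => t; rewrite big_cons.
Qed.

Lemma le_pr b b' : measurable_fun setT b -> measurable_fun setT b' ->
  {ae P, forall t, b t -> b' t} -> pr b <= pr b'.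
Proof.
move=> mb mb' bb'; rewrite -!ex_ind //; apply: ex_le; [exact: bounded_rv_ind..|].
by apply: filterS bb' => t; case: (b t) => [->//|_]; rewrite ler0n.
Qed.

End Expectation.

(** * Probabilities of events depending on few weights *)

Section Independence.
Context d (T : measurableType d) (R : realType) (P : probability T R)
  (xi : nat -> {RV P >-> R}).
Hypotheses (xi_indep : mutually_independent xi)
  (xi_ident : identically_distributed xi).

Definition prs (E : set T) : R := fine (P E).

Definition law (B : set R) : R := prs (xi 0%N @^-1` B).

Definition rect (I : seq nat) (B : nat -> set R) : set T :=
  \bigcap_(i in [set` I]) xi i @^-1` B i.

Lemma prsE E : measurable E -> P E = (prs E)%:E.
Proof.
move=> mE; rewrite fineK // ge0_fin_numE //.
by apply: le_lt_trans (probability_le1 P mE) _; rewrite ltry.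
Qed.

Lemma prs_ge0 E : 0 <= prs E.
Proof. by rewrite /prs fine_ge0. Qed.

Lemma prs_le E F : measurable E -> measurable F -> E `<=` F -> prs E <= prs F.
Proof. by move=> mE mF EF; rewrite -lee_fin -!prsE // le_measure ?inE. Qed.

Lemma prs_le1 E : measurable E -> prs E <= 1.
Proof. by move=> mE; rewrite -lee_fin -prsE // probability_le1. Qed.

Lemma prsU_le E F : measurable E -> measurable F -> prs (E `|` F) <= prs E + prs F.
Proof.
move=> mE mF; rewrite -lee_fin EFinD -!prsE //; first exact: measureU2.
exact: measurableU.
Qed.

Lemma prsU_disj E F : measurable E -> measurable F -> E `&` F = set0 ->
  prs (E `|` F) = prs E + prs F.
Proof.
move=> mE mF EF; apply: EFin_inj; rewrite EFinD -!prsE //; first by rewrite measureU.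
exact: measurableU.
Qed.

Lemma measurable_preimage i (B : set R) : measurable B -> measurable (xi i @^-1` B).
Proof. by move=> mB; rewrite -[X in measurable X]setTI; apply: measurable_funP. Qed.

Lemma measurable_rect I B : (forall i, measurable (B i)) -> measurable (rect I B).
Proof.
move=> mB; apply: bigcap_measurableType => i _; exact: measurable_preimage.
Qed.

Lemma rect_nil B : rect [::] B = setT.
Proof. by apply/seteqP; split => // t _ i /=; rewrite inE. Qed.

Lemma rect_cons i I B : rect (i :: I) B = xi i @^-1` B i `&` rect I B.
Proof.
apply/seteqP; split => [t H|t [H1 H2] j /=].
  split; first by apply: (H i); rewrite /= mem_head.
  by move=> j /= jI; apply: (H j); rewrite /= inE jI orbT.
by rewrite inE => /orP[/eqP ->//|]; exact: H2.
Qed.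

Lemma eq_rect I B B' : (forall i, i \in I -> B i = B' i) -> rect I B = rect I B'.
Proof.
move=> H; apply/seteqP; split=> t Ht i /= iI.
  by rewrite -H //; exact: Ht.
by rewrite H //; exact: Ht.
Qed.

Lemma law_ge0 B : 0 <= law B. Proof. exact: prs_ge0. Qed.

Lemma law_le1 B : measurable B -> law B <= 1.
Proof. by move=> mB; apply: prs_le1; exact: measurable_preimage. Qed.

Lemma law_le (B C : set R) : measurable B -> measurable C -> B `<=` C -> law B <= law C.
Proof.
move=> mB mC BC; apply: prs_le; [exact: measurable_preimage..|].
by move=> t; exact: BC.
Qed.

Lemma lawE i B : measurable B -> P (xi i @^-1` B) = (law B)%:E.
Proof.
move=> mB; rewrite -[LHS]/(distribution P (xi i) B) xi_ident // -prsE //.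
exact: measurable_preimage.
Qed.

(** E has probability gamma and is independent of the weights with index in J, tested on rectangles.
    In this form the factor gamma can be carried through the estimates for end weights. *)
Definition indep_of (J : pred nat) (E : set T) (gamma : R) :=
  measurable E /\ forall I B, uniq I -> all J I -> (forall i, measurable (B i)) ->
    prs (E `&` rect I B) = gamma * \prod_(i <- I) law (B i).

Lemma prs_rect I B : uniq I -> (forall i, measurable (B i)) ->
  prs (rect I B) = \prod_(i <- I) law (B i).
Proof.
move=> uI mB; apply: EFin_inj; rewrite -prsE; last exact: measurable_rect.
rewrite /rect xi_indep //; elim: I uI => [|i I IH] => [_|/= /andP[_ uI]].
  by rewrite !big_nil.
by rewrite !big_cons EFinM lawE // IH.
Qed.

Lemma indep_of_setT J : indep_of J setT 1.
Proof.
split=> // I B uI _ mB; rewrite setTI mul1r; exact: prs_rect.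
Qed.

Lemma indep_of_prs J E gamma : indep_of J E gamma -> prs E = gamma.
Proof.
move=> [mE /(_ [::] (fun=> setT))]; rewrite rect_nil setIT big_nil mulr1.
by apply.
Qed.

(** The pairs are disjoint, hence independent: the event contains the absence of forced sites on a
    run, and its probability is an exact power. *)
Definition npairs c a k : set T :=
  [set t | forall m, (m < k)%N -> ~ (xi (a + m.*2)%N t < c /\ xi (a + m.*2).+1 t < c)].

Lemma indep_of_npairs c a k :
  indep_of (fun i => ~~ (a <= i < a + k.*2)%N) (npairs c a k)
    ((1 - law `]-oo, c[ ^+ 2) ^+ k).
Proof.
have mc : measurable (`]-oo, c[%classic : set R) by exact: measurable_itv.
elim: k => [|k [mE IH]].
  rewrite expr0 (_ : npairs c a 0 = setT); last by apply/seteqP; split.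
  exact: indep_of_setT.
set j := (a + k.*2)%N; set Q := xi j @^-1` `]-oo, c[ `&` xi j.+1 @^-1` `]-oo, c[.
have mQ : measurable Q by apply: measurableI; exact: measurable_preimage.
have E1 : npairs c a k.+1 = npairs c a k `\` Q.
  apply/seteqP; split=> t /=.
    move=> H; split; first by move=> m mk; apply: H; rewrite ltnS ltnW.
    by rewrite /Q /= !in_itv /= => h; apply: (H k).
  move=> [H1 H2] m; rewrite ltnS leq_eqVlt => /orP[/eqP ->|]; last exact: H1.
  by move=> h; apply: H2; rewrite /Q /= !in_itv.
split; first by rewrite E1; exact: measurableD.
move=> I B uI aI mB.
have aI' : all (fun i => ~~ (a <= i < a + k.*2)%N) I.
  by apply: sub_all aI => i; rewrite doubleS; lia.
(* Q intersected with a rectangle is a rectangle with the two further indices j and j + 1, to which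
   the induction hypothesis applies; the probability for k + 1 pairs is then a difference. *)
pose B' i := if i \in I then B i else `]-oo, c[%classic.
have mB' i : measurable (B' i) by rewrite /B'; case: ifP.
have notin l : (a <= l < a + k.+1.*2)%N -> l \notin I.
  by move=> h; apply/negP => /(allP aI); rewrite h.
have jI : j \notin I by apply: notin; rewrite /j doubleS; lia.
have j1I : j.+1 \notin I by apply: notin; rewrite /j doubleS; lia.
have E2 : rect [:: j, j.+1 & I] B' = Q `&` rect I B.
  rewrite !rect_cons setIA /B' (negbTE jI) (negbTE j1I); congr (_ `&` _).
  by apply: eq_rect => i iI; rewrite iI.
have := IH [:: j, j.+1 & I] B'.
rewrite /= inE negb_or jI j1I uI aI' andbT (_ : j != j.+1); last by lia.
rewrite (_ : ~~ (a <= j < j)%N); last by lia.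
rewrite (_ : ~~ (a <= j.+1 < j)%N); last by lia.
move=> /(_ isT isT mB'); rewrite E2 !big_cons {1 2}/B' (negbTE jI) (negbTE j1I).
rewrite (eq_big_seq (fun i => law (B i))); last first.
  by move=> i iI; rewrite /B' iI.
have := IH I B uI aI' mB.
have -> : npairs c a k `&` rect I B =
    (npairs c a k.+1 `&` rect I B) `|` (npairs c a k `&` (Q `&` rect I B)).
  rewrite E1; apply/seteqP; split=> t /=.
    by move=> [h1 h2]; have [q|q] := pselect (Q t); [right | left].
  by move=> [[[h1 h2] h3]|[h1 [h2 h3]]].
have mr : measurable (rect I B) by exact: measurable_rect.
rewrite prsU_disj.
- move=> h1 h2; rewrite exprS mulrBl mul1r mulrBl -h1 -/j h2.
  set x := prs _; set b := \prod_(_ <- _) _; ring.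
- by apply: measurableI => //; rewrite E1; exact: measurableD.
- by apply: measurableI => //; exact: measurableI.
- by rewrite E1; apply/seteqP; split=> t //= -[[[_ h1] _] [_ [h2 _]]].
Qed.

End Independence.

(** * Affine expressions in weights with bounded density *)

Section Density.
Context d (T : measurableType d) (R : realType) (P : probability T R)
  (xi : nat -> {RV P >-> R}).
Hypotheses (xi_indep : mutually_independent xi)
  (xi_ident : identically_distributed xi)
  (xi_gt0 : forall i, {ae P, forall t, 0 < xi i t}).

Let cell (y : R) (k : nat) : set R := [set` `[k%:R * y, k.+1%:R * y[].

(** This takes the place of conditioning on xi_i: the cells partition the nonnegative half-line,
    which carries the whole law, so bounds proportional to the law of each cell add up to a. *)
Lemma prs_cells F i (y a : R) : 0 < y -> 0 <= a -> measurable F ->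
  (forall k, prs P (F `&` xi i @^-1` cell y k) <= a * law xi (cell y k)) ->
  prs P F <= a.
Proof.
move=> y0 a0 mF H; rewrite -lee_fin -prsE //.
have mC k : measurable (cell y k) by exact: measurable_itv.
have mp k : measurable (xi i @^-1` cell y k) by exact: measurable_preimage.
set N := [set t | xi i t <= 0].
have mN : measurable N.
  have -> : N = xi i @^-1` `]-oo, 0].
    by apply/seteqP; split=> t /=; rewrite in_itv.
  exact: measurable_preimage.
have N0 : P N = 0%E.
  apply/negligibleP => //; have := xi_gt0 i; rewrite /almost_everywhere.
  by apply: negligibleS => t /= h; rewrite ltNge h.
set U := \bigcup_k (F `&` xi i @^-1` cell y k).
have mU : measurable U by apply: bigcupT_measurable => k; exact: measurableI.
have FU : F `<=` N `|` U.
  move=> t Ft; have [h|h] := leP (xi i t) 0; [by left | right].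
  exists (Num.truncn (xi i t / y)) => //; split=> //=.
  rewrite /cell /= in_itv /= -ler_pdivlMr // -ltr_pdivrMr //.
  by apply: truncn_itv; rewrite divr_ge0 // ltW.
apply: (@le_trans _ _ (P N + P U)%E).
  apply: le_trans (measureU2 _ _ _) => //; apply: le_measure; rewrite ?inE //.
  exact: measurableU.
rewrite N0 add0e.
apply: (@le_trans _ _ (\sum_(k <oo) a%:E * P (xi i @^-1` cell y k))%E).
  apply: le_trans (generalized_Boole_inequality P _ _) _ => //.
    by move=> k; exact: measurableI.
  apply: lee_nneseries => [k _ _|k _]; first exact: measure_ge0.
  have := H k; rewrite -lee_fin EFinM -(prsE P (measurableI _ _ mF (mp k))).
  by rewrite -(lawE xi_ident i (mC k)).
rewrite nneseriesZl // -measure_semi_bigcup //; last first.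
- exact: bigcupT_measurable.
- apply/trivIsetP => k l _ _; wlog : k l / (k < l)%N.
    by move=> W; rewrite neq_ltn => /orP[] h;
      [|rewrite setIC]; apply: W => //; rewrite neq_ltn h ?orbT.
  move=> kl _; apply/seteqP; split=> t //=; rewrite /cell /= !in_itv /=.
  move=> [/andP[_ h1] /andP[h2 _]]; move: (le_lt_trans h2 h1).
  by rewrite ltr_pM2r // ltr_nat ltnS leqNgt kl.
rewrite -[leRHS]mule1; apply: lee_wpmul2l; first by rewrite lee_fin.
by apply: probability_le1; exact: bigcupT_measurable.
Qed.

Variables (M : R).
Hypotheses (M_ge0 : 0 <= M)
  (law_ub : forall a b, a <= b -> law xi [set` `]a, b]] <= M * (b - a)).

(* Split the value of each xi_i, i in L, into cells of length y; given its cell,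
   s_i xi_i is known up to y, so in the end xi_j lies in a fixed interval of
   length 2 (r + |L| y). *)
Lemma prs_affine_near J E gamma I B j L (s : nat -> R) (y r t : R) :
  indep_of xi J E gamma -> 0 < y -> 0 <= r ->
  uniq (I ++ j :: L) -> all J (I ++ j :: L) -> (forall i, measurable (B i)) ->
  (forall i, `|s i| <= 1) ->
  prs P (E `&` rect xi I B `&` [set w | `|xi j w + \sum_(i <- L) s i * xi i w - t| < r])
    <= gamma * \prod_(i <- I) law xi (B i) * (M * (2 * (r + (size L)%:R * y))).
Proof.
move=> iE y0 + + + + s1; have [mE HE] := iE.
have g0 : 0 <= gamma by rewrite -(indep_of_prs iE) prs_ge0.
elim: L I B r t => [|i L IH] I B r t r0 uIL aIL mB.
  have mIB : measurable (E `&` rect xi I B) by apply: measurableI => //; exact: measurable_rect.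
  have mabs : measurable [set w | `|xi j w + \sum_(i <- [::]) s i * xi i w - t| < r].
    apply: measurable_set_bool; apply: measurable_fun_ltr => //.
    apply: (measurableT_comp (@normr_measurable R setT)) => //.
    apply: measurable_funB => //; apply: measurable_funD => //.
    under eq_fun do rewrite big_nil.
    exact: measurable_cst.
  rewrite cats1 rcons_uniq in uIL; case/andP: uIL => jI uI.
  rewrite all_cat /= andbT in aIL; case/andP: aIL => aI Jj.
  pose B' i := if i == j then [set` `]t - r, t + r]] else B i.
  have mB' i : measurable (B' i) by rewrite /B'; case: ifP.
  have := HE (j :: I) B'; rewrite /= jI uI Jj aI => /(_ isT isT mB').
  rewrite rect_cons big_cons {1 3}/B' eqxx.
  rewrite (eq_rect _ (B' := B)); last first.
    by move=> i iI; rewrite /B' ifN //; apply: contraNneq jI => <-.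
  rewrite (eq_big_seq (fun i => law xi (B i))); last first.
    by move=> i iI; rewrite /B' ifN //; apply: contraNneq jI => <-.
  move=> Heq; apply: (@le_trans _ _ (prs P (E `&` (xi j @^-1` [set` `]t - r, t + r]] `&` rect xi I B)))).
    apply: prs_le; [exact: measurableI | |].
      apply: measurableI => //; apply: measurableI; last exact: measurable_rect.
      exact: measurable_preimage.
    move=> w /= [[h1 h2]]; rewrite big_nil addr0 ltr_norml => /andP[h3 h4].
    by split=> //; split=> //; rewrite in_itv /=; apply/andP; split; lra.
  rewrite Heq mulrCA [leLHS]mulrC ler_wpM2l //.
    by rewrite mulr_ge0 // prodr_ge0 // => k _; exact: law_ge0.
  apply: le_trans (law_ub _) _; first lra.
  by rewrite ler_wpM2l //= mul0r addr0; lra.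
have mC k : measurable (cell y k) by exact: measurable_itv.
have mF : measurable (E `&` rect xi I B `&`
    [set w | `|xi j w + \sum_(i <- i :: L) s i * xi i w - t| < r]).
  apply: measurableI; first by apply: measurableI => //; exact: measurable_rect.
  apply: measurable_set_bool; apply: measurable_fun_ltr => //.
  apply: (measurableT_comp (@normr_measurable R setT)) => //.
  apply: measurable_funB => //; apply: measurable_funD => //.
  by apply: measurable_sum => k; exact: measurable_funM.
apply: (@prs_cells _ i y) => //.
  rewrite mulr_ge0 //.
    by rewrite mulr_ge0 // prodr_ge0 // => k _; exact: law_ge0.
  by rewrite mulr_ge0 // mulr_ge0 // addr_ge0 // mulr_ge0 // ltW.
move=> k.
have pm : perm_eq (I ++ j :: i :: L) ((i :: I) ++ j :: L).
  by apply/seq.permP => a; rewrite /= !count_cat /=; lia.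
have uI' : uniq ((i :: I) ++ j :: L) by rewrite -(perm_uniq pm).
have aI' : all J ((i :: I) ++ j :: L) by rewrite -(perm_all _ pm).
have iI : i \notin I.
  by move: uI'; rewrite /= mem_cat negb_or => /andP[/andP[]].
pose B' l := if l == i then cell y k else B l.
have mB' l : measurable (B' l) by rewrite /B'; case: ifP.
have BB l : l \in I -> B' l = B l.
  by move=> lI; rewrite /B' ifN //; apply: contraNneq iI => <-.
have r0' : 0 <= r + y by rewrite addr_ge0 // ltW.
have := IH (i :: I) B' (r + y) (t - s i * (k%:R * y)) r0' uI' aI' mB'.
rewrite rect_cons big_cons {1 3}/B' eqxx (eq_rect _ BB).
rewrite (eq_big_seq (fun l => law xi (B l))); last by move=> l lI; rewrite BB.
move=> H; rewrite [leRHS](_ : _ = gamma * (law xi (cell y k) * \prod_(i <- I) law xi (B i)) *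
  (M * (2 * (r + y + (size L)%:R * y)))); last first.
  rewrite /= -[(size L).+1]addn1 natrD; ring.
apply: le_trans H; apply: prs_le.
- by apply: measurableI => //; exact: measurable_preimage.
- apply: measurableI.
    apply: measurableI => //; apply: measurableI; last exact: measurable_rect.
    exact: measurable_preimage.
  apply: measurable_set_bool; apply: measurable_fun_ltr => //.
  apply: (measurableT_comp (@normr_measurable R setT)) => //.
  apply: measurable_funB => //; apply: measurable_funD => //.
  by apply: measurable_sum => l; exact: measurable_funM.
move=> w /= [[[h1 h2] h3] h4]; split=> //; rewrite big_cons in h3.
set S := \sum_(_ <- L) _ in h3 *.
have h5 : `|s i * (xi i w - k%:R * y)| <= y.
  move: h4; rewrite /cell /= in_itv /= -[k.+1]addn1 natrD mulrDl mul1r => /andP[h4 h5].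
  rewrite normrM -[leRHS]mul1r ler_pM // ger0_norm; lra.
have -> : xi j w + S - (t - s i * (k%:R * y)) =
   (xi j w + (s i * xi i w + S) - t) - s i * (xi i w - k%:R * y) by ring.
by apply: le_lt_trans (ler_normB _ _) _; apply: ltr_leD.
Qed.

End Density.

Section Estimates.
Context d (T : measurableType d) (R : realType) (P : probability T R)
  (xi : nat -> {RV P >-> R}).
Hypotheses (xi_indep : mutually_independent xi)
  (xi_ident : identically_distributed xi)
  (xi_gt0 : forall i, {ae P, forall t, 0 < xi i t}).
Variables (M : R).
Hypotheses (M_ge0 : 0 <= M)
  (law_ub : forall a b, a <= b -> law xi [set` `]a, b]] <= M * (b - a)).

Let xs w i : R := xi i w.

(** Each of the four events on one weight has probability at most 2My, each of the two on both
    weights at most 4My, which makes 16M; the 1 covers y >= 1. The factor gamma comes out because E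
    is independent of the end weights. *)
Lemma prs_small_ends J E gamma p q y : indep_of xi J E gamma -> (p < q)%N ->
  J q.-1 -> ((0 < p)%N -> J p.-1) -> 0 < y ->
  prs P (E `&` [set w | small_ends (wt (xs w)) p q y]) <= gamma * ((1 + 16 * M) * y).
Proof.
move=> iE pq Jq Jp y0; have [mE _] := iE.
have g0 : 0 <= gamma by rewrite -(indep_of_prs iE) prs_ge0.
pose A j (L : seq nat) (s : nat -> R) t :=
  E `&` [set w | `|xi j w + \sum_(i <- L) s i * xi i w - t| < y].
have mA j L s t : measurable (A j L s t).
  apply: measurableI => //.
  apply: measurable_set_bool; apply: measurable_fun_ltr => //.
  apply: (measurableT_comp (@normr_measurable R setT)) => //.
  apply: measurable_funB => //; apply: measurable_funD => //.
  by apply: measurable_sum => l; exact: measurable_funM.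
have hA j L s t : uniq (j :: L) -> all J (j :: L) -> (forall i, `|s i| <= 1) ->
    prs P (A j L s t) <= gamma * (M * (2 * (y + (size L)%:R * y))).
  move=> uL aL s1.
  have := @prs_affine_near _ _ _ _ _ xi_ident xi_gt0 M M_ge0 law_ub J E gamma
    [::] (fun=> setT) j L s y y t iE y0 (ltW y0) uL aL (fun=> measurableT) s1.
  by rewrite rect_nil setIT big_nil mulr1.
have mN : measurable (E `&` [set w | small_ends (wt (xs w)) p q y]).
  apply: measurableI => //; apply: measurable_set_bool; apply: measurable_small_ends => i.
  exact: measurable_funP.
pose s0 (i : nat) : R := 0; pose s1 (i : nat) : R := 1; pose s2 (i : nat) : R := -1.
have hs0 i : `|s0 i| <= 1 by rewrite normr0.
have hs1 i : `|s1 i| <= 1 by rewrite normr1.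
have hs2 i : `|s2 i| <= 1 by rewrite normrN1.
have My : 0 <= gamma * (M * y) by rewrite !mulr_ge0 // ltW.
have [y1|y1] := leP 1 y.
  apply: (@le_trans _ _ (prs P E)); first by apply: prs_le => // w [].
  rewrite (indep_of_prs iE) -{1}[gamma]mulr1 ler_wpM2l //.
  have : 0 <= M * y by rewrite mulr_ge0 // ltW.
  lra.
have hq1 := hA q.-1 [::] s0 0 isT ltac:(by rewrite /= Jq) hs0.
have hq2 := hA q.-1 [::] s0 1 isT ltac:(by rewrite /= Jq) hs0.
(* [wt] gives the edges 0 and 1 the same variable, so for p = 0 and q = 1 the difference of the end
   weights would vanish; the guard in [small_ends] removes that event. *)
have [p0|p0] := posnP p.
  apply: (@le_trans _ _ (prs P (A q.-1 [::] s0 0 `|` A q.-1 [::] s0 1))).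
    apply: prs_le => //; first exact: measurableU.
    rewrite /A => w /= [h1]; rewrite /small_ends p0 /= orbF leNgt y1 /= !big_nil !addr0 !subr0.
    by move=> /orP[h2|h2]; [left|right].
  apply: le_trans (prsU_le P _ _) _ => //.
  by move: hq1 hq2 My g0 (mulr_ge0 g0 (ltW y0)); rewrite /= ; nra.
have ne : q.-1 != p.-1 by apply/eqP; lia.
have hp1 := hA p.-1 [::] s0 0 isT ltac:(by rewrite /= Jp) hs0.
have hp2 := hA p.-1 [::] s0 1 isT ltac:(by rewrite /= Jp) hs0.
have hm := hA q.-1 [:: p.-1] s2 0 ltac:(by rewrite /= inE ne) ltac:(by rewrite /= Jq Jp) hs2.
have hpl := hA q.-1 [:: p.-1] s1 1 ltac:(by rewrite /= inE ne) ltac:(by rewrite /= Jq Jp) hs1.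
apply: (@le_trans _ _ (prs P ((A q.-1 [::] s0 0 `|` A q.-1 [::] s0 1) `|`
  ((A p.-1 [::] s0 0 `|` A p.-1 [::] s0 1) `|`
   (A q.-1 [:: p.-1] s2 0 `|` A q.-1 [:: p.-1] s1 1))))).
  apply: prs_le => //; first by do !apply: measurableU.
  rewrite /A => w /= [h1]; rewrite /small_ends p0 /= leNgt y1 /= !big_nil !big_cons !big_nil.
  rewrite !addr0 !subr0 /s1 /s2 mulN1r mul1r /wt /xs.
  move=> /or3P[h2|h2|/or4P[h2|h2|h2|h2]].
  - by left; left.
  - by left; right.
  - by right; left; left.
  - by right; left; right.
  - by right; right; left.
  - by right; right; right.
apply: le_trans (prsU_le P _ _) _; [exact: measurableU | by do !apply: measurableU |].
have := prsU_le P (mA q.-1 [::] s0 0) (mA q.-1 [::] s0 1).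
have := prsU_le P (mA p.-1 [::] s0 0) (mA p.-1 [::] s0 1).
have := prsU_le P (mA q.-1 [:: p.-1] s2 0) (mA q.-1 [:: p.-1] s1 1).
have := prsU_le P (measurableU _ _ (mA p.-1 [::] s0 0) (mA p.-1 [::] s0 1))
  (measurableU _ _ (mA q.-1 [:: p.-1] s2 0) (mA q.-1 [:: p.-1] s1 1)).
move: hq1 hq2 hp1 hp2 hm hpl My (mulr_ge0 g0 (ltW y0)); rewrite /= mul0r mul1r; lra.
Qed.

(** Neighbourhoods of the affine hyperplane have arbitrarily small probability; K makes the bound at
    radius e / K less than e. *)
Lemma prs_affine_eq0 j L (s : nat -> R) t : uniq (j :: L) -> (forall i, `|s i| <= 1) ->
  prs P [set w | xi j w + \sum_(i <- L) s i * xi i w = t] = 0.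
Proof.
move=> uL s1; set F := [set w | _].
have mF : measurable F.
  have -> : F = [set w | xi j w + \sum_(i <- L) s i * xi i w - t == 0].
    by apply/seteqP; split => w /=; rewrite subr_eq0 => /eqP.
  apply: measurable_set_bool; apply: measurable_fun_eqr => //.
  apply: measurable_funB => //; apply: measurable_funD => //.
  by apply: measurable_sum => l; exact: measurable_funM.
apply/eqP; rewrite eq_le prs_ge0 andbT; apply/ler_addgt0Pr => e e0; rewrite add0r.
set K := M * (2 * (1 + (size L)%:R)) + 1.
have K0 : 0 < K by rewrite ltr_wpDl // mulr_ge0 // mulr_ge0 // addr_ge0.
have y0 : 0 < e / K by rewrite divr_gt0.
have aT : all predT ([::] ++ j :: L) by exact: all_predT.
have := @prs_affine_near _ _ _ _ _ xi_ident xi_gt0 M M_ge0 law_ub predT setT 1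
    [::] (fun=> setT) j L s (e / K) (e / K) t (indep_of_setT xi_indep xi_ident _) y0 (ltW y0) uL aT (fun=> measurableT) s1.
rewrite rect_nil !setTI big_nil mulr1 mul1r => H.
apply: le_trans (le_trans _ H) _.
  apply: prs_le => //.
    apply: measurable_set_bool; apply: measurable_fun_ltr => //.
    apply: (measurableT_comp (@normr_measurable R setT)) => //.
    apply: measurable_funB => //; apply: measurable_funD => //.
    by apply: measurable_sum => l; exact: measurable_funM.
  by move=> w; rewrite /F /= => ->; rewrite subrr normr0.
have -> : M * (2 * (e / K + (size L)%:R * (e / K))) = (K - 1) * (e / K).
  by rewrite /K; ring.
rewrite mulrBl mulrC divfK ?gt_eqF // mul1r; lra.
Qed.

(** Some k lies in only one of the two sets, so a tie is an affine equation in which xi_k has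
    coefficient 1 and the others -1, 0 or 1; it has probability 0, and there are finitely many
    ties. *)
Lemma ae_no_tie n : {ae P, forall w, forall (E1 E2 : {set 'I_n}) (m1 m2 : 'I_n.+1),
  E1 != E2 -> ~ tie (xs w) E1 E2 m1 m2}.
Proof.
suff H (v : {set 'I_n} * {set 'I_n} * 'I_n.+1 * 'I_n.+1) :
    {ae P, forall w, v.1.1.1 != v.1.1.2 -> ~ tie (xs w) v.1.1.1 v.1.1.2 v.1.2 v.2}.
  have h : {ae P, forall w, forall v : {set 'I_n} * {set 'I_n} * 'I_n.+1 * 'I_n.+1,
      v.1.1.1 != v.1.1.2 -> ~ tie (xs w) v.1.1.1 v.1.1.2 v.1.2 v.2}.
    exact: filter_forall.
  by apply: filterS h => w h E1 E2 m1 m2; exact: (h (E1, E2, m1, m2)).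
case: v => [[[E1 E2] m1] m2] /=.
have [->|ne] := eqVneq E1 E2; first by apply: aeW => w /eqP.
have key (D1 D2 : {set 'I_n}) (k : 'I_n) (k1 k2 : nat) : k \in D1 -> k \notin D2 ->
    {ae P, forall w, ~ tie (xs w) D1 D2 k1 k2}.
  move=> kD1 kD2.
  pose s i : R := if insub i is Some l then (l \in D1)%:R - (l \in D2)%:R else 0.
  have sE (l : 'I_n) : s l = (l \in D1)%:R - (l \in D2)%:R by rewrite /s valK.
  have s1 i : `|s i| <= 1.
    rewrite /s; case: insubP => [l _ _|_]; last by rewrite normr0.
    by case: (l \in D1); case: (l \in D2); rewrite ?subrr ?subr0 ?sub0r ?normrN ?normr0 ?normr1.
  pose L := [seq nat_of_ord l | l <- rem k (enum 'I_n)].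
  have pe : perm_eq (index_enum 'I_n) (k :: rem k (enum 'I_n)).
    by apply: perm_trans (perm_to_rem _); [rewrite enumT | rewrite mem_enum].
  have uL : uniq (nat_of_ord k :: L).
    have := perm_uniq pe; rewrite index_enum_uniq => /esym.
    by rewrite -(map_inj_uniq (@ord_inj n)).
  have := prs_affine_eq0 (k2%:R - k1%:R) uL s1.
  set F := [set w | _] => F0.
  have mF : measurable F.
    have -> : F = [set w | xi k w + \sum_(i <- L) s i * xi i w == k2%:R - k1%:R].
      by apply/seteqP; split => w /= /eqP.
    apply: measurable_set_bool; apply: measurable_fun_eqr => //.
    apply: measurable_funD => //.
    by apply: measurable_sum => l; exact: measurable_funM.
  exists F; split=> //; first by rewrite (prsE P mF) F0.
  move=> w /= /contrapT h; rewrite /F /= /L big_map.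
  have -> : xi k w + \sum_(l <- rem k (enum 'I_n)) s l * xi l w = \sum_(l < n) s l * xi l w.
    by rewrite (perm_big _ pe) /= big_cons sE kD1 (negbTE kD2) subr0 mul1r.
  have -> : \sum_(l < n) s l * xi l w = \sum_(l in D1) xi l w - \sum_(l in D2) xi l w.
    rewrite [X in X - _]big_mkcond [X in _ - X]big_mkcond -sumrB.
    apply: eq_bigr => l _; rewrite sE.
    by case: (l \in D1); case: (l \in D2) => /=; ring.
  by move: h; rewrite /tie /xs; lra.
have [k hk] : exists k, (k \in E1) != (k \in E2).
  apply: contrapT => H; move/eqP: ne; apply; apply/setP => k.
  by apply/eqP; apply: contrapT => /negP h; apply: H; exists k.
case k1 : (k \in E1) hk; case k2 : (k \in E2) => // _.
  apply: filterS (key E1 E2 k m1 m2 k1 (negbT k2)) => w h _; exact: h.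
apply: filterS (key E2 E1 k m2 m1 k2 (negbT k1)) => w h _ t; apply: h.
by move: t; rewrite /tie => ->.
Qed.

End Estimates.

(** * Probabilities of intervals from the density *)

Section LawDensity.
Context d (T : measurableType d) (R : realType) (P : probability T R)
  (xi : nat -> {RV P >-> R}) (g : R -> R).
Hypothesis xi_density : bounded_continuous_density (cdf (xi 0%N)) g.

Let mg (a b : R) : 0 <= a -> measurable_fun (`]a, b]%classic : set R) (fun t => (g t)%:E).
Proof.
move=> a0; have [_ _ cg _] := xi_density.
have sub : (`]a, b]%classic : set R) `<=` `]0, +oo[%classic.
  by move=> t /=; rewrite !in_itv /= andbT => /andP[h _]; exact: le_lt_trans h.
apply/measurable_EFinP; apply: (measurable_funS _ sub); first exact: measurable_itv.
apply: open_continuous_measurable_fun; first exact: interval_open.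
by move=> t; rewrite inE /= in_itv /= andbT => /cg.
Qed.

Lemma law_density (a b : R) : 0 <= a <= b ->
  (law xi [set` `]a, b]])%:E = (\int[lebesgue_measure]_(t in `]a, b]) (g t)%:E)%E.
Proof.
move=> /andP[a0 ab]; have [g0 [M gM] cg cdfE] := xi_density.
have cE x : (law xi `]-oo, x])%:E = (\int[lebesgue_measure]_(t in `]0%R, x]) (g t)%:E)%E.
  by rewrite -cdfE /cdf /law -prsE //; exact: measurable_preimage.
have E1 : law xi `]-oo, b] = law xi `]-oo, a] + law xi `]a, b].
  rewrite /law -prsU_disj.
  - congr prs; rewrite -preimage_setU; congr (_ @^-1` _).
    apply/seteqP; split=> t /=; rewrite !in_itv /=.
      by case: (leP t a) => h1 h2; [left | right].
    by move=> [h|/andP[_ ->//]]; exact: le_trans ab.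
  - exact: measurable_preimage.
  - exact: measurable_preimage.
  - by apply/seteqP; split=> t //= [] /=; rewrite !in_itv /= => h /andP[/lt_geF]; rewrite h.
have ge0 x t : `]0, x]%classic t -> (0 <= (g t)%:E)%E.
  by rewrite /= in_itv /= => /andP[t0 _]; rewrite lee_fin g0.
have E2 : (\int[lebesgue_measure]_(t in `]0%R, b]) (g t)%:E =
   \int[lebesgue_measure]_(t in `]0%R, a]) (g t)%:E +
   \int[lebesgue_measure]_(t in `]a, b]) (g t)%:E)%E.
  have U : `]0, b]%classic = `]0, a]%classic `|` `]a, b]%classic :> set R.
    apply/seteqP; split=> t /=; rewrite !in_itv /=.
      by case: (leP t a) => h1 /andP[h2 h3]; [left; rewrite h2 | right].
    by move=> [/andP[-> h]|/andP[h ->]] /=; [exact: le_trans ab | rewrite (le_lt_trans a0 h)].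
  rewrite {1}U ge0_integral_setU //.
  - by rewrite -U; exact: mg.
  - by move=> t; rewrite -U; exact: ge0.
  - apply/disj_setPS => t /=; rewrite !in_itv /= => -[/andP[_ h] /andP[/lt_geF]].
    by rewrite h.
have := cE b; rewrite E1 EFinD E2 -cE => /(congr1 (fun x => x - (law xi `]-oo, a])%:E)%E).
by rewrite addeAC subee // add0e [X in _ = X -> _]addeAC subee // add0e.
Qed.

(** The density describes positive reals only. There is no mass up to 0, because the distribution
    function at 0 is an integral over an empty interval. *)
Lemma law_ub_density : exists2 M : R, 0 <= M &
  forall a b, a <= b -> law xi [set` `]a, b]] <= M * (b - a).
Proof.
have [g0 [M gM] cg cdfE] := xi_density.
have M0 : 0 <= M by apply: le_trans (g0 1 _) (gM 1 _); exact: ltr01.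
exists M => // a b ab.
have ge0 x y t : 0 <= x -> `]x, y]%classic t -> (0 <= (g t)%:E)%E.
  move=> x0; rewrite /= in_itv /= => /andP[t0 _]; rewrite lee_fin g0 //.
  exact: le_lt_trans t0.
have pos c : 0 <= c <= b -> law xi [set` `]c, b]] <= M * (b - c).
  move=> /andP[c0 cb]; rewrite -lee_fin law_density ?c0 //.
  apply: (@le_trans _ _ (\int[lebesgue_measure]_(t in `]c, b]) M%:E)%E).
    apply: ge0_le_integral => //.
    - by move=> t; exact: ge0.
    - exact: mg.
    - move=> t; rewrite /= in_itv /= => /andP[h _]; rewrite lee_fin gM //.
      exact: le_lt_trans h.
  rewrite integral_cst //= lebesgue_measure_itv /= lte_fin.
  by case: ifP => _; rewrite ?mule0 -?EFinB -?EFinM // lee_fin mulr_ge0 // subr_ge0.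
have cE x : (law xi `]-oo, x])%:E = (\int[lebesgue_measure]_(t in `]0%R, x]) (g t)%:E)%E.
  by rewrite -cdfE /cdf /law -prsE //; exact: measurable_preimage.
have z0 : law xi `]-oo, 0] = 0.
  apply: EFin_inj; rewrite cE (_ : `]0, 0]%classic = set0 :> set R); last first.
    by apply/seteqP; split=> t //=; rewrite in_itv /= => /andP[h1 h2];
       have := lt_le_trans h1 h2; rewrite ltxx.
  by rewrite integral_set0.
have [a0|a0] := leP 0 a; first by apply: pos; rewrite a0.
have neg x : x <= 0 -> law xi [set` `]a, x]] = 0.
  move=> x0; apply/eqP; rewrite eq_le law_ge0 andbT -z0; apply: law_le => //.
  by move=> t /=; rewrite !in_itv /= => /andP[_ h]; exact: le_trans x0.
have [b0|b0] := leP b 0; first by rewrite neg // mulr_ge0 // subr_ge0.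
apply: (@le_trans _ _ (law xi [set` `]a, 0]] + law xi [set` `]0, b]])).
  rewrite /law; apply: le_trans (prsU_le P _ _); [|exact: measurable_preimage..].
  apply: prs_le; first exact: measurable_preimage.
    by apply: measurableU; exact: measurable_preimage.
  move=> t /=; rewrite !in_itv /= => /andP[h1 h2].
  by case: (leP (xi 0%N t) 0) => h3; [left; rewrite h1 | right].
rewrite neg // add0r; apply: le_trans (pos 0 _) _; first by rewrite lexx ltW.
by rewrite ler_wpM2l //; lra.
Qed.

Lemma law_lb_density : 0 < g 2^-1 -> exists m eta : R, [/\ 0 < m, 0 < eta < 2^-1 &
  forall a b, 2^-1 - eta <= a -> a <= b -> b <= 2^-1 + eta ->
    m * (b - a) <= law xi [set` `]a, b]]].
Proof.
move=> gh; have [g0 [M gM] cg cdfE] := xi_density.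
have h0 : 0 < 2^-1 :> R by rewrite invr_gt0.
have : \forall t \near (2^-1 : R), g 2^-1 / 2 < g t.
  have := cg _ h0; move/cvgr_gt; apply; lra.
move=> /nbhs_ballP[e /= e0 he].
exists (g 2^-1 / 2), (Num.min (e / 2) 4^-1); split; first by rewrite divr_gt0.
  rewrite lt_min; apply/andP; split; first by rewrite divr_gt0 //= invr_gt0.
  by rewrite gt_min; apply/orP; right; lra.
set eta := Num.min _ _ => a b ha ab hb.
have e1 : eta <= e / 2 by rewrite ge_min lexx.
have e2 : eta <= 4^-1 by rewrite ge_min lexx orbT.
have a0 : 0 < a by lra.
rewrite -lee_fin law_density ?(ltW a0) //.
apply: (@le_trans _ _ (\int[lebesgue_measure]_(t in `]a, b]) (g 2^-1 / 2)%:E)%E).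
  rewrite integral_cst //= lebesgue_measure_itv /= lte_fin.
  case: ifP => ab'; rewrite -?EFinB -?EFinM lee_fin //.
  have -> : b = a by apply/eqP; rewrite eq_le ab andbT leNgt ab'.
  by rewrite subrr !mulr0.
apply: ge0_le_integral => //.
- by move=> t _; rewrite lee_fin divr_ge0 // ltW.
- by apply: mg; exact: ltW.
- move=> t; rewrite /= in_itv /= => /andP[h1 h2]; rewrite lee_fin ltW //.
  by apply: he; rewrite /ball /= ltr_norml; apply/andP; split; lra.
Qed.

End LawDensity.

(** * Spots: sites that are cheap to flip *)

Section Spots.
Context d (T : measurableType d) (R : realType) (P : probability T R)
  (xi : nat -> {RV P >-> R}).
Hypotheses (xi_indep : mutually_independent xi)
  (xi_ident : identically_distributed xi).
Variables (h c : R) (K : nat).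
Hypothesis h_gt0 : 0 < h.

Let xs w i : R := xi i w.

Lemma prs_rect_disjoint I J B C : uniq I -> uniq J -> ~~ has [in I] J ->
  (forall i, measurable (B i)) -> (forall i, measurable (C i)) ->
  prs P (rect xi I B `&` rect xi J C) = prs P (rect xi I B) * prs P (rect xi J C).
Proof.
move=> uI uJ IJ mB mC; pose D i := if i \in I then B i else C i.
have mD i : measurable (D i) by rewrite /D; case: ifP.
have DJ i : i \in J -> D i = C i.
  by move=> iJ; rewrite /D ifN //; apply: contraNN IJ => iI; apply/hasP; exists i.
have DI i : i \in I -> D i = B i by rewrite /D => ->.
have -> : rect xi I B `&` rect xi J C = rect xi (I ++ J) D.
  rewrite -(eq_rect _ DI) -(eq_rect _ DJ); apply/seteqP; split=> [w [h1 h2] i /=|w h1].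
    by rewrite mem_cat => /orP[iI|iJ]; [exact: h1 | exact: h2].
  by split=> i /= iI; apply: (h1 i); rewrite /= mem_cat iI ?orbT.
rewrite !prs_rect // ?cat_uniq ?uI ?uJ ?IJ // big_cat /=; congr (_ * _).
  by apply: eq_big_seq => i /DI ->.
by apply: eq_big_seq => i /DJ ->.
Qed.

(* At a spot the outer weights put both neighbours of the middle site into every
   optimal set, and the middle weights lie in cells which are symmetric about
   1/2, so that flipping the middle site costs at most h. *)
Definition up_cell k : set R := [set` `]2^-1 + k%:R * h, 2^-1 + k.+1%:R * h]].
Definition down_cell k : set R := [set` `]2^-1 - k.+1%:R * h, 2^-1 - k%:R * h]].

Definition cell_spot k a (x : nat -> R) := [&& x a < c,
  2^-1 + k%:R * h < x a.+1 <= 2^-1 + k.+1%:R * h,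
  2^-1 - k.+1%:R * h < x a.+2 <= 2^-1 - k%:R * h & x a.+3 < c].

Definition spot a x := [exists k : 'I_K, cell_spot k a x].

Definition spot_prob : R :=
  \sum_(k < K) law xi `]-oo, c[ ^+ 2 * (law xi (up_cell k) * law xi (down_cell k)).

Let spot_box k a i : set R := if i == a then `]-oo, c[%classic
  else if i == a.+1 then up_cell k else if i == a.+2 then down_cell k
  else `]-oo, c[%classic.

Let spot_idx a := [:: a; a.+1; a.+2; a.+3].

Lemma measurable_spot_box k a i : measurable (spot_box k a i).
Proof.
by rewrite /spot_box /up_cell /down_cell; case: (i == a); case: (i == a.+1);
  case: (i == a.+2); exact: measurable_itv.
Qed.

Lemma cell_spot_rect k a :
  [set w | cell_spot k a (xs w)] = rect xi (spot_idx a) (spot_box k a).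
Proof.
rewrite !rect_cons rect_nil setIT /spot_box !eqxx.
have -> : (a.+1 == a) = false by lia.
have -> : (a.+2 == a) = false by lia.
have -> : (a.+3 == a) = false by lia.
have -> : (a.+2 == a.+1) = false by lia.
have -> : (a.+3 == a.+1) = false by lia.
have -> : (a.+3 == a.+2) = false by lia.
apply/seteqP; split=> w; rewrite /cell_spot /up_cell /down_cell /= !in_itv /=.
  by move=> /and4P[].
by move=> [h1 [h2 [h3 h4]]]; apply/and4P.
Qed.

Lemma uniq_spot_idx a : uniq (spot_idx a).
Proof. by rewrite /= !inE; lia. Qed.

Lemma measurable_cell_spot k a : measurable_fun setT (fun w => cell_spot k a (xs w)).
Proof.
apply: measurable_bool_set; rewrite cell_spot_rect; apply: measurable_rect.
exact: measurable_spot_box.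
Qed.

Lemma pr_cell_spot k a : pr P (fun w => cell_spot k a (xs w)) =
  law xi `]-oo, c[ ^+ 2 * (law xi (up_cell k) * law xi (down_cell k)).
Proof.
rewrite -[LHS]/(prs P [set w | cell_spot k a (xs w)]) cell_spot_rect prs_rect //.
- rewrite !big_cons big_nil /spot_box !eqxx.
  have -> : (a.+1 == a) = false by lia.
  have -> : (a.+2 == a) = false by lia.
  have -> : (a.+3 == a) = false by lia.
  have -> : (a.+2 == a.+1) = false by lia.
  have -> : (a.+3 == a.+1) = false by lia.
  have -> : (a.+3 == a.+2) = false by lia.
  by rewrite mulr1; ring.
- exact: uniq_spot_idx.
- exact: measurable_spot_box.
Qed.

Lemma pr_cell_spot2 k l a b : (a + 3 < b)%N || (b + 3 < a)%N ->
  pr P (fun w => cell_spot k a (xs w) && cell_spot l b (xs w)) =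
  pr P (fun w => cell_spot k a (xs w)) * pr P (fun w => cell_spot l b (xs w)).
Proof.
move=> ab; have prsetE (f : T -> bool) : pr P f = prs P [set w | f w] by [].
rewrite !prsetE (_ : [set w | _ && _] =
  [set w | cell_spot k a (xs w)] `&` [set w | cell_spot l b (xs w)]); last first.
  by apply/seteqP; split=> w /= => [/andP[] | [-> ->]].
rewrite !cell_spot_rect prs_rect_disjoint //; [exact: uniq_spot_idx.. | | |].
- by apply/hasP => -[i]; rewrite /= !inE => h1 h2; lia.
- exact: measurable_spot_box.
- exact: measurable_spot_box.
Qed.

(** The up cells for different k are disjoint, so at most one term is nonzero. *)
Lemma spot_sum a x : (spot a x)%:R = \sum_(k < K) (cell_spot k a x)%:R :> R.
Proof.
have [/existsP[k hk]|/existsPn H] := boolP (spot a x); last first.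
  by rewrite big1 // => k _; rewrite (negbTE (H k)).
rewrite (bigD1 k) //= hk big1 ?addr0 // => l lk.
suff -> : cell_spot l a x = false by [].
apply/negP => hl; move: hk hl => /and4P[_ /andP[u1 u2] _ _] /and4P[_ /andP[v1 v2] _ _].
have kl (i j : nat) : (i < j)%N -> 2^-1 + i.+1%:R * h <= 2^-1 + j%:R * h.
  by move=> ij; rewrite lerD2l ler_pM2r // ler_nat.
move: lk; rewrite -val_eqE neq_ltn => /orP[/kl|/kl]; lra.
Qed.

Lemma measurable_spot a : measurable_fun setT (fun w => spot a (xs w)).
Proof. by apply: measurable_existsb => k; exact: measurable_cell_spot. Qed.

Lemma ex_spot a : ex P (fun w => (spot a (xs w))%:R) = spot_prob.
Proof.
under [X in ex P X]eq_fun do rewrite spot_sum.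
rewrite ex_sum; last by move=> k; apply: bounded_rv_ind; exact: measurable_cell_spot.
by apply: eq_bigr => k _; rewrite ex_ind ?pr_cell_spot //; exact: measurable_cell_spot.
Qed.

Lemma ex_spot2 a b : (a + 3 < b)%N || (b + 3 < a)%N ->
  ex P (fun w => (spot a (xs w))%:R * (spot b (xs w))%:R) = spot_prob ^+ 2.
Proof.
move=> ab.
have E w : (spot a (xs w))%:R * (spot b (xs w))%:R =
    \sum_(k < K) \sum_(l < K) (cell_spot k a (xs w) && cell_spot l b (xs w))%:R :> R.
  rewrite !spot_sum big_distrlr /=; apply: eq_bigr => k _; apply: eq_bigr => l _.
  by rewrite -natrM mulnb.
under [X in ex P X]eq_fun do rewrite E.
have m2 k l : measurable_fun setT (fun w => cell_spot k a (xs w) && cell_spot l b (xs w)).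
  by apply: measurable_and; exact: measurable_cell_spot.
rewrite ex_sum; last by move=> k; apply: bounded_rv_sum => l; exact: bounded_rv_ind.
rewrite expr2 big_distrlr /=; apply: eq_bigr => k _.
rewrite ex_sum; last by move=> l; exact: bounded_rv_ind.
by apply: eq_bigr => l _; rewrite ex_ind // pr_cell_spot2 // !pr_cell_spot.
Qed.

(** Restricting to i = 3 mod 4 gives each spot a block of four weights of its own, with indices i -
    3 to i; this makes spots independent and keeps them apart. *)
Definition spot_site n x i := [&& (i %% 4 == 3)%N, (i < n)%N & spot (i - 3) x].

Definition spot_count n : nat := cnt n (fun i => (i %% 4 == 3)%N && (i < n)%N).

Lemma cnt_spot n x : (cnt n (spot_site n x))%:R =
  \sum_(i <- [seq i <- index_iota 1 n.+1 | (i %% 4 == 3)%N && (i < n)%N])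
    (spot (i - 3) x)%:R :> R.
Proof.
rewrite big_filter /cnt natr_sum [RHS]big_mkcond /=; apply: eq_bigr => i _.
by rewrite /spot_site; case: (_ == _); case: (_ < _)%N.
Qed.

Lemma bounded_spot a : bounded_rv P (fun w => (spot a (xs w))%:R).
Proof. by apply: bounded_rv_ind; exact: measurable_spot. Qed.

Lemma spot_count_sum n (u : R) :
  \sum_(i <- [seq i <- index_iota 1 n.+1 | (i %% 4 == 3)%N && (i < n)%N]) u =
  (spot_count n)%:R * u.
Proof.
rewrite big_filter big_mkcond /= /spot_count /cnt natr_sum mulr_suml.
by apply: eq_bigr => i _; case: ifP; rewrite ?mul1r ?mul0r.
Qed.

Lemma ex_cnt_spot n : ex P (fun w => (cnt n (spot_site n (xs w)))%:R) =
  (spot_count n)%:R * spot_prob.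
Proof.
under [X in ex P X]eq_fun do rewrite cnt_spot.
rewrite ex_sum; last by move=> i; exact: bounded_spot.
by rewrite -spot_count_sum; apply: eq_bigr => i _; rewrite ex_spot.
Qed.

(** Distinct blocks are independent and an indicator is its own square, so only the diagonal adds to
    the squared mean. *)
Lemma ex_cnt_spot2 n : ex P (fun w => (cnt n (spot_site n (xs w)))%:R ^+ 2) <=
  ((spot_count n)%:R * spot_prob) ^+ 2 + (spot_count n)%:R * spot_prob.
Proof.
set s := [seq i <- index_iota 1 n.+1 | (i %% 4 == 3)%N && (i < n)%N].
have us : uniq s by rewrite filter_uniq // iota_uniq.
have E w : (cnt n (spot_site n (xs w)))%:R ^+ 2 =
    \sum_(i <- s) \sum_(j <- s) (spot (i - 3) (xs w))%:R * (spot (j - 3) (xs w))%:R :> R.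
  by rewrite cnt_spot expr2 big_distrlr.
under [X in ex P X]eq_fun do rewrite E.
have b2 a b : bounded_rv P (fun w => (spot a (xs w))%:R * (spot b (xs w))%:R).
  under [X in bounded_rv P X]eq_fun do rewrite -natrM mulnb.
  by apply: bounded_rv_ind; apply: measurable_and; exact: measurable_spot.
rewrite ex_sum; last by move=> i; exact: bounded_rv_sum.
have -> : ((spot_count n)%:R * spot_prob) ^+ 2 + (spot_count n)%:R * spot_prob =
    \sum_(i <- s) (\sum_(j <- s) spot_prob ^+ 2 + spot_prob).
  by rewrite !spot_count_sum; ring.
rewrite big_seq [leRHS]big_seq; apply: ler_sum => i is_.
rewrite ex_sum // (bigD1_seq i) //= [X in _ <= X + _](bigD1_seq i) //=.
rewrite [X in _ <= X]addrAC lerD //.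
  rewrite -[leLHS]add0r lerD ?sqr_ge0 //.
  under [X in ex P X]eq_fun do rewrite -expr2 -natrX.
  rewrite (_ : (fun x => _) = (fun w => (spot (i - 3) (xs w))%:R)) ?ex_spot //.
  by apply/funext => w; case: (spot _ _).
rewrite big_seq_cond [leRHS]big_seq_cond; apply: ler_sum => j /andP[js ji].
rewrite ex_spot2 //; move: is_ js; rewrite !mem_filter !mem_index_iota.
move=> /andP[/andP[/eqP i3 _] _] /andP[/andP[/eqP j3 _] _]; clear -i3 j3 ji.
have := divn_eq i 4; have := divn_eq j 4; rewrite i3 j3 => E1 E2.
by move: ji; rewrite neq_ltn => /orP[] ji; lia.
Qed.

(** Means of [eps_upper]: the 8 on the left cancels against the constant 4 and the 4 from the
    squared mean, which leaves the variance term 4 / mu. *)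
Lemma ex_le_spot n X (mu := (spot_count n)%:R * spot_prob) : bounded_rv P X -> 0 < mu ->
  (0 < n)%N ->
  {ae P, forall w, X w + 8 / mu * (cnt n (spot_site n (xs w)))%:R <=
    h / n%:R * (cnt n (spot_site n (xs w)))%:R +
    4 / mu ^+ 2 * (cnt n (spot_site n (xs w)))%:R ^+ 2 + 4} ->
  ex P X <= h / n%:R * mu + 4 / mu.
Proof.
move=> bX mu0 n0 H.
have bN : bounded_rv P (fun w => (cnt n (spot_site n (xs w)))%:R).
  under [X in bounded_rv P X]eq_fun do rewrite cnt_spot.
  by apply: bounded_rv_sum => i; exact: bounded_spot.
have bN2 : bounded_rv P (fun w => (cnt n (spot_site n (xs w)))%:R ^+ 2).
  split; first by apply: measurable_funX; exact: bN.1.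
  exists (n%:R ^+ 2); apply: aeW => w; rewrite exprn_ge0 //= lerXn2r ?nnegrE //.
  by rewrite ler_nat; apply: leq_trans (_ : cnt n predT <= _)%N;
    [exact: le_cnt | rewrite /cnt sum_nat_const_nat; lia].
have a8 : 0 <= 8 / mu by rewrite divr_ge0 // ltW.
have ahn : 0 <= h / n%:R by rewrite divr_ge0 // ltW.
have a4 : 0 <= 4 / mu ^+ 2 by rewrite divr_ge0 // exprn_ge0 // ltW.
have b1 := bounded_rvZ a8 bN.
have b2 := bounded_rvZ ahn bN.
have b3 := bounded_rvZ a4 bN2.
have b4 : bounded_rv P (fun=> 4 : R) by exact: bounded_rv_cst.
have := ex_le (bounded_rvD bX b1) (bounded_rvD (bounded_rvD b2 b3) b4) H.
rewrite exD // exD //; last exact: bounded_rvD.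
rewrite exD // !exZ // ex_cst ex_cnt_spot -/mu.
have := ex_cnt_spot2 n; rewrite -/mu => h2.
have : 4 / mu ^+ 2 * ex P (fun w => (cnt n (spot_site n (xs w)))%:R ^+ 2) <=
   4 + 4 / mu.
  apply: le_trans (ler_wpM2l a4 h2) _.
  by rewrite le_eqVlt; apply/orP; left; apply/eqP; field; rewrite gt_eqF.
have -> : 8 / mu * mu = 8 by rewrite divfK // gt_eqF.
lra.
Qed.

End Spots.

(** * Two facts on real sequences *)

Lemma weight_sum_bounded (R : realFieldType) (rho : R) : 0 <= rho < 1 ->
  exists2 S : R, 0 <= S & forall n, \sum_(0 <= u < n) u.+1%:R * rho ^+ u./2 <= S.
Proof.
move=> /andP[r0 r1]; set th := 1 - rho.
have th0 : 0 < th by rewrite subr_gt0.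
pose a := th^-1; pose b := (1 + 2 * a) / th.
have a0 : 0 < a by rewrite invr_gt0.
have b0 : 0 < b by rewrite divr_gt0 //; lra.
(* U u - U (u + 2) dominates the u-th term, so the sum telescopes. *)
pose U (u : nat) := (a * u%:R + b) * rho ^+ u./2.
have U0 u : 0 <= U u.
  by rewrite /U mulr_ge0 ?exprn_ge0 // addr_ge0 ?(ltW b0) // mulr_ge0 // ltW.
exists (U 0%N + U 1%N); first exact: addr_ge0.
have step u : u.+1%:R * rho ^+ u./2 <= U u - U u.+2.
  rewrite /U /= exprS -subr_ge0.
  have -> : (a * u%:R + b) * rho ^+ u./2 - (a * u.+2%:R + b) * (rho * rho ^+ u./2) -
     u.+1%:R * rho ^+ u./2 = (a * u%:R + b - (a * u.+2%:R + b) * rho - u.+1%:R) * rho ^+ u./2.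
    by ring.
  rewrite mulr_ge0 ?exprn_ge0 // -[u.+2]addn2 -[u.+1]addn1 !natrD.
  have -> : rho = 1 - th by rewrite /th; ring.
  have E1 : a * th = 1 by rewrite mulVf // gt_eqF.
  have E2 : b * th = 1 + 2 * a by rewrite /b divfK // gt_eqF.
  have -> : a * u%:R + b - (a * (u%:R + 2%:R) + b) * (1 - th) - (u%:R + 1%:R) =
    (a * th) * u%:R + 2 * (a * th) - 2 * a + b * th - u%:R - 1 by ring.
  rewrite E1 E2; lra.
move=> n; apply: (@le_trans _ _ (U 0%N + U 1%N - U n - U n.+1)).
  elim: n => [|n IH]; first by rewrite big_geq //; lra.
  rewrite big_nat_recr //=; have := step n; lra.
by have := U0 n; have := U0 n.+1; lra.
Qed.

(** a + K is subadditive, so its ratio to n tends to the infimum. As subadditivity holds from n0 on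
    only, n is written as q m + r with n0 <= r < n0 + m. *)
Lemma fekete (R : realType) (a : nat -> R) (n0 : nat) (K : R) : (0 < n0)%N -> 0 <= K ->
  (forall n, (n0 <= n)%N -> 0 <= a n) ->
  (forall m n, (n0 <= m)%N -> (n0 <= n)%N -> a (m + n)%N <= a m + a n + K) ->
  exists l : R, (fun n => a n / n%:R) @ \oo --> l.
Proof.
move=> n00 K0 a0 sub; pose u n := a n + K.
have u0 n : (n0 <= n)%N -> 0 <= u n by move=> h; rewrite addr_ge0 // a0.
pose V := [set u n / n%:R | n in [set n | (n0 <= n)%N]].
have hV : has_inf V.
  split; first by exists (u n0 / n0%:R); exists n0 => //=.
  by exists 0 => _ [n hn <-]; rewrite divr_ge0 // u0.
exists (inf V); apply/cvgrPdist_le => e e0.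
have e20 : 0 < e / 2 by rewrite divr_gt0.
have [_ [m /= hm <-] um] := inf_adherent e20 hV.
have m0 : (0 < m)%N by exact: leq_trans n00 hm.
have m0' : 0 < m%:R :> R by rewrite ltr0n.
have iter q r : (n0 <= r)%N -> u (q * m + r)%N <= q%:R * u m + u r.
  move=> hr; elim: q => [|q IH]; first by rewrite mul0r add0r add0n.
  rewrite mulSn -addnA -[q.+1]addn1 natrD mulrDl mul1r.
  have := sub m (q * m + r)%N hm (leq_trans hr (leq_addl _ _)).
  by move: IH; rewrite /u; lra.
pose B := \sum_(0 <= r < n0 + m) (if (n0 <= r)%N then u r else 0).
have uB r : (n0 <= r < n0 + m)%N -> u r <= B.
  move=> hr; rewrite /B (bigD1_seq r) ?iota_uniq ?mem_index_iota //=; last by lia.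
  rewrite ifT; last by lia.
  rewrite lerDl sumr_ge0 // => i _; case: ifP => // h; exact: u0.
have B0 : 0 <= B by rewrite sumr_ge0 // => r _; case: ifP => // h; exact: u0.
set L := inf V in um *.
have L0 : 0 <= L by apply: (lb_le_inf hV.1) => _ [n hn <-]; rewrite divr_ge0 // u0.
have Lle n : (n0 <= n)%N -> L <= u n / n%:R.
  by move=> hn; apply: (ge_inf hV.2); exists n.
near=> n.
have hn : (n0 <= n)%N by near: n; exact: nbhs_infty_ge.
have hn0 : 0 < n%:R :> R by rewrite ltr0n (leq_trans n00 hn).
have hbig : 2 * (B + K) / e <= n%:R by near: n; exact: nbhs_infty_ger.
have {}hbig : B + K <= n%:R * (e / 2).
  by move: hbig; rewrite ler_pdivrMr //; lra.
have low := Lle n hn.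
have up : u n <= n%:R * (L + e / 2) + B.
  have -> : n = ((n - n0) %/ m * m + (n0 + (n - n0) %% m))%N.
    by have := divn_eq (n - n0) m; clear -hn; lia.
  set q := ((n - n0) %/ m)%N; set r := (n0 + _)%N.
  have hr : (n0 <= r < n0 + m)%N by rewrite /r leq_addr ltn_add2l ltn_pmod.
  apply: le_trans (iter q r _) _; first by case/andP: hr.
  apply: lerD; last exact: uB.
  apply: (@le_trans _ _ (q%:R * (m%:R * (L + e / 2)))).
    by rewrite ler_wpM2l // mulrC -ler_pdivrMr // ltW.
  rewrite mulrA -natrM ler_wpM2r //; first by rewrite addr_ge0 // ltW.
  by rewrite ler_nat leq_addr.
have E : u n = n%:R * (u n / n%:R) by rewrite mulrC divfK // gt_eqF.
have -> : a n / n%:R = (u n - K) / n%:R by rewrite /u addrK.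
rewrite ler_norml; apply/andP; split.
  rewrite lerBrDr -lerBrDl opprK ler_pdivrMr //; lra.
rewrite lerBlDr -lerBlDl ler_pdivlMr //.
by move: low; rewrite ler_pdivlMr //; lra.
Unshelve. all: by end_near. Qed.

(** * Probabilities of unforced runs, bad sites and spots *)

Section Probabilities.
Context d (T : measurableType d) (R : realType) (P : probability T R)
  (xi : nat -> {RV P >-> R}).
Hypotheses (xi_indep : mutually_independent xi)
  (xi_ident : identically_distributed xi)
  (xi_gt0 : forall i, {ae P, forall t, 0 < xi i t}).
Variables (M : R).
Hypotheses (M_ge0 : 0 <= M)
  (law_ub : forall a b, a <= b -> law xi [set` `]a, b]] <= M * (b - a)).
Variable c : R.
Let rho := 1 - law xi `]-oo, c[ ^+ 2.

Let xs w i : R := xi i w.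

Let mxs i : measurable_fun setT (fun w => xs w i).
Proof. exact: measurable_funP. Qed.

Lemma rho_ge0 : 0 <= rho.
Proof. by rewrite subr_ge0 expr_le1 ?law_ge0 // law_le1. Qed.

Lemma rho_le1 : rho <= 1.
Proof. by rewrite gerBl sqr_ge0. Qed.

(** The pairs use weights with indices between p and q - 2 only, hence neither of the edges p and q,
    whose weights have indices p - 1 and q - 1. This is the origin of the exponent and of the
    independence used in [pr_bad]. *)
Lemma unforced_npairs p q w : unforced (wt (xs w)) c p q ->
  npairs xi c p (q - p).-1./2 w.
Proof.
move=> /unforcedP H m mk [h1 h2]; have := H (p + m.*2).+2.
have hm : (p < (p + m.*2).+2 <= q)%N.
  have := odd_double_half (q - p).-1; lia.
by move=> /(_ hm) /negP; apply; rewrite /forced /wt /=; apply/andP.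
Qed.

Lemma prs_npairs p k : prs P (npairs xi c p k) = rho ^+ k.
Proof. exact: indep_of_prs (indep_of_npairs xi_indep xi_ident c p k). Qed.

Lemma pr_unforced p q : pr P (fun w => unforced (wt (xs w)) c p q) <= rho ^+ (q - p).-1./2.
Proof.
rewrite -(prs_npairs p); apply: prs_le.
- by apply: measurable_set_bool; exact: measurable_unforced.
- by have [] := indep_of_npairs xi_indep xi_ident c p (q - p).-1./2.
- by move=> w /=; exact: unforced_npairs.
Qed.

Lemma pr_bad X p q : 0 < X -> (p < q)%N ->
  pr P (fun w => bad (wt (xs w)) c X p q) <=
    rho ^+ (q - p).-1./2 * ((1 + 16 * M) * (X * (q - p)%:R)).
Proof.
move=> X0 pq; set k := (q - p).-1./2.
have y0 : 0 < X * (q - p)%:R by rewrite mulr_gt0 // ltr0n subn_gt0.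
have iE := indep_of_npairs xi_indep xi_ident c p k.
have hk : (p + k.*2 <= q.-1)%N.
  by rewrite /k; have := odd_double_half (q - p).-1; lia.
have Jq : ~~ (p <= q.-1 < p + k.*2)%N by lia.
have Jp : (0 < p)%N -> ~~ (p <= p.-1 < p + k.*2)%N by lia.
apply: le_trans (prs_small_ends xi_ident xi_gt0 M_ge0 law_ub iE pq Jq Jp y0).
apply: prs_le.
- by apply: measurable_set_bool; exact: measurable_bad.
- apply: measurableI; first by case: iE.
  by apply: measurable_set_bool; exact: measurable_small_ends.
- by move=> w /= /andP[/unforced_npairs h1 h2]; split.
Qed.

(** Union bound over all runs through i. With u = i - 1 - p and v = q - i the length is u + v + 1 <=
    (u + 1)(v + 1), and the exponent is at least u./2 + v./2, so the double sum is bounded by a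
    product of two convergent sums. *)
Lemma pr_bad_site : rho < 1 -> exists2 C : R, 0 <= C & forall X n i, 0 < X ->
  (0 < i <= n)%N -> pr P (fun w => bad_site (wt (xs w)) c X n i) <= C * X.
Proof.
move=> r1; have [|S S0 HS] := @weight_sum_bounded R rho; first by rewrite rho_ge0.
have C10 : 0 <= 1 + 16 * M by rewrite addr_ge0 // mulr_ge0.
exists ((1 + 16 * M) * S ^+ 2); first by rewrite mulr_ge0 // exprn_ge0.
move=> X n i X0 /andP[i0 iN].
pose f (p q : nat) w := (p < i <= q)%N && bad (wt (xs w)) c X p q.
have mf p q : measurable_fun setT (f p q).
  by apply: measurable_and; [exact: measurable_cst | exact: measurable_bad].
have bf p q := bounded_rv_ind P (mf p q).
have ms : measurable_fun setT (fun w => bad_site (wt (xs w)) c X n i).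
  by apply: measurable_existsb => p; apply: measurable_existsb => q; exact: mf.
apply: (@le_trans _ _ (\sum_(0 <= p < n.+1) \sum_(0 <= q < n.+1) pr P (f p q))).
  rewrite -(ex_ind P ms).
  have -> : \sum_(0 <= p < n.+1) \sum_(0 <= q < n.+1) pr P (f p q) =
    ex P (fun w => \sum_(0 <= p < n.+1) \sum_(0 <= q < n.+1) (f p q w)%:R).
    rewrite ex_sum; last by move=> p; exact: bounded_rv_sum.
    by apply: eq_bigr => p _; rewrite ex_sum //; apply: eq_bigr => q _; rewrite ex_ind.
  apply: ex_le; first exact: bounded_rv_ind.
    by apply: bounded_rv_sum => p; exact: bounded_rv_sum.
  apply: aeW => w; have [/existsP[p /existsP[q h]]|_] := boolP (bad_site _ _ _ _ _); last first.
    by rewrite sumr_ge0 // => p _; rewrite sumr_ge0.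
  rewrite !big_mkord (bigD1 p) //= !big_mkord (bigD1 q) //=.
  have -> : f p q w = true by exact: h.
  rewrite -addrA lerDl addr_ge0 //; first by rewrite sumr_ge0.
  by rewrite sumr_ge0 // => p' _; rewrite big_mkord sumr_ge0.
pose wgt u : R := u.+1%:R * rho ^+ u./2.
have w0 u : 0 <= wgt u by rewrite mulr_ge0 // exprn_ge0 // rho_ge0.
apply: (@le_trans _ _ (\sum_(0 <= p < i) \sum_(i <= q < n.+1)
    (1 + 16 * M) * X * (wgt (i.-1 - p)%N * wgt (q - i)%N))).
  have zero p q : ~~ (p < i <= q)%N -> pr P (f p q) = 0.
    move=> h; rewrite /pr (_ : [set t | _] = set0) ?measure0 //.
    by apply/seteqP; split=> w //=; rewrite /f (negbTE h).
  rewrite (big_cat_nat (n := i)) //=; last by rewrite ltnW.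
  rewrite [X in _ + X <= _]big_nat [X in _ + X <= _]big1 ?addr0; last first.
    by move=> p /andP[ip _]; rewrite big1 // => q _; rewrite zero //; lia.
  rewrite !big_nat; apply: ler_sum => p /andP[_ pi].
  rewrite (big_cat_nat (n := i)) //=; last by rewrite ltnW.
  rewrite [X in X + _ <= _]big_nat [X in X + _ <= _]big1 ?add0r; last first.
    by move=> q /andP[_ qi]; rewrite zero //; lia.
  rewrite !big_nat; apply: ler_sum => q /andP[iq qn].
  have pq : (p < q)%N by lia.
  apply: (@le_trans _ _ (pr P (fun w => bad (wt (xs w)) c X p q))).
    by apply: le_pr => //; [exact: measurable_bad | apply: aeW => w /andP[]].
  apply: le_trans (pr_bad X0 pq) _.
  have -> : (1 + 16 * M) * X * (wgt (i.-1 - p)%N * wgt (q - i)%N) =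
    rho ^+ ((i.-1 - p)./2 + (q - i)./2) * ((1 + 16 * M) *
      (X * ((i.-1 - p).+1 * (q - i).+1)%N%:R)).
    by rewrite /wgt exprD natrM; ring.
  apply: ler_pM.
  - by rewrite exprn_ge0 // rho_ge0.
  - by rewrite !mulr_ge0 // ltW.
  - rewrite ler_wiXn2l ?rho_ge0 ?rho_le1 //.
    have -> : (q - p).-1 = ((i.-1 - p) + (q - i))%N by lia.
    by rewrite halfD; lia.
  - rewrite ler_wpM2l // ler_wpM2l ?(ltW X0) // ler_nat.
    have -> : (q - p = ((i.-1 - p) + (q - i)).+1)%N by lia.
    by nia.
have -> : \sum_(0 <= p < i) \sum_(i <= q < n.+1)
    (1 + 16 * M) * X * (wgt (i.-1 - p)%N * wgt (q - i)%N) =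
    (1 + 16 * M) * X * ((\sum_(0 <= p < i) wgt p) * (\sum_(0 <= q < n.+1 - i) wgt q)).
  rewrite [X in _ = _ * (X * _)]big_nat_rev /= add0n.
  rewrite big_distrlr mulr_sumr /= !big_nat; apply: eq_bigr => p /andP[_ pi].
  rewrite mulr_sumr -{1}[i]add0n big_addn; apply: eq_bigr => q _.
  by rewrite addnK (_ : (i.-1 - p = i - p.+1)%N) //; lia.
rewrite -mulrA -mulrA ler_wpM2l // mulrC ler_wpM2r ?(ltW X0) //.
rewrite expr2; apply: ler_pM; rewrite ?HS //; apply: sumr_ge0 => *; exact: w0.
Qed.

(** About eta / h pairs of cells, each of probability of order h^2, give a probability of order
    h. *)
Lemma spot_prob_bounds (m eta : R) : 0 < m -> 0 < eta < 2^-1 ->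
  (forall a b, 2^-1 - eta <= a -> a <= b -> b <= 2^-1 + eta ->
    m * (b - a) <= law xi [set` `]a, b]]) ->
  0 < law xi `]-oo, c[ ->
  exists c1 C1 : R, [/\ 0 < c1, 0 <= C1 & forall h, 0 < h <= eta / 2 -> exists K,
    [/\ K%:R * h <= eta, c1 * h <= spot_prob xi h c K & spot_prob xi h c K <= C1 * h]].
Proof.
move=> m0 /andP[e0 e1] Hm; set r := law xi _ => r0.
have r1 : r <= 1 by apply: law_le1.
exists (r ^+ 2 * m ^+ 2 * (eta / 2)), (M ^+ 2 * eta); split.
- by rewrite !mulr_gt0 // exprn_gt0.
- by rewrite mulr_ge0 // ?exprn_ge0 // ltW.
move=> h /andP[h0 h1]; exists (Num.truncn (eta / h)); set K := Num.truncn _.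
have /andP[K1 K2] : K%:R <= eta / h < K.+1%:R.
  by apply: truncn_itv; rewrite divr_ge0 // ltW.
rewrite ler_pdivlMr // in K1; rewrite ltr_pdivrMr // in K2.
have K3 : eta / 2 <= K%:R * h by move: K2; rewrite -[K.+1]addn1 natrD; lra.
split=> //.
- have low (k : 'I_K) : r ^+ 2 * (m * h) ^+ 2 <= r ^+ 2 * (law xi (up_cell h k) * law xi (down_cell h k)).
    have hk : k.+1%:R * h <= eta.
      by apply: le_trans K1; rewrite ler_pM2r // ler_nat.
    have hk0 : 0 <= k%:R * h by rewrite mulr_ge0 // ltW.
    rewrite ler_wpM2l ?sqr_ge0 // expr2; have mh : 0 <= m * h by rewrite mulr_ge0 // ltW.
    have Ek : k.+1%:R * h = k%:R * h + h by rewrite -[k.+1]addn1 natrD mulrDl mul1r.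
    apply: ler_pM => //.
      have -> : m * h = m * (2^-1 + k.+1%:R * h - (2^-1 + k%:R * h)) by rewrite Ek; ring.
      by apply: Hm; rewrite ?Ek; lra.
    have -> : m * h = m * (2^-1 - k%:R * h - (2^-1 - k.+1%:R * h)) by rewrite Ek; ring.
    by apply: Hm; rewrite ?Ek; lra.
  have : \sum_(k < K) r ^+ 2 * (m * h) ^+ 2 <= spot_prob xi h c K by exact: ler_sum.
  rewrite sumr_const card_ord -[X in X <= _]mulr_natr => H; apply: le_trans H.
  have -> : r ^+ 2 * (m * h) ^+ 2 * K%:R = r ^+ 2 * m ^+ 2 * h * (K%:R * h) by ring.
  rewrite [leLHS]mulrAC ler_wpM2l //.
  by rewrite !mulr_ge0 // ?sqr_ge0 // ltW.
- have up (k : 'I_K) : r ^+ 2 * (law xi (up_cell h k) * law xi (down_cell h k)) <= (M * h) ^+ 2.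
    have Ek : k.+1%:R * h = k%:R * h + h by rewrite -[k.+1]addn1 natrD mulrDl mul1r.
    have Mh : 0 <= M * h by rewrite mulr_ge0 // ltW.
    apply: (@le_trans _ _ (law xi (up_cell h k) * law xi (down_cell h k))).
      by rewrite ler_piMl // ?mulr_ge0 ?law_ge0 // expr_le1 // law_ge0.
    rewrite expr2; apply: ler_pM; rewrite ?law_ge0 //.
      apply: le_trans (law_ub _) _; first by rewrite Ek; lra.
      by rewrite Ek ler_wpM2l //; lra.
    apply: le_trans (law_ub _) _; first by rewrite Ek; lra.
    by rewrite Ek ler_wpM2l //; lra.
  have : spot_prob xi h c K <= \sum_(k < K) (M * h) ^+ 2 by exact: ler_sum.
  rewrite sumr_const card_ord -mulr_natr => /le_trans; apply.
  have -> : (M * h) ^+ 2 * K%:R = M ^+ 2 * h * (K%:R * h) by ring.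
  rewrite [leRHS]mulrAC ler_wpM2l //.
  by rewrite !mulr_ge0 // ?sqr_ge0 // ltW.
Qed.

End Probabilities.

(** * Stationarity *)

Section Shift.
Context d (T : measurableType d) (R : realType) (P : probability T R)
  (xi : nat -> {RV P >-> R}).
Hypotheses (xi_indep : mutually_independent xi)
  (xi_ident : identically_distributed xi).

Definition box (N : nat) (B : nat -> set R) : set (nat -> R) :=
  [set x | forall i, (i < N)%N -> B i (x i)].

(** A pi-system that generates the product sigma-algebra on sequences. *)
Definition boxes : set (set (nat -> R)) :=
  [set A | exists N B, (forall i, measurable (B i)) /\ A = box N B].

Lemma boxes_setI : setI_closed boxes.
Proof.
move=> _ _ [N [B [mB ->]]] [N' [B' [mB' ->]]].
exists (maxn N N'), (fun i => (if (i < N)%N then B i else setT) `&`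
  (if (i < N')%N then B' i else setT)); split.
  by move=> i; apply: measurableI; case: ifP.
apply/seteqP; split=> x /=.
  by move=> [h1 h2] i _; split; case: ifP => // h; [exact: h1 | exact: h2].
move=> h; split=> i iN; have [|h1 h2] := h i; rewrite ?leq_max ?iN ?orbT //.
- by move: h1; rewrite iN.
- by move: h2; rewrite iN.
Qed.

Notation seqT := (g_sigma_algebraType boxes).

Lemma measurable_coord i : measurable_fun setT (fun x : seqT => (x : nat -> R) i).
Proof.
move=> _ B mB; rewrite setTI; apply: sub_sigma_algebra.
exists i.+1, (fun j => if j == i then B else setT); split.
  by move=> j; case: ifP.
apply/seteqP; split=> x /=; last by move=> /(_ i (ltnSn i)); rewrite eqxx.
by move=> h j _; case: eqP => // ->.
Qed.

Let Y (k : nat) (w : T) : seqT := shiftx k (fun i => xi i w).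

Lemma preimage_box k N B : Y k @^-1` box N B = rect xi (iota k N) (fun i => B (i - k)%N).
Proof.
apply/seteqP; split=> w /= h i /=.
  rewrite mem_iota => /andP[ki ik]; have := h (i - k)%N; rewrite /Y /shiftx subnKC //.
  by apply; rewrite ltn_subLR.
by move=> iN; have := h (k + i)%N; rewrite /= addKn; apply; rewrite /= mem_iota leq_addr ltn_add2l.
Qed.

Lemma measurable_seq k : measurable_fun setT (Y k).
Proof.
refine (@measurability _ _ T seqT setT (Y k) boxes _ _) => //.
move=> _ [_ [N [B [mB ->]]] <-]; rewrite setTI preimage_box.
by apply: measurable_rect => i; exact: mB.
Qed.

Let Ym k : {mfun T >-> seqT} := HB.pack (Y k) (isMeasurableFun.Build _ _ _ _ _ (measurable_seq k)).

Lemma law_shift k (A : set seqT) : measurable A -> P (Y k @^-1` A) = P (Y 0 @^-1` A).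
Proof.
move=> mA; rewrite -[LHS]/(distribution P (Ym k) A) -[RHS]/(distribution P (Ym 0) A).
apply: (@measure_unique _ R seqT boxes (fun=> setT) _ _ _ _
  (distribution P (Ym k)) (distribution P (Ym 0)) _ _ A mA) => //.
- exact: boxes_setI.
- move=> _; exists 0%N, (fun=> setT); split=> //.
  by apply/seteqP; split=> x.
- by apply/seteqP; split=> // x _; exists 0%N.
- move=> _ [N [B [mB ->]]]; rewrite /distribution /pushforward /=.
  rewrite -[X in P X = _]/(Y k @^-1` box N B) -[X in _ = P X]/(Y 0 @^-1` box N B).
  have mr l : measurable (rect xi (iota l N) (fun i => B (i - l)%N)).
    by apply: measurable_rect => i; exact: mB.
  rewrite !preimage_box !prsE // !(prs_rect xi_indep xi_ident) ?iota_uniq //.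
  congr _%:E; rewrite -[k]addn0 iotaDl big_map; apply: eq_bigr => i _.
  by rewrite addn0 addKn subn0.
- move=> _; rewrite -ge0_fin_numE // fin_num_measure //.
Qed.

(** Gives the second half of a glued chain the mean of a chain that starts at the first weight. *)
Lemma ex_shift (F : (nat -> R) -> R) k : (forall x, 0 <= F x) ->
  measurable_fun setT (fun x : seqT => F x) ->
  ex P (fun w => F (shiftx k (fun i => xi i w))) = ex P (fun w => F (fun i => xi i w)).
Proof.
move=> F0 mF; have mF' : measurable_fun setT (fun x : seqT => (F x)%:E).
  exact/measurable_EFinP.
have E l : ex P (fun w => F (shiftx l (fun i => xi i w))) =
    fine (\int[distribution P (Ym l)]_(x in setT) (F x)%:E)%E.
  rewrite /ex /distribution ge0_integral_pushforward //.
  by move=> x _; rewrite lee_fin.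
rewrite E -[RHS](_ : ex P (fun w => F (shiftx 0 (fun i => xi i w))) = _) // E.
congr fine; apply: eq_measure_integral => A mA _; exact: law_shift.
Qed.

End Shift.

Lemma epsM_ge (R : realType) n delta (x : nat -> R) (A : {set 'I_n}) :
  maximizes x A -> eps x A delta <= epsM n delta x.
Proof. by move=> mA; apply: le_bigmax_cond; apply/maxbP. Qed.

(** A maximizer exists and [eps] is nonnegative at it, so the default 0 of the maximum does no
    harm. *)
Lemma epsM_attained (R : realType) n delta (x : nat -> R) :
  exists2 A : {set 'I_n}, maximizes x A & epsM n delta x = eps x A delta.
Proof.
pose A0 : {set 'I_n} := [arg max_(A > (finset.set0 : {set 'I_n})) fn x A]%O.
have mA0 : maximizes x A0.
  by move=> B; rewrite /A0; case: arg_maxP => // A _ H; exact: H.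
have [z|//] : epsM n delta x = 0 \/
    exists2 A : {set 'I_n}, maximizes x A & epsM n delta x = eps x A delta.
  rewrite /epsM; elim/big_ind : _ => [|a b ha hb|A /maxbP mA]; first by left.
    by rewrite /Num.max; case: ifP.
  by right; exists A.
exists A0 => //; apply/eqP; rewrite eq_le epsM_ge // andbT z; exact: eps_ge0.
Qed.

Lemma epsM_ge0 (R : realType) n delta (x : nat -> R) : 0 <= epsM n delta x.
Proof. by have [A mA ->] := epsM_attained n delta x; exact: eps_ge0. Qed.

Lemma spot_countE n : spot_count n = (n %/ 4)%N.
Proof.
case: n => [|n]; first by rewrite /spot_count /cnt big_geq.
rewrite /spot_count /cnt big_nat_recr //= ltnn andbF addn0.
rewrite (_ : \sum_(1 <= i < n.+1) _ = \sum_(1 <= i < n.+1) (i %% 4 == 3))%N; last first.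
  rewrite !big_nat; apply: eq_bigr => i /andP[_ ->]; by rewrite andbT.
elim: n => [|n IH]; first by rewrite big_geq.
by rewrite big_nat_recr //= IH; lia.
Qed.

(** * Bounds on the mean *)

Section Assembly.
Context d (T : measurableType d) (R : realType) (P : probability T R)
  (xi : nat -> {RV P >-> R}).
Hypotheses (xi_indep : mutually_independent xi)
  (xi_ident : identically_distributed xi)
  (xi_gt0 : forall i, {ae P, forall t, 0 < xi i t}).
Variables (M : R).
Hypotheses (M_ge0 : 0 <= M)
  (law_ub : forall a b, a <= b -> law xi [set` `]a, b]] <= M * (b - a)).
Variable c : R.
Hypotheses (c12 : 0 < c < 2^-1) (law_c : 0 < law xi `]-oo, c[).

Let xs w i : R := xi i w.

Let mxs i : measurable_fun setT (fun w => xs w i).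
Proof. exact: measurable_funP. Qed.

Let rho := 1 - law xi `]-oo, c[ ^+ 2.

Let rho01 : 0 <= rho < 1.
Proof. by rewrite rho_ge0 //= gtrBl exprn_gt0. Qed.

Lemma xs_gt0 : {ae P, forall w i, 0 < xs w i}.
Proof. by apply: ae_foralln => i; exact: xi_gt0. Qed.

Definition mean_epsM n delta : R := ex P (fun w => epsM n delta (xs w)).

(** Makes the competitor at distance n - 1 admissible, so that [eps] is at most 1. *)
Definition big_enough n (delta : R) := (0 < n)%N && (delta * n%:R <= n.-1%:R).

Lemma bounded_epsM n delta : delta <= 1 -> big_enough n delta ->
  bounded_rv P (fun w => epsM n delta (xs w)).
Proof.
move=> d1 /andP[n0 dn]; split; first exact: measurable_epsM.
exists 1; apply: filterS xs_gt0 => w w0; rewrite epsM_ge0 /=.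
by have [A mA ->] := epsM_attained n delta (xs w); exact: eps_le1.
Qed.

Let unf p q w := unforced (wt (xs w)) c p q.

Let munf p q : measurable_fun setT (unf p q).
Proof. exact: measurable_unforced. Qed.

(** One convergent sum of (u + 1) rho^(u./2) serves all three: n times the first probability is at
    most a single term of it. *)
Lemma pr_unforced_le : exists2 S : R, 0 <= S & forall n,
  [/\ (0 < n)%N -> pr P (unf 0 n) <= S / n%:R,
     \sum_(0 <= i < n) pr P (unf i n) <= S &
     forall m, \sum_(0 <= i < n) pr P (unf m (m + i.+1)) <= S].
Proof.
have [S S0 HS] := weight_sum_bounded rho01.
have r0 : 0 <= rho by case/andP: rho01.
have w1 u : rho ^+ u./2 <= u.+1%:R * rho ^+ u./2.
  by rewrite ler_peMl ?exprn_ge0 // -[1]/(1%:R) ler_nat.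
have prU p q : pr P (unf p q) <= rho ^+ (q - p).-1./2.
  exact: (pr_unforced xi_indep xi_ident).
exists S => // n; split.
- case: n => // n _.
  have w0 u : 0 <= u.+1%:R * rho ^+ u./2 by rewrite mulr_ge0 // exprn_ge0.
  apply: le_trans (prU 0%N n.+1) _.
  rewrite subn0 /= ler_pdivlMr // mulrC; apply: le_trans (HS n.+1).
  by rewrite big_nat_recr //= lerDr sumr_ge0.
- apply: le_trans (HS n); rewrite big_nat_rev /= add0n !big_nat; apply: ler_sum => i /andP[_ iN].
  apply: le_trans (prU _ _) _; apply: le_trans (w1 i).
  by rewrite (_ : (n - (n - i.+1)).-1 = i)%N //; clear -iN; lia.
- move=> m; apply: le_trans (HS n); apply: ler_sum => i _.
  apply: le_trans (prU _ _) _.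
  by rewrite addKn; exact: w1.
Qed.

Lemma mean_epsM_lower : exists C S : R, [/\ 0 <= C, 0 <= S &
  forall n delta X, 0 < X <= 1 - 2 * c -> delta <= 1 -> big_enough n delta ->
    X * delta <= mean_epsM n delta + C * X ^+ 2 + S / n%:R].
Proof.
have r1 : rho < 1 by case/andP: rho01.
have [C C0 HC] := pr_bad_site xi_indep xi_ident xi_gt0 M_ge0 law_ub r1.
have [S S0 HS] := pr_unforced_le.
exists C, S; split=> // n delta X /andP[X0 X1] d1 be; have [n0 dn] := andP be.
have n0' : 0 < n%:R :> R by rewrite ltr0n.
pose bs i w := bad_site (wt (xs w)) c X n i.
have mbs i : measurable_fun setT (bs i).
  apply: measurable_existsb => p; apply: measurable_existsb => q.
  by apply: measurable_and; [exact: measurable_cst | exact: measurable_bad].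
have bbs i := bounded_rv_ind P (mbs i).
have bE := bounded_epsM d1 be.
have bcnt : bounded_rv P (fun w => \sum_(1 <= i < n.+1) (bs i w)%:R) by exact: bounded_rv_sum.
have bun := bounded_rv_ind P (munf 0 n).
have Xn0 : 0 <= X * n%:R by rewrite mulr_ge0 // ltW.
have b1 := bounded_rvZ (ler0n R n) bE.
have b2 := bounded_rvZ (ltW X0) bcnt.
have b3 := bounded_rvZ Xn0 bun.
(* The maximum with 0 is for negative delta: [ex_le] asks for nonnegative variables. *)
have main : ex P (fun=> Num.max 0 (X * (delta * n%:R))) <=
    ex P (fun w => n%:R * epsM n delta (xs w) + X * (\sum_(1 <= i < n.+1) (bs i w)%:R) +
     X * n%:R * (unf 0 n w)%:R).
  apply: ex_le.
  - by apply: bounded_rv_cst; rewrite le_max lexx.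
  - by apply: bounded_rvD => //; exact: bounded_rvD.
  apply: filterS xs_gt0 => w w0; rewrite ge_max; apply/andP; split.
    rewrite !addr_ge0 ?mulr_ge0 ?epsM_ge0 ?sumr_ge0 //; exact: ltW.
  have [A mA ->] := epsM_attained n delta (xs w).
  have := eps_lower (c := c) (X := X) w0 n0 d1 c12 _ mA.
  rewrite ltW //= => /(_ X1); rewrite /cnt natr_sum; exact.
move: main; rewrite ex_cst exD //; last exact: bounded_rvD.
rewrite exD // !exZ // ?(ltW X0) // ex_sum // ex_ind //.
rewrite -/(mean_epsM n delta) => main.
have hs : \sum_(1 <= i < n.+1) ex P (fun w => (bs i w)%:R) <= n%:R * (C * X).
  apply: (@le_trans _ _ (\sum_(1 <= i < n.+1) C * X)).
    rewrite !big_nat; apply: ler_sum => i hi; rewrite ex_ind //; exact: HC.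
  by rewrite sumr_const_nat subn1 /= mulr_natl.
have [/(_ n0) hu _ _] := HS n.
have {}main : X * (delta * n%:R) <= n%:R * mean_epsM n delta + X * (n%:R * (C * X)) + X * n%:R * (S / n%:R).
  apply: (@le_trans _ _ (Num.max 0 (X * (delta * n%:R)))); first by rewrite le_max lexx orbT.
  apply: le_trans main _; rewrite !lerD // ?ler_wpM2l // ltW //.
rewrite -(ler_pM2l n0'); have X2 : X <= 1 by case/andP: c12; lra.
have SS : X * (S / n%:R) <= S / n%:R by rewrite ler_piMl // divr_ge0.
apply: (@le_trans _ _ (n%:R * (mean_epsM n delta + C * X ^+ 2 + X * (S / n%:R)))).
  by apply: le_trans (le_trans _ main) _; rewrite le_eqVlt; apply/orP; left; apply/eqP; ring.
by rewrite ler_wpM2l // lerD2l.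
Qed.

Lemma mean_epsM_subadditive : exists2 K : R, 0 <= K & forall n1 n2 delta,
  0 <= delta <= 1 -> big_enough n1 delta -> big_enough n2 delta ->
  big_enough (n1 + n2) delta ->
  (n1 + n2)%:R * mean_epsM (n1 + n2) delta <=
    n1%:R * mean_epsM n1 delta + n2%:R * mean_epsM n2 delta + K.
Proof.
have [S S0 HS] := pr_unforced_le.
exists (4 * S + 7) => [|n1 n2 delta d01 be1 be2 be]; first by rewrite addr_ge0 // mulr_ge0.
have d1 : delta <= 1 by case/andP: d01.
have [n10 _] := andP be1; have [n20 _] := andP be2; have [n0 dn] := andP be.
have bE1 := bounded_epsM d1 be1.
have bE := bounded_epsM d1 be.
have mE2 : measurable_fun setT (fun w => epsM n2 delta (shiftx n1 (xs w))).
  by apply: (measurable_epsM (X := fun w => shiftx n1 (xs w))) => i; exact: mxs.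
have bE2 : bounded_rv P (fun w => epsM n2 delta (shiftx n1 (xs w))).
  split=> //; exists 1; apply: filterS xs_gt0 => w w0; rewrite epsM_ge0 /=.
  have [A mA ->] := epsM_attained n2 delta (shiftx n1 (xs w)).
  by have [h1 h2] := andP be2; apply: eps_le1 => // i; exact: w0.
have E2 : ex P (fun w => epsM n2 delta (shiftx n1 (xs w))) = mean_epsM n2 delta.
  apply: (ex_shift xi_indep xi_ident (F := epsM n2 delta)) => [x|]; first exact: epsM_ge0.
  exact: (@measurable_epsM _ (g_sigma_algebraType (@boxes R)) R (fun x => x) (@measurable_coord R) n2 delta).
pose s1 w : R := \sum_(0 <= i < n1) (unf i n1 w)%:R.
pose s2 w : R := \sum_(0 <= i < n2) (unf n1 (n1 + i.+1) w)%:R.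
have bs1 : bounded_rv P s1 by apply: bounded_rv_sum => i; exact: bounded_rv_ind.
have bs2 : bounded_rv P s2 by apply: bounded_rv_sum => i; exact: bounded_rv_ind.
have b0 := bounded_rvZ (ler0n R (n1 + n2)) bE.
have b1 := bounded_rvZ (ler0n R n1) bE1.
have b2 := bounded_rvZ (ler0n R n2) bE2.
have b3 := bounded_rvZ (ler0n R 2) bs1.
have b4 := bounded_rvZ (ler0n R 2) bs2.
have b5 : bounded_rv P (fun=> 7 : R) by exact: bounded_rv_cst.
have b12 := bounded_rvD b1 b2.
have b123 := bounded_rvD b12 b3.
have b1234 := bounded_rvD b123 b4.
have b12345 := bounded_rvD b1234 b5.
have main := ex_le b0 b12345.
have {}main := main _.
move: main; rewrite exD // exD // exD // exD // !exZ // E2 ex_cst -!/(mean_epsM _ _) => main.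
have hs1 : ex P s1 <= S.
  rewrite /s1 ex_sum; last by move=> i; exact: bounded_rv_ind.
  by have [_ h _] := HS n1; apply: le_trans h; apply: ler_sum => i _; rewrite ex_ind.
have hs2 : ex P s2 <= S.
  rewrite /s2 ex_sum; last by move=> i; exact: bounded_rv_ind.
  by have [_ _ h] := HS n2; apply: le_trans (h n1); apply: ler_sum => i _; rewrite ex_ind.
apply: (@le_trans _ _ (n1%:R * mean_epsM n1 delta + n2%:R * mean_epsM n2 delta + 2 * ex P s1 + 2 * ex P s2 + 7)); last by lra.
apply: main.
have nt := ae_no_tie xi_indep xi_ident xi_gt0 M_ge0 law_ub (n1 + n2).
apply: filterS2 xs_gt0 nt => w w0 wt.
have [A mA EA] := epsM_attained (n1 + n2) delta (xs w).
have [A1 mA1 EA1] := epsM_attained n1 delta (xs w).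
have [A2 mA2 EA2] := epsM_attained n2 delta (shiftx n1 (xs w)).
rewrite EA EA1 EA2 /s1 /s2 -!natr_sum.
apply: eps_glue => //.
by move=> nuf; apply: (unique_max_or_tie w0 c12 mA) nuf => E1 E2' m1 m2 ne; exact: wt.
Qed.

Lemma mean_epsM_upper (m eta : R) : 0 < m -> 0 < eta < 2^-1 -> c + eta <= 2^-1 ->
  (forall a b, 2^-1 - eta <= a -> a <= b -> b <= 2^-1 + eta ->
    m * (b - a) <= law xi [set` `]a, b]]) ->
  exists C delta0 : R, [/\ 0 <= C, 0 < delta0 & forall delta, 0 < delta <= delta0 ->
    delta <= 1 -> exists2 S, 0 <= S & forall n, (4 <= n)%N -> big_enough n delta ->
    mean_epsM n delta <= C * delta ^+ 2 + S / n%:R].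
Proof.
move=> m0 eta12 ceta Hm; have [eta0 _] := andP eta12.
have [c1 [C1 [c10 C10 H]]] := spot_prob_bounds M_ge0 law_ub m0 eta12 Hm law_c.
(* With h = 16 delta / c1 a spot has probability p >= 16 delta. For n >= 4 there are at least n / 8
   possible spots, so mu >= 2 delta n, as [eps_upper] asks. The constant is that of h p <= C1 h^2,
   and delta0 ensures h <= eta / 2. *)
exists ((16 / c1) ^+ 2 * C1), (eta / 2 * c1 / 16); split.
- by rewrite mulr_ge0 // sqr_ge0.
- by rewrite !mulr_gt0 // invr_gt0.
move=> delta /andP[de0 de1] d1.
set h := 16 * delta / c1.
have h0 : 0 < h by rewrite divr_gt0 // mulr_gt0.
have h1 : h <= eta / 2 by rewrite /h ler_pdivrMr // -ler_pdivlMl // mulrC; move: de1; lra.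
have [K [K1 K2 K3]] := H h ltac:(by rewrite h0 h1).
set p := spot_prob xi h c K in K2 K3.
have p16 : 16 * delta <= p by apply: le_trans K2; rewrite /h [c1 * _]mulrC divfK ?gt_eqF.
have p0 : 0 < p by apply: lt_le_trans p16; rewrite mulr_gt0.
exists (32 / p) => [|n n4 be]; first by rewrite divr_ge0 // ltW.
have [n0 dn] := andP be.
have n0' : 0 < n%:R :> R by rewrite ltr0n.
set mu := (spot_count n)%:R * p.
have cn8 : n%:R / 8 <= (spot_count n)%:R :> R.
  by rewrite ler_pdivrMr // -[8]/(8%:R) -natrM ler_nat spot_countE; clear -n4; lia.
have cn : (spot_count n)%:R <= n%:R :> R.
  by rewrite ler_nat spot_countE leq_div.
have mu_lb : n%:R / 8 * p <= mu by rewrite ler_wpM2r // ltW.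
have mu0 : 0 < mu by apply: lt_le_trans mu_lb; rewrite mulr_gt0 // divr_gt0.
apply: (@le_trans _ _ (h / n%:R * mu + 4 / mu)).
  apply: (ex_le_spot xi_indep xi_ident h0 (bounded_epsM d1 be) mu0 n0).
  apply: filterS xs_gt0 => w w0.
  have [A mA ->] := epsM_attained n delta (xs w).
  apply: (eps_upper (h := h) (mu := mu)) => //; first exact: ltW.
    apply: le_trans (_ : n%:R / 16 * p <= _); last by move: mu_lb; lra.
    by rewrite mulrC -mulrA ler_wpM2l ?ler0n //; move: p16; lra.
  move=> i /and3P[/eqP i4 iN /existsP[k /and4P[z1 /andP[z2 z2'] /andP[z3 z3'] z4]]].
  have i3 : (3 <= i)%N by have := divn_eq i 4; rewrite i4; clear; lia.
  have e1 : (i.-2.-1 = i - 3)%N by clear -i3; lia.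
  have e2 : (i.-1.-1 = (i - 3).+1)%N by clear -i3; lia.
  have e3 : (i.-1 = (i - 3).+2)%N by clear -i3; lia.
  have e4 : (i = (i - 3).+3)%N by clear -i3; lia.
  have kh : k.+1%:R * h <= eta.
    by apply: le_trans K1; rewrite ler_pM2r // ler_nat.
  have kh0 : 0 <= k%:R * h by rewrite mulr_ge0 // ltW.
  have Ek : k.+1%:R * h = k%:R * h + h by rewrite -[k.+1]addn1 natrD mulrDl mul1r.
  rewrite Ek in z2' z3 kh.
  split.
  - by rewrite iN andbT; clear -i3; lia.
  - rewrite /spot_site negb_and; apply/orP; left; apply/eqP.
    by have := divn_eq i 4; rewrite i4 => ->; clear; lia.
  - by rewrite /wt /xs e1 e2; lra.
  - by rewrite /wt /xs /= e3 {2}e4; lra.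
  - rewrite /wt /xs e2 e3 ler_norml; apply/andP; split; lra.
apply: lerD.
  apply: (@le_trans _ _ (h * p)).
    rewrite /mu mulrA ler_wpM2r ?(ltW p0) // mulrAC ler_pdivrMr // ler_wpM2l // ltW //.
  apply: (@le_trans _ _ (h * (C1 * h))); first by rewrite ler_wpM2l // ltW.
  by rewrite le_eqVlt; apply/orP; left; apply/eqP; rewrite /h; field; rewrite gt_eqF.
rewrite ler_pdivrMr //; apply: le_trans (_ : 32 / p / n%:R * (n%:R / 8 * p) <= _).
  by rewrite le_eqVlt; apply/orP; left; apply/eqP; field; rewrite !gt_eqF.
by rewrite ler_wpM2l // !divr_ge0 // ltW.
Qed.

End Assembly.

(** * Passage to the limit *)

Lemma big_enough_near (R : realType) (delta : R) : delta < 1 ->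
  exists2 n0 : nat, (0 < n0)%N & forall n, (n0 <= n)%N -> big_enough n delta.
Proof.
move=> d1; have d10 : 0 < 1 - delta by rewrite subr_gt0.
exists (Num.truncn (1 - delta)^-1).+1 => // n hn.
have n0 : (0 < n)%N by exact: leq_trans hn.
rewrite /big_enough n0 /=.
have /andP[_ h] : (Num.truncn (1 - delta)^-1)%:R <= (1 - delta)^-1 < (Num.truncn (1 - delta)^-1).+1%:R.
  by apply: truncn_itv; rewrite invr_ge0 ltW.
have {}h : (1 - delta)^-1 <= n%:R by apply: le_trans (ltW h) _; rewrite ler_nat.
rewrite -[in leLHS](prednK n0) -[n.-1.+1]addn1 natrD.
have : 1 <= n%:R * (1 - delta) by rewrite -ler_pdivrMr // mul1r.
rewrite -{1}(prednK n0) -[n.-1.+1]addn1 natrD; lra.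
Qed.

Lemma cvg_le_add (R : realType) (u : nat -> R) (l b K : R) (n0 : nat) :
  u @ \oo --> l -> 0 <= K -> (forall n, (n0 <= n)%N -> u n <= b + K / n%:R) -> l <= b.
Proof.
move=> ul K0 H; apply/ler_addgt0Pr => e e0.
have e20 : 0 < e / 2 by rewrite divr_gt0.
suff : \forall n \near \oo, l <= b + e by move=> /filter_const; apply.
move/cvgrPdist_le : ul => /(_ _ e20) ul.
near=> n.
have h1 : `|l - u n| <= e / 2 by near: n.
have h2 : 2 * K / e <= n%:R by near: n; exact: nbhs_infty_ger.
have hn0 : (n0 <= n)%N by near: n; exact: nbhs_infty_ge.
have n1 : (0 < n)%N by near: n; exact: nbhs_infty_gt.
have h3 : K / n%:R <= e / 2.
  rewrite ler_pdivrMr ?ltr0n //; move: h2; rewrite ler_pdivrMr //; lra.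
have := H n hn0; move: h1; rewrite ler_norml => /andP[_]; lra.
Unshelve. all: by end_near. Qed.

Lemma cvg_squeeze_add (R : realType) (u v : nat -> R) (l K : R) (n0 : nat) :
  u @ \oo --> l -> 0 <= K ->
  (forall n, (n0 <= n)%N -> u n - K / n%:R <= v n <= u n) -> v @ \oo --> l.
Proof.
move=> ul K0 H; apply/cvgrPdist_le => e e0.
have e20 : 0 < e / 2 by rewrite divr_gt0.
move/cvgrPdist_le : ul => /(_ _ e20) ul.
near=> n.
have h1 : `|l - u n| <= e / 2 by near: n.
have h2 : 2 * K / e <= n%:R by near: n; exact: nbhs_infty_ger.
have hn0 : (n0 <= n)%N by near: n; exact: nbhs_infty_ge.
have n1 : (0 < n)%N by near: n; exact: nbhs_infty_gt.
have h3 : K / n%:R <= e / 2.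
  rewrite ler_pdivrMr ?ltr0n //; move: h2; rewrite ler_pdivrMr //; lra.
have /andP[h4 h5] := H n hn0; move: h1; rewrite !ler_norml => /andP[h6 h7].
by apply/andP; split; lra.
Unshelve. all: by end_near. Qed.

Section Limit.
Context d (T : measurableType d) (R : realType) (P : probability T R)
  (xi : nat -> {RV P >-> R}).
Hypotheses (xi_indep : mutually_independent xi)
  (xi_ident : identically_distributed xi)
  (xi_gt0 : forall i, {ae P, forall t, 0 < xi i t}).
Variables (M : R).
Hypotheses (M_ge0 : 0 <= M)
  (law_ub : forall a b, a <= b -> law xi [set` `]a, b]] <= M * (b - a)).
Variable c : R.
Hypotheses (c12 : 0 < c < 2^-1) (law_c : 0 < law xi `]-oo, c[).

Let xs w i : R := xi i w.

Lemma mean_epsM_cvg delta : 0 <= delta < 1 ->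
  exists l : R, (mean_epsM xi ^~ delta) @ \oo --> l.
Proof.
move=> /andP[d0 d1]; have [n0 n00 Hn] := big_enough_near d1.
have [K K0 HK] := mean_epsM_subadditive xi_indep xi_ident xi_gt0 M_ge0 law_ub c12 law_c.
have [n hn|m n hm hn|l hl] := @fekete R (fun n => n%:R * mean_epsM xi n delta) n0 K n00 K0.
- rewrite mulr_ge0 // -[0](ex_cst P 0); apply: ex_le.
  + exact: bounded_rv_cst.
  + by apply: bounded_epsM => //; [exact: ltW | exact: Hn].
  + by apply: aeW => w; exact: epsM_ge0.
- by apply: HK; rewrite ?d0 ?ltW //; apply: Hn => //; exact: leq_trans (leq_addr _ _).
exists l; apply: cvg_trans hl; apply: near_eq_cvg; near=> n.
rewrite mulrAC mulfV ?mul1r // pnatr_eq0 -lt0n; near: n; exact: nbhs_infty_gt.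
Unshelve. all: by end_near. Qed.

Variable Aopt : forall n : nat, T -> {set 'I_n}.
Hypotheses (Aopt_max : forall n t, maximizes (fun i => xi i t) (Aopt n t))
  (Aopt_meas : forall n (S : {set 'I_n}), measurable [set t | Aopt n t = S]).

Lemma bounded_eps_opt n delta : delta <= 1 -> big_enough n delta ->
  bounded_rv P (fun t => eps (fun i => xi i t) (Aopt n t) delta).
Proof.
move=> d1 /andP[n0 dn]; split.
  (* Measurability of the chosen maximizer enters through a sum over its finitely many values. *)
  rewrite (_ : (fun t => _) = fun t => \sum_(A : {set 'I_n} | Aopt n t == A)
      eps (fun i => xi i t) A delta); last first.
    by apply/funext => t; rewrite (big_pred1 (Aopt n t)) // => A; rewrite /= eq_sym.
  apply: measurable_big_if => [f g|||A].
  - exact: measurable_funD.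
  - exact: measurable_cst.
  - move=> A; apply: measurable_bool_set.
    rewrite (_ : [set t | _] = [set t | Aopt n t = A]) //.
    by apply/seteqP; split=> t /eqP.
  - apply: (measurable_eps (X := fun t i => xi i t)) => i; exact: measurable_funP.
exists 1; apply: filterS (xs_gt0 xi_gt0) => w w0.
by rewrite eps_ge0 ?eps_le1 //; exact: Aopt_max.
Qed.

(** Both quantities agree when the maximizer is unique. Up to a null set this fails only if no site
    is forced, and then they differ by at most 1; hence the choice of maximizer does not affect the
    limit. *)
Lemma mean_opt_bounds : exists2 S : R, 0 <= S & forall n delta, delta <= 1 ->
  big_enough n delta ->
  mean_epsM xi n delta - S / n%:R <=
    ex P (fun t => eps (fun i => xi i t) (Aopt n t) delta) <= mean_epsM xi n delta.
Proof.
have [S S0 HS] := pr_unforced_le xi_indep xi_ident law_c.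
exists S => // n delta d1 be; have [n0 dn] := andP be.
have bO := bounded_eps_opt d1 be.
have bE := bounded_epsM xi_gt0 d1 be.
have mu : measurable_fun setT (fun w => unforced (wt (xs w)) c 0 n).
  by apply: measurable_unforced => i; exact: measurable_funP.
have bu := bounded_rv_ind P mu.
have [/(_ n0) hS _ _] := HS n.
apply/andP; split; last first.
  by apply: ex_le => //; apply: aeW => w; apply: epsM_ge; exact: Aopt_max.
rewrite lerBlDr; apply: (@le_trans _ _ (ex P (fun t => eps (fun i => xi i t) (Aopt n t) delta) +
  ex P (fun w => (unforced (wt (xs w)) c 0 n)%:R))).
  rewrite -exD //; apply: ex_le => //; first exact: bounded_rvD.
  have nt := ae_no_tie xi_indep xi_ident xi_gt0 M_ge0 law_ub n.
  apply: filterS2 (xs_gt0 xi_gt0) nt => w w0 wt.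
  have [A mA ->] := epsM_attained n delta (fun i => xi i w).
  have [uf|nuf] := boolP (unforced _ _ _ _).
    apply: (@le_trans _ _ 1); first exact: eps_le1.
    by rewrite lerDr eps_ge0 //; exact: Aopt_max.
  rewrite addr0 le_eqVlt; apply/orP; left; apply/eqP; congr eps.
  have [_ h] := unique_max_or_tie w0 c12 (@Aopt_max n w)
    (fun E1 E2 m1 m2 ne => wt E1 E2 m1 m2 ne) nuf.
  exact: h.
by rewrite lerD2l ex_ind.
Qed.

End Limit.

Lemma limf_esup_lt_pinfty (R : realType) (f : R -> R) (delta0 C : R) : 0 < delta0 ->
  (forall delta, 0 < delta < delta0 -> f delta <= C) ->
  (limf_esup (fun delta => (f delta)%:E) 0^'+ < +oo)%E.
Proof.
move=> d0 H; apply: (@le_lt_trans _ _ C%:E); last exact: ltry.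
rewrite limf_esupE; apply: (@le_trans _ _ (ereal_sup ((fun delta => (f delta)%:E) @` [set x | 0 < x < delta0]))).
  apply: ereal_inf_lbound; exists [set x | 0 < x < delta0] => //.
  near=> x; apply/andP; split; near: x; [exact: nbhs_right_gt | exact: nbhs_right_lt].
by apply: ub_ereal_sup => _ [x /= hx <-]; rewrite lee_fin H.
Unshelve. all: by end_near. Qed.

Lemma limf_einf_gt0 (R : realType) (f : R -> R) (delta0 C : R) : 0 < delta0 -> 0 < C ->
  (forall delta, 0 < delta < delta0 -> C <= f delta) ->
  (0 < limf_einf (fun delta => (f delta)%:E) 0^'+)%E.
Proof.
move=> d0 C0 H; apply: (@lt_le_trans _ _ C%:E); first by rewrite lte_fin.
rewrite /limf_einf leeNr limf_esupE.
apply: (@le_trans _ _ (ereal_sup ((fun delta => - (f delta)%:E)%E @` [set x | 0 < x < delta0]))).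
  apply: ereal_inf_lbound; exists [set x | 0 < x < delta0] => //.
  near=> x; apply/andP; split; near: x; [exact: nbhs_right_gt | exact: nbhs_right_lt].
by apply: ub_ereal_sup => _ [x /= hx <-]; rewrite lee_fin lerN2 H.
Unshelve. all: by end_near. Qed.

Theorem theorem2 (R : realType) (d : measure_display) (T : measurableType d)
  (P : probability T R) (xi : nat -> {RV P >-> R}) (g : R -> R)
  (xi_indep : mutually_independent xi)
  (xi_ident : identically_distributed xi)
  (xi_gt0 : forall i, {ae P, forall t, 0 < xi i t})
  (xi_density : bounded_continuous_density (cdf (xi 0%N)) g)
  (g_half : 0 < g 2^-1)
  (Aopt : forall n : nat, T -> {set 'I_n})
  (Aopt_max : forall n t, maximizes (fun i => xi i t) (Aopt n t))
  (Aopt_meas : forall n (S : {set 'I_n}), measurable [set t | Aopt n t = S]) :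
  exists epsbar : R -> R,
    [/\ forall delta : R, 0 < delta -> delta < 1 ->
          'E_P[fun t => eps (fun i => xi i t) (Aopt n t) delta]%E
            @[n --> \oo] --> (epsbar delta)%:E,
        (limf_esup (fun delta : R => (delta ^- 2 * epsbar delta)%:E) 0^'+ < +oo)%E &
        (0 < limf_einf (fun delta : R => (delta ^- 2 * epsbar delta)%:E) 0^'+)%E].
Proof.
have [M M0 law_ub] := law_ub_density xi_density.
have [m [eta0 [m0 /andP[e0 e1] law_lb]]] := law_lb_density xi_density g_half.
(* Halving eta0 leaves an interval of positive probability below c inside the range of the density
   bound. As c + eta = 1/2, a weight below c and one of at most 1/2 + eta add up to less than 1, as
   a spot requires. *)
set eta := eta0 / 2; set c := 2^-1 - eta.
have eta12 : 0 < eta < 2^-1 by rewrite /eta; apply/andP; split; lra.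
have c12 : 0 < c < 2^-1 by rewrite /c /eta; apply/andP; split; lra.
have law_lb' a b : 2^-1 - eta <= a -> a <= b -> b <= 2^-1 + eta ->
    m * (b - a) <= law xi [set` `]a, b]].
  by move=> ha ab hb; apply: law_lb => //; move: ha hb; rewrite /eta; lra.
have law_c : 0 < law xi `]-oo, c[.
  apply: (@lt_le_trans _ _ (law xi [set` `]2^-1 - eta0, 2^-1 - 3 / 4 * eta0]])).
    apply: lt_le_trans (law_lb _ _ _ _ _); [|lra..].
    by rewrite mulr_gt0 //; lra.
  apply: law_le => // t /=; rewrite !in_itv /= => /andP[_ h].
  by apply: le_lt_trans h _; rewrite /c /eta; lra.
have cvgM delta : 0 < delta -> delta < 1 ->
    exists l : R, (mean_epsM xi ^~ delta) @ \oo --> l.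
  move=> d0 d1; apply: (mean_epsM_cvg xi_indep xi_ident xi_gt0 M0 law_ub c12 law_c).
  by rewrite ltW.
pose epsbar delta : R := lim (mean_epsM xi ^~ delta @ \oo).
have cvgE delta : 0 < delta -> delta < 1 ->
    (mean_epsM xi ^~ delta) @ \oo --> epsbar delta.
  move=> d0 d1; have [l hl] := cvgM delta d0 d1.
  by apply: cvgP hl.
exists epsbar; split.
- move=> delta d0 d1; have [n0 n00 Hn] := big_enough_near d1.
  have [S S0 HS] := mean_opt_bounds xi_indep xi_ident xi_gt0 M0 law_ub c12 law_c Aopt_max Aopt_meas.
  have h : (fun n => ex P (fun t => eps (fun i => xi i t) (Aopt n t) delta)) @ \oo --> epsbar delta.
    apply: (cvg_squeeze_add (n0 := n0) (cvgE delta d0 d1) S0) => n hn.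
    by apply: HS; [exact: ltW | exact: Hn].
  have {}h : (fun n => (ex P (fun t => eps (fun i => xi i t) (Aopt n t) delta))%:E) @ \oo --> (epsbar delta)%:E.
    by apply: cvg_EFin => //; exact: nearW.
  apply: cvg_trans h; apply: near_eq_cvg; near=> n.
  rewrite -exE ?unlock //; apply: (bounded_eps_opt xi_gt0 Aopt_max Aopt_meas); first exact: ltW.
  by apply: Hn; near: n; exact: nbhs_infty_ge.
- have ceta : c + eta <= 2^-1 by rewrite /c; lra.
  have [C [delta0 [C0 d00 HC]]] := mean_epsM_upper xi_indep xi_ident xi_gt0 M0 law_ub law_c m0 eta12 ceta law_lb'.
  apply: (@limf_esup_lt_pinfty _ _ (Num.min delta0 1) C); first by rewrite lt_min d00 /=.
  move=> delta /andP[d0]; rewrite lt_min => /andP[dd0 d1].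
  have [S S0 HS] := HC delta ltac:(by rewrite d0 ltW) (ltW d1).
  have [n0 n00 Hn] := big_enough_near d1.
  rewrite mulrC ler_pdivrMr ?exprn_gt0 //.
  apply: (cvg_le_add (n0 := maxn n0 4) (cvgE delta d0 d1) S0) => n.
  by rewrite geq_max => /andP[hn n4]; apply: HS => //; exact: Hn.
have [C [S [C0 S0 HC]]] := mean_epsM_lower xi_indep xi_ident xi_gt0 M0 law_ub c12 law_c.
(* The choice X = delta / (2 (C + 1)) makes X delta - C X^2 of order delta^2. *)
set k := 2 * (C + 1).
have k0 : 0 < k by rewrite /k; lra.
apply: (@limf_einf_gt0 _ _ (Num.min 1 (k * (1 - 2 * c))) (k^-1 / 2)).
- by rewrite lt_min ltr01 mulr_gt0 //=; case/andP: c12; lra.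
- by rewrite divr_gt0 // invr_gt0.
move=> delta /andP[d0]; rewrite lt_min => /andP[d1 dk].
have [n0 n00 Hn] := big_enough_near d1.
have HX : 0 < delta / k <= 1 - 2 * c.
  by rewrite divr_gt0 //= ler_pdivrMr // mulrC ltW.
rewrite [leRHS]mulrC ler_pdivlMr ?exprn_gt0 //.
have : delta / k * delta - C * (delta / k) ^+ 2 <= epsbar delta.
  (* Negating the sequence turns the lower bound on the limit into an upper one. *)
  have cN : (fun n => - mean_epsM xi n delta) @ \oo --> - epsbar delta.
    by apply: cvgN; exact: cvgE.
  rewrite -lerN2; apply: (cvg_le_add (n0 := n0) cN S0) => n hn.
  have := HC n delta (delta / k) HX (ltW d1) (Hn n hn); lra.
apply: le_trans.
have -> : delta / k * delta - C * (delta / k) ^+ 2 = k^-1 * (1 - C / k) * delta ^+ 2.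
  by field; rewrite gt_eqF.
rewrite ler_wpM2r ?sqr_ge0 // ler_wpM2l ?invr_ge0 ?(ltW k0) //.
have : C / k <= 2^-1 by rewrite ler_pdivrMr // /k; lra.
lra.
Unshelve. all: by end_near. Qed.
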